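(* Let $k\geq1$ and $\lambda,\mu\in\mathbb{C}$. (i) If $(\lambda,\mu)\neq(0,1)$, then the algebra $\mathcal{I}^k_{\lambda,\mu}(\mathbb{R})$ is isomorphic to $\mathcal{I}^k_{\lambda,\mu}(S^1)$. (ii) If $(\lambda,\mu)=(0,1)$, then $\mathcal{I}^k_{0,1}(\mathbb{R})\cong\mathfrak{t}_2\oplus\mathbb{R}^2$ for $k\geq3$, $\mathcal{I}^2_{0,1}(\mathbb{R})\cong\mathfrak{t}_2\oplus\mathbb{R}$, and $\mathcal{I}^1_{0,1}(\mathbb{R})\cong\mathfrak{t}_2$.
   Context: For a one-dimensional manifold $M\in\{S^1,\mathbb{R}\}$ and $\lambda\in\mathbb{C}$, $\mathcal{F}_\lambda(M)$ denotes the space of smooth $\lambda$-densities $\phi(x)(dx)^\lambda$ on $M$, with $\mathrm{Diff}(M)$-action $\rho^\lambda_{f^{-1}}:\phi(x)(dx)^\lambda\mapsto (f'(x))^\lambda\phi(f(x))(dx)^\lambda$. $\mathcal{D}^k_{\lambda,\mu}(M)$ is the space of linear differential operators $A=\sum_{i=0}^k a_i(x)\frac{d^i}{dx^i}:\mathcal{F}_\lambda(M)\to\mathcal{F}_\mu(M)$ of order $\le k$, with $\mathrm{Diff}(M)$-action $A\mapsto\rho^\mu_f\circ A\circ\rho^\lambda_{f^{-1}}$. $\mathcal{I}^k_{\lambda,\mu}(M)$ is the associative algebra of all linear maps $\mathcal{D}^k_{\lambda,\mu}(M)\to\mathcal{D}^k_{\lambda,\mu}(M)$ commuting with the $\mathrm{Diff}(M)$-action.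 $\mathbb{R}^n$ is the commutative algebra $\mathbb{R}\oplus\cdots\oplus\mathbb{R}$ ($n$ copies); $\mathfrak{t}_2$ is the algebra of lower triangular real $2\times2$ matrices.
   Formalization: Densities are complex-valued, so the invariant algebras are complex (i·Id is central with square −Id) and cannot be isomorphic to real t₂⊕ℝⁿ; t₂ and ℝⁿ are taken over ℂ. Diff(M) is the orientation-preserving group, so that (f')^λ is defined for complex λ. *)

(* Defs.v *)
From Stdlib Require Import Reals.
From Coquelicot Require Import Coquelicot.
Open Scope R_scope.

Definition smooth (f : R -> R) : Prop := forall (n : nat) (x : R), ex_derive_n f n x.

Definition csmooth (phi : R -> C) : Prop :=
  smooth (fun x => Re (phi x)) /\ smooth (fun x => Im (phi x)).

Definition cDn (n : nat) (phi : R -> C) (x : R) : C :=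
  (Derive_n (fun y => Re (phi y)) n x, Derive_n (fun y => Im (phi y)) n x).

(* t ^ l = exp (l * ln t) for t > 0, l complex (principal branch) *)
Definition cpow (t : R) (l : C) : C :=
  (exp (Re l * ln t) * cos (Im l * ln t), exp (Re l * ln t) * sin (Im l * ln t)).

Fixpoint csum (n : nat) (g : nat -> C) : C :=
  match n with
  | O => g O
  | S m => Cplus (csum m g) (g (S m))
  end.

(* S^1 = R / Z: functions on S^1 are 1-periodic functions on R, and
   orientation-preserving diffeomorphisms of S^1 are represented by their lifts. *)
Inductive manifold := MR | MS1.

Definition isfun (M : manifold) (phi : R -> C) : Prop :=
  match M with
  | MR => csmooth phi
  | MS1 => csmooth phi /\ forall x, phi (x + 1) = phi x
  end.

Definition isdiff (M : manifold) (f : R -> R) : Prop :=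
  match M with
  | MR => smooth f /\ (forall x, 0 < Derive f x) /\
          exists g : R -> R, smooth g /\ (forall x, g (f x) = x) /\ (forall y, f (g y) = y)
  | MS1 => smooth f /\ (forall x, 0 < Derive f x) /\ (forall x, f (x + 1) = f x + 1)
  end.

(* rho^lambda_{f^{-1}} : phi (dx)^lambda |-> (f')^lambda (phi o f) (dx)^lambda *)
Definition act (l : C) (f : R -> R) (phi : R -> C) : R -> C :=
  fun x => Cmult (cpow (Derive f x) l) (phi (f x)).

(* An operator sum_{i<=k} a_i d^i/dx^i is represented by its coefficient family a. *)
Definition coefs := nat -> R -> C.

Definition validop (M : manifold) (k : nat) (a : coefs) : Prop :=
  (forall i, (i <= k)%nat -> isfun M (a i)) /\
  (forall i x, (k < i)%nat -> a i x = RtoC 0).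

Definition applyop (k : nat) (a : coefs) (phi : R -> C) : R -> C :=
  fun x => csum k (fun i => Cmult (a i x) (cDn i phi x)).

(* b = rho^mu_f o a o rho^lambda_{f^{-1}}, equivalently
   rho^mu_{f^{-1}} o b = a o rho^lambda_{f^{-1}} (on F_lambda(M)). *)
Definition conjop (M : manifold) (k : nat) (l m : C) (f : R -> R) (a b : coefs) : Prop :=
  forall psi, isfun M psi -> forall x,
    act m f (applyop k b psi) x = applyop k a (act l f psi) x.

Definition coef_eq (a b : coefs) : Prop := forall i x, a i x = b i x.
Definition coef_add (a b : coefs) : coefs := fun i x => Cplus (a i x) (b i x).
Definition coef_scal (c : C) (a : coefs) : coefs := fun i x => Cmult c (a i x).

Definition Op := coefs -> coefs.

Definition in_I (M : manifold) (k : nat) (l m : C) (T : Op) : Prop :=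
  (forall a, validop M k a -> validop M k (T a)) /\
  (forall a b, validop M k a -> validop M k b ->
      coef_eq (T (coef_add a b)) (coef_add (T a) (T b))) /\
  (forall c a, validop M k a -> coef_eq (T (coef_scal c a)) (coef_scal c (T a))) /\
  (forall f, isdiff M f -> forall a b, validop M k a -> validop M k b ->
      conjop M k l m f a b -> conjop M k l m f (T a) (T b)).

Record SAlg := {
  car : Type;
  mem : car -> Prop;
  eqv : car -> car -> Prop;
  add : car -> car -> car;
  mul : car -> car -> car;
  scl : C -> car -> car;
  one : car }.

Definition IAlg (M : manifold) (k : nat) (l m : C) : SAlg := {|
  car := Op;
  mem := in_I M k l m;
  eqv := fun T U => forall a, validop M k a -> coef_eq (T a) (U a);
  add := fun T U a => coef_add (T a) (U a);
  mul := fun T U a => T (U a);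
  scl := fun c T a => coef_scal c (T a);
  one := fun a => a |}.

(* t_2 (+) C^n : lower triangular 2x2 matrices [[p,0],[q,r]] times C^n (componentwise) *)
Definition t2_mul (x y : C * C * C) : C * C * C :=
  let '(p, q, r) := x in let '(p', q', r') := y in
  (Cmult p p', Cplus (Cmult q p') (Cmult r q'), Cmult r r').

Definition T2plus (n : nat) : SAlg := {|
  car := (C * C * C) * (nat -> C);
  mem := fun x => forall j, (n <= j)%nat -> snd x j = RtoC 0;
  eqv := fun x y => fst x = fst y /\ forall j, snd x j = snd y j;
  add := fun x y =>
    (let '(p, q, r) := fst x in let '(p', q', r') := fst y in
       (Cplus p p', Cplus q q', Cplus r r'),
     fun j => Cplus (snd x j) (snd y j));
  mul := fun x y => (t2_mul (fst x) (fst y), fun j => Cmult (snd x j) (snd y j));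
  scl := fun c x =>
    (let '(p, q, r) := fst x in (Cmult c p, Cmult c q, Cmult c r),
     fun j => Cmult c (snd x j));
  one := ((RtoC 1, RtoC 0, RtoC 1), fun j => if Nat.ltb j n then RtoC 1 else RtoC 0) |}.

Definition alg_iso (A B : SAlg) : Prop :=
  exists Phi : car A -> car B,
    (forall x, mem A x -> mem B (Phi x)) /\
    (forall x y, mem A x -> mem A y -> (eqv A x y <-> eqv B (Phi x) (Phi y))) /\
    (forall y, mem B y -> exists x, mem A x /\ eqv B (Phi x) y) /\
    (forall x y, mem A x -> mem A y -> eqv B (Phi (add A x y)) (add B (Phi x) (Phi y))) /\
    (forall x y, mem A x -> mem A y -> eqv B (Phi (mul A x y)) (mul B (Phi x) (Phi y))) /\
    (forall c x, mem A x -> eqv B (Phi (scl A c x)) (scl B c (Phi x))) /\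
    eqv B (Phi (one A)) (one B).

(* Main.v *)
Require Import Defs.
From Stdlib Require Import Reals.
From Coquelicot Require Import Coquelicot.
From Stdlib Require Import ZArith Lra Lia FunctionalExtensionality ClassicalEpsilon.
Open Scope R_scope.

(** Write f^*B for the operator (f')^m o B(f) o (f')^(-l) transported by a diffeomorphism f, so that
an invariant T is a linear map with T(f^*B) = f^*(T B). No continuity of T is assumed; locality
comes from invariance. If A vanishes near x0, it is fixed by all f supported near x0, hence so is
T A, and T A is near x0 a constant times an invariant operator: the identity (l = m), d/dx
((l, m) = (0, 1)), or 0. On the line the constant vanishes by a swindle: an operator A_+ supported
in a right half-line is b - tau b with b the sum of the translates of A_+. On the circle with
l = m it vanishes by induction on the order j: every positive density w is the top coefficient of
some K^(-j) f^*(d^j) with K the integral of w^(-1/j), so w -> (T (w d^j))_0(x0) is both linear and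
proportional to the nonlinear K^(-j), hence zero.

Local invariant maps on the circle and on the line determine each other, since germs of operators
and of diffeomorphisms extend from one to the other; this gives (i).

For (l, m) = (0, 1), T is determined by its values on d^j and on x d, because locally any positive
function is the top coefficient of some f^*(d^j), j <> 1, and f d = f^*(x d). If T kills the orders
below j >= 4, then T(d^j) = 0: take f with (f')^(1-j) = 1 + x; affine invariance shows that
T((1 + x) d^j) has no first-order term, whereas f^*(d^j) has one. So five scalars determine T, and
they are realized by combinations of id, A -> A*, A -> A(1), A -> A*(1) and A -> g d with
dg = A(1) - A*(1). *)

(** * Smooth functions of a real variable *)

(** The pair (0, 1) is studied on the line only because locality fails for it on the circle: the map
    sending A to (integral of A(1)) d is invariant but not local. For l = m the circle needs its own
    argument since its translations are periodic, so an infinite sum of translates makes no sense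
    there. For (0, 1), order 1 stands apart because the factor (f')^(1-j) is trivial at j = 1: f^*d
    = d carries no information, so x d has to join the generators. The bound j >= 4 comes from two
    separate failures. At j = 2 affine invariance allows a first-order term in T((1 + x) d^2); at j
    = 3 the first-order term of f^*(d^3) vanishes for the chosen f. These two orders supply the two
    free scalars next to the triangular block. *)

Fixpoint diffn (n : nat) (f : R -> R) : Prop :=
  match n with
  | O => True
  | S n => (forall x, ex_derive f x) /\ diffn n (Derive f)
  end.

Lemma Derive_n_Derive (n : nat) (f : R -> R) : Derive_n (Derive f) n = Derive_n f (S n).
Proof.
  induction n as [|n IH]; [reflexivity|].
  extensionality x. simpl. apply Derive_ext. intro t. now rewrite IH.
Qed.

Lemma smooth_step (f : R -> R) :
  smooth f <-> (forall x, ex_derive f x) /\ smooth (Derive f).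
Proof.
  split.
  - intro H. split; [exact (fun x => H 1%nat x)|].
    intros [|n] x; [exact I|].
    simpl. apply ex_derive_ext with (Derive_n f (S n)).
    + intro t. now rewrite Derive_n_Derive.
    + exact (H (S (S n)) x).
  - intros [H1 H2] [|[|n]] x; [exact I|exact (H1 x)|].
    simpl. generalize (H2 (S n) x). simpl. apply ex_derive_ext.
    intro t. now rewrite Derive_n_Derive.
Qed.

(** [Derive_n] adds the last derivative outside, while [diffn] strips the first one. The latter
    suits inductions in which f is replaced by its derivative through the product or chain rule. *)
Lemma smooth_diffn (f : R -> R) : smooth f <-> forall n, diffn n f.
Proof.
  split.
  - intros H n. revert f H. induction n as [|n IH]; intros f H; [exact I|].
    apply smooth_step in H. destruct H. split; auto.
  - intros H n. revert f H. induction n as [|n IH]; intros f H x; [exact I|].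
    destruct n as [|n]; [exact (proj1 (H 1%nat) x)|].
    simpl. apply ex_derive_ext with (Derive_n (Derive f) n).
    + intro t. now rewrite Derive_n_Derive.
    + apply (IH (Derive f)). intro m. exact (proj2 (H (S m))).
Qed.

Lemma diffn_le (n : nat) : forall f, diffn (S n) f -> diffn n f.
Proof.
  induction n as [|n IH]; intros f H; [exact I|].
  destruct H as [H1 H2]. split; auto.
Qed.

Lemma diffn_const (n : nat) (c : R) : diffn n (fun _ => c).
Proof.
  revert c. induction n as [|n IH]; intro c; [exact I|]. split.
  - intro x. apply ex_derive_const.
  - replace (Derive (fun _ => c)) with (fun _ : R => 0); [apply IH|].
    extensionality x. now rewrite Derive_const.
Qed.

Lemma diffn_plus (n : nat) : forall f g, diffn n f -> diffn n g -> diffn n (fun x => f x + g x).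
Proof.
  induction n as [|n IH]; intros f g Hf Hg; [exact I|].
  destruct Hf as [Hf1 Hf2], Hg as [Hg1 Hg2]. split.
  - intro x. now apply @ex_derive_plus.
  - replace (Derive (fun x => f x + g x)) with (fun x => Derive f x + Derive g x); [now apply IH|].
    extensionality x. now rewrite Derive_plus.
Qed.

Lemma diffn_mult (n : nat) : forall f g, diffn n f -> diffn n g -> diffn n (fun x => f x * g x).
Proof.
  induction n as [|n IH]; intros f g Hf Hg; [exact I|].
  pose proof (diffn_le _ _ Hf). pose proof (diffn_le _ _ Hg).
  destruct Hf as [Hf1 Hf2], Hg as [Hg1 Hg2]. split.
  - intro x. now apply ex_derive_mult.
  - replace (Derive (fun x => f x * g x)) with (fun x => Derive f x * g x + f x * Derive g x).
    + apply diffn_plus; now apply IH.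
    + extensionality x. now rewrite Derive_mult.
Qed.

Lemma diffn_comp (n : nat) : forall f g, diffn n f -> diffn n g -> diffn n (fun x => f (g x)).
Proof.
  induction n as [|n IH]; intros f g Hf Hg; [exact I|].
  pose proof (diffn_le _ _ Hg).
  destruct Hf as [Hf1 Hf2], Hg as [Hg1 Hg2]. split.
  - intro x. now apply ex_derive_comp.
  - replace (Derive (fun x => f (g x))) with (fun x => Derive g x * Derive f (g x)).
    + apply diffn_mult; [assumption|]. apply (IH (Derive f) g); auto.
    + extensionality x. symmetry. now apply Derive_comp.
Qed.

Lemma diffn_inv (n : nat) : forall f, (forall x, f x <> 0) -> diffn n f -> diffn n (fun x => / f x).
Proof.
  induction n as [|n IH]; intros f H0 Hf; [exact I|].
  pose proof (diffn_le _ _ Hf).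
  destruct Hf as [Hf1 Hf2]. split.
  - intro x. now apply ex_derive_inv.
  - replace (Derive (fun x => / f x)) with (fun x => (-1) * Derive f x * (/ f x * / f x)).
    + apply diffn_mult; [apply diffn_mult; [apply diffn_const|assumption]|].
      apply diffn_mult; now apply IH.
    + extensionality x. rewrite (Derive_inv f x (Hf1 x) (H0 x)). field. apply H0.
Qed.

Section SmoothClosure.
Implicit Types f g : R -> R.

Lemma smooth_const (c : R) : smooth (fun _ => c).
Proof. apply smooth_diffn. intro n. apply diffn_const. Qed.

Lemma smooth_id : smooth (fun x => x).
Proof.
  apply smooth_step. split; [intro; apply ex_derive_id|].
  replace (Derive (fun x => x)) with (fun _ : R => 1); [apply smooth_const|].
  extensionality x. now rewrite Derive_id.
Qed.

Lemma smooth_plus f g : smooth f -> smooth g -> smooth (fun x => f x + g x).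
Proof. rewrite !smooth_diffn. intros Hf Hg n. now apply diffn_plus. Qed.

Lemma smooth_mult f g : smooth f -> smooth g -> smooth (fun x => f x * g x).
Proof. rewrite !smooth_diffn. intros Hf Hg n. now apply diffn_mult. Qed.

Lemma smooth_comp f g : smooth f -> smooth g -> smooth (fun x => f (g x)).
Proof. rewrite !smooth_diffn. intros Hf Hg n. now apply diffn_comp. Qed.

Lemma smooth_inv f : (forall x, f x <> 0) -> smooth f -> smooth (fun x => / f x).
Proof. rewrite !smooth_diffn. intros H Hf n. now apply diffn_inv. Qed.

Lemma smooth_opp f : smooth f -> smooth (fun x => - f x).
Proof.
  intro H. replace (fun x => - f x) with (fun x => (-1) * f x) by (extensionality x; ring).
  apply smooth_mult; [apply smooth_const|assumption].
Qed.

Lemma smooth_minus f g : smooth f -> smooth g -> smooth (fun x => f x - g x).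
Proof. intros Hf Hg. apply smooth_plus; [assumption|now apply smooth_opp]. Qed.

Lemma smooth_div f g : (forall x, g x <> 0) -> smooth f -> smooth g -> smooth (fun x => f x / g x).
Proof. intros H Hf Hg. apply smooth_mult; [assumption|now apply smooth_inv]. Qed.

Lemma smooth_pow f (n : nat) : smooth f -> smooth (fun x => f x ^ n).
Proof.
  intro H. induction n as [|n IH]; simpl; [apply smooth_const|]. now apply smooth_mult.
Qed.

Lemma smooth_Derive f : smooth f -> smooth (Derive f).
Proof. intro H. now apply smooth_step in H. Qed.

Lemma smooth_ex_derive f : smooth f -> forall x, ex_derive f x.
Proof. intro H. now apply smooth_step in H. Qed.

Lemma smooth_is_derive f : smooth f -> forall x, is_derive f x (Derive f x).
Proof. intros H x. apply Derive_correct. now apply smooth_ex_derive. Qed.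

Lemma smooth_continuous f : smooth f -> forall x, continuous f x.
Proof. intros H x. apply @ex_derive_continuous. now apply smooth_ex_derive. Qed.

Lemma smooth_of_derive f g : (forall x, is_derive f x (g x)) -> smooth g -> smooth f.
Proof.
  intros H Hg. apply smooth_step. split; [intro x; eexists; apply H|].
  replace (Derive f) with g; [assumption|].
  extensionality x. symmetry. now apply is_derive_unique.
Qed.

Lemma smooth_exp : smooth exp.
Proof.
  apply smooth_diffn. intro n. induction n as [|n IH]; [exact I|]. split.
  - intro x. eexists. apply is_derive_exp.
  - replace (Derive exp) with exp; [assumption|].
    extensionality x. symmetry. apply is_derive_unique, is_derive_exp.
Qed.

Lemma smooth_sin_cos : smooth sin /\ smooth cos.
Proof.
  assert (H : forall n, diffn n sin /\ diffn n cos).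
  { induction n as [|n [IH1 IH2]]; [now split|]. split; split.
    - intro x. eexists. apply is_derive_sin.
    - replace (Derive sin) with cos; [assumption|].
      extensionality x. symmetry. apply is_derive_unique, is_derive_sin.
    - intro x. eexists. apply is_derive_cos.
    - replace (Derive cos) with (fun x => (-1) * sin x).
      + apply diffn_mult; [apply diffn_const|assumption].
      + extensionality x. symmetry. apply is_derive_unique.
        replace (-1 * sin x) with (- sin x) by ring. apply is_derive_cos. }
  split; apply smooth_diffn; intro n; apply H.
Qed.

Lemma smooth_ln f : (forall x, 0 < f x) -> smooth f -> smooth (fun x => ln (f x)).
Proof.
  intros H0 Hf. apply smooth_of_derive with (fun x => Derive f x * / f x).
  - intro x. apply (is_derive_comp ln f x (/ f x) (Derive f x)).
    + now apply is_derive_ln.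
    + now apply smooth_is_derive.
  - apply smooth_mult; [now apply smooth_Derive|].
    apply smooth_inv; [|assumption]. intro x. specialize (H0 x). lra.
Qed.

Lemma smooth_local f :
  (forall x, exists g, smooth g /\ locally x (fun y => f y = g y)) -> smooth f.
Proof.
  intros H n x. destruct (H x) as [g [Hg Hl]].
  apply ex_derive_n_ext_loc with g; [|apply Hg].
  apply filter_imp with (2 := Hl). intros y Hy. now symmetry.
Qed.

End SmoothClosure.

Lemma locally_Rabs (x e : R) : 0 < e -> locally x (fun y => Rabs (y - x) < e).
Proof. intro H. exists (mkposreal e H). intros y Hy. exact Hy. Qed.

Lemma locally_Rabs_ex (x : R) (P : R -> Prop) :
  locally x P <-> exists e, 0 < e /\ forall y, Rabs (y - x) < e -> P y.
Proof.
  split.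
  - intros [e He]. exists e. split; [apply cond_pos|]. exact He.
  - intros [e [H He]]. exists (mkposreal e H). exact He.
Qed.

Lemma locally_continuous (f : R -> R) (x : R) (P : R -> Prop) :
  continuous f x -> locally (f x) P -> locally x (fun y => P (f y)).
Proof. intros H HP. apply H. exact HP. Qed.

(* Each case only matches the head symbol syntactically, so that unification stays first-order. *)
Ltac smooth :=
  lazymatch goal with |- smooth ?F => change (smooth (fun x => F x)) | _ => idtac end; cbv beta;
  lazymatch goal with
  | |- smooth (fun _ => ?c) => apply smooth_const
  | |- smooth (fun x => x) => apply smooth_id
  | |- smooth (fun x => @?f x + @?g x) => apply (smooth_plus f g); smooth
  | |- smooth (fun x => @?f x - @?g x) => apply (smooth_minus f g); smooth
  | |- smooth (fun x => @?f x * @?g x) => apply (smooth_mult f g); smooth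
  | |- smooth (fun x => @?f x / ?c) => apply (smooth_mult f (fun _ => / c)); smooth
  | |- smooth (fun x => - @?f x) => apply (smooth_opp f); smooth
  | |- smooth (fun x => @?f x ^ ?n) => apply (smooth_pow f n); smooth
  | |- smooth (fun x => exp (@?f x)) => apply (smooth_comp exp f); [apply smooth_exp|smooth]
  | |- smooth (fun x => ln (@?f x)) => apply (smooth_ln f); [auto|smooth]
  | |- smooth (fun x => Derive ?f x) => apply (smooth_Derive f); smooth
  | |- smooth (fun x => ?h x) => auto
  | |- smooth (fun x => ?h (@?f x)) => apply (smooth_comp h f); [smooth|smooth]
  | |- _ => auto
  end.

Lemma exp_mult_INR (s : R) (n : nat) : exp s ^ n = exp (INR n * s).
Proof.
  induction n as [|n IH]; [simpl; now rewrite Rmult_0_l, exp_0|].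
  rewrite S_INR. simpl. rewrite IH, <- exp_plus. f_equal. ring.
Qed.

Lemma Rabs_triang_minus (x y z : R) : Rabs (x - z) <= Rabs (x - y) + Rabs (y - z).
Proof. replace (x - z) with ((x - y) + (y - z)) by ring. apply Rabs_triang. Qed.

(** * Flat functions, smooth steps and bumps *)

Section FlatFunction.

(** The powers of 1/x make the span of this family closed under differentiation, so one induction
    proves all members smooth. *)
Definition flat (n : nat) (x : R) : R :=
  if Rlt_dec 0 x then (/ x) ^ n * exp (- / x) else 0.

Lemma exp_ge_pow (N : nat) (y : R) : 0 <= y -> (0 < N)%nat -> y ^ N <= INR N ^ N * exp y.
Proof.
  intros Hy HN. assert (HN' : 0 < INR N) by now apply lt_0_INR.
  replace y with (INR N * (y / INR N)) at 1 2 by (field; lra).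
  rewrite Rpow_mult_distr. apply Rmult_le_compat_l; [apply pow_le; lra|].
  replace (exp (INR N * (y / INR N))) with (exp (y / INR N) ^ N).
  - apply pow_incr. split.
    + apply Rmult_le_pos; [lra|]. left. now apply Rinv_0_lt_compat.
    + left. apply Rlt_le_trans with (1 + y / INR N); [lra|]. apply exp_ineq1_le.
  - apply exp_mult_INR.
Qed.

(** This is [exp_ge_pow] at y = 1/x with exponent n + 2; the two spare powers of x make the
    difference quotient at 0 tend to 0. *)
Lemma flat_bound (n : nat) (x : R) : Rabs (flat n x) <= INR (n + 2) ^ (n + 2) * x ^ 2.
Proof.
  unfold flat. destruct (Rlt_dec 0 x) as [H|H].
  - assert (Hi : 0 < / x) by now apply Rinv_0_lt_compat.
    rewrite Rabs_pos_eq by (apply Rmult_le_pos; [apply pow_le; lra|left; apply exp_pos]).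
    assert (E := exp_ge_pow (n + 2) (/ x) ltac:(lra) ltac:(lia)).
    apply Rmult_le_reg_r with (exp (/ x)); [apply exp_pos|].
    rewrite Rmult_assoc, <- exp_plus, Rplus_opp_l, exp_0, Rmult_1_r.
    replace ((/ x) ^ n) with ((/ x) ^ (n + 2) * x ^ 2).
    + replace (INR (n + 2) ^ (n + 2) * x ^ 2 * exp (/ x))
        with (INR (n + 2) ^ (n + 2) * exp (/ x) * x ^ 2) by ring.
      apply Rmult_le_compat_r; [apply pow2_ge_0|assumption].
    + rewrite pow_add. simpl. field. lra.
  - rewrite Rabs_R0. apply Rmult_le_pos; [apply pow_le, pos_INR|apply pow2_ge_0].
Qed.

Lemma flat_derive (n : nat) (x : R) :
  is_derive (flat n) x (flat (n + 2) x - INR n * flat (n + 1) x).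
Proof.
  destruct (Rtotal_order x 0) as [H|[H|H]].
  - apply is_derive_ext_loc with (fun _ => 0).
    + apply locally_Rabs_ex. exists (- x). split; [lra|]. intros y Hy.
      apply Rabs_def2 in Hy. unfold flat. destruct (Rlt_dec 0 y); lra.
    + unfold flat. destruct (Rlt_dec 0 x); [lra|].
      replace (0 - INR n * 0) with 0 by ring. apply @is_derive_const.
  - subst x. replace (flat (n + 2) 0 - INR n * flat (n + 1) 0) with 0.
    2: { unfold flat. destruct (Rlt_dec 0 0); lra. }
    apply is_derive_Reals. intros eps Heps.
    set (K := INR (n + 2) ^ (n + 2)).
    assert (HK : 0 <= K) by (apply pow_le, pos_INR).
    assert (Hd : 0 < eps / (K + 1)) by (apply Rdiv_lt_0_compat; lra).
    exists (mkposreal _ Hd). intros h Hh0 Hh. simpl in Hh.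
    replace (flat n 0) with 0 by (unfold flat; destruct (Rlt_dec 0 0); lra).
    rewrite Rplus_0_l. unfold Rminus. rewrite Ropp_0, !Rplus_0_r.
    rewrite Rabs_div by assumption.
    assert (B := flat_bound n h). fold K in B.
    assert (Ha : 0 < Rabs h) by now apply Rabs_pos_lt.
    apply Rle_lt_trans with (K * Rabs h).
    + apply Rmult_le_reg_r with (Rabs h); [assumption|].
      replace (Rabs (flat n h) / Rabs h * Rabs h) with (Rabs (flat n h)) by (field; lra).
      apply Rle_trans with (1 := B).
      replace (K * Rabs h * Rabs h) with (K * Rabs h ^ 2) by ring.
      rewrite <- Rsqr_pow2, <- (Rsqr_pow2 (Rabs h)), <- Rsqr_abs. lra.
    + apply Rle_lt_trans with ((K + 1) * Rabs h); [nra|].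
      apply Rmult_lt_reg_r with (/ (K + 1)); [apply Rinv_0_lt_compat; lra|].
      replace ((K + 1) * Rabs h * / (K + 1)) with (Rabs h) by (field; lra). exact Hh.
  - apply is_derive_ext_loc with (fun y => (/ y) ^ n * exp (- / y)).
    + apply locally_Rabs_ex. exists x. split; [lra|]. intros y Hy.
      apply Rabs_def2 in Hy. unfold flat. destruct (Rlt_dec 0 y); lra.
    + unfold flat. destruct (Rlt_dec 0 x); [|lra].
      auto_derive; [lra|]. rewrite !pow_add.
      destruct n as [|n]; [simpl; field; lra|].
      rewrite Nat.pred_succ. rewrite S_INR. simpl. field. lra.
Qed.

Lemma flat_smooth (n : nat) : smooth (flat n).
Proof.
  apply smooth_diffn. intro N. revert n. induction N as [|N IH]; intro n; [exact I|]. split.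
  - intro x. eexists. apply flat_derive.
  - replace (Derive (flat n)) with (fun x => flat (n + 2) x + (- INR n) * flat (n + 1) x).
    + apply diffn_plus; [apply IH|]. apply diffn_mult; [apply diffn_const|apply IH].
    + extensionality x. symmetry. apply is_derive_unique.
      replace (flat (n + 2) x + - INR n * flat (n + 1) x)
        with (flat (n + 2) x - INR n * flat (n + 1) x) by ring. apply flat_derive.
Qed.

Lemma flat0_pos (x : R) : 0 < x -> 0 < flat 0 x.
Proof. intro H. unfold flat. destruct (Rlt_dec 0 x); [|lra]. simpl. rewrite Rmult_1_l. apply exp_pos. Qed.

Lemma flat_nonneg (n : nat) (x : R) : 0 <= flat n x.
Proof.
  unfold flat. destruct (Rlt_dec 0 x); [|lra].
  apply Rmult_le_pos; [|left; apply exp_pos]. apply pow_le. left. now apply Rinv_0_lt_compat.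
Qed.

Lemma flat_neg (n : nat) (x : R) : x <= 0 -> flat n x = 0.
Proof. intro H. unfold flat. destruct (Rlt_dec 0 x); lra. Qed.

Definition step (x : R) : R := flat 0 x / (flat 0 x + flat 0 (1 - x)).

Lemma step_den (x : R) : 0 < flat 0 x + flat 0 (1 - x).
Proof.
  destruct (Rlt_dec 0 x) as [H|H].
  - pose proof (flat0_pos x H). pose proof (flat_nonneg 0 (1 - x)). lra.
  - pose proof (flat0_pos (1 - x) ltac:(lra)). pose proof (flat_nonneg 0 x). lra.
Qed.

Lemma smooth_flat_refl : smooth (fun x => flat 0 (1 - x)).
Proof.
  apply (smooth_comp (flat 0)); [apply flat_smooth|smooth].
Qed.

Lemma step_smooth : smooth step.
Proof.
  apply smooth_div.
  - intro x. pose proof (step_den x). lra.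
  - apply flat_smooth.
  - apply smooth_plus; [apply flat_smooth|apply smooth_flat_refl].
Qed.

Lemma step_0 (x : R) : x <= 0 -> step x = 0.
Proof. intro H. unfold step. rewrite (flat_neg 0 x H). unfold Rdiv. ring. Qed.

Lemma step_1 (x : R) : 1 <= x -> step x = 1.
Proof.
  intro H. unfold step. rewrite (flat_neg 0 (1 - x)) by lra. rewrite Rplus_0_r.
  pose proof (flat0_pos x ltac:(lra)). field. lra.
Qed.

Lemma step_bound (x : R) : 0 <= step x <= 1.
Proof.
  pose proof (step_den x). pose proof (flat_nonneg 0 x). pose proof (flat_nonneg 0 (1 - x)).
  unfold step. split.
  - apply Rmult_le_pos; [assumption|]. left. now apply Rinv_0_lt_compat.
  - apply Rmult_le_reg_r with (flat 0 x + flat 0 (1 - x)); [assumption|].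
    unfold Rdiv. rewrite Rmult_assoc, Rinv_l; lra.
Qed.

Lemma step_Derive_nonneg (x : R) : 0 <= Derive step x.
Proof.
  pose proof (step_den x) as Hd.
  pose proof (flat_nonneg 0 x). pose proof (flat_nonneg 0 (1 - x)).
  pose proof (flat_nonneg 2 x). pose proof (flat_nonneg 2 (1 - x)).
  assert (D1 : is_derive (flat 0) x (flat 2 x)).
  { replace (flat 2 x) with (flat (0 + 2) x - INR 0 * flat (0 + 1) x) by (simpl; ring).
    apply flat_derive. }
  assert (D2 : is_derive (fun x => flat 0 (1 - x)) x (- flat 2 (1 - x))).
  { replace (- flat 2 (1 - x)) with ((-1) * (flat (0 + 2) (1 - x) - INR 0 * flat (0 + 1) (1 - x)))
      by (simpl; ring).
    apply (is_derive_comp (flat 0) (fun x => 1 - x)); [apply flat_derive|].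
    auto_derive; [exact I|ring]. }
  unfold step.
  assert (D3 : is_derive (fun x => flat 0 x + flat 0 (1 - x)) x (flat 2 x + - flat 2 (1 - x)))
    by (apply @is_derive_plus; assumption).
  assert (D4 := is_derive_div _ _ x _ _ D1 D3 ltac:(lra)).
  rewrite (is_derive_unique _ _ _ D4).
  apply Rmult_le_pos.
  - ring_simplify. apply Rplus_le_le_0_compat; now apply Rmult_le_pos.
  - left. apply Rinv_0_lt_compat. now apply pow_lt.
Qed.

(** Using t ^ 2 instead of |t| keeps the bump smooth at 0; for 0 < a < b it falls from 1 to 0 while
    |t| runs from a to b. *)
Definition bump (a b t : R) : R := step ((b ^ 2 - t ^ 2) / (b ^ 2 - a ^ 2)).

Lemma bump_smooth (a b : R) : smooth (bump a b).
Proof.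
  apply (smooth_comp step); [apply step_smooth|smooth].
Qed.

Lemma bump_1 (a b t : R) : 0 < a < b -> Rabs t <= a -> bump a b t = 1.
Proof.
  intros H Ht. apply step_1. apply Rabs_le_between in Ht.
  assert (0 < b ^ 2 - a ^ 2) by nra.
  apply Rmult_le_reg_r with (b ^ 2 - a ^ 2); [assumption|].
  unfold Rdiv. rewrite Rmult_assoc, Rinv_l by lra. nra.
Qed.

Lemma bump_0 (a b t : R) : 0 < a < b -> b <= Rabs t -> bump a b t = 0.
Proof.
  intros H Ht. apply step_0.
  assert (0 < b ^ 2 - a ^ 2) by nra.
  assert (b ^ 2 <= t ^ 2).
  { rewrite <- (pow2_abs t). apply pow_incr. lra. }
  apply Rmult_le_reg_r with (b ^ 2 - a ^ 2); [assumption|].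
  unfold Rdiv. rewrite Rmult_assoc, Rinv_l by lra. lra.
Qed.

Lemma bump_bound (a b t : R) : 0 <= bump a b t <= 1.
Proof. apply step_bound. Qed.

(** The bump does not grow with |t|, so t times its derivative is at most 0 and the product rule
    leaves at most the value of the bump. This one-sided bound is what [slope_diffeo] needs for
    ratios in (0, 1]. *)
Lemma bump_slope (a b t : R) : 0 < a < b -> Derive (fun t => t * bump a b t) t <= 1.
Proof.
  intro H. assert (0 < b ^ 2 - a ^ 2) by nra.
  rewrite Derive_mult; [|apply ex_derive_id|apply smooth_ex_derive, bump_smooth].
  rewrite Derive_id. unfold bump at 2.
  rewrite (Derive_comp step).
  2: apply smooth_ex_derive, step_smooth.
  2: auto_derive; lra.
  replace (Derive (fun t => (b ^ 2 - t ^ 2) / (b ^ 2 - a ^ 2)) t)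
    with (- 2 * t / (b ^ 2 - a ^ 2)).
  2: { symmetry. apply is_derive_unique. auto_derive; [lra|]. field. simpl in *. lra. }
  pose proof (bump_bound a b t).
  pose proof (step_Derive_nonneg ((b ^ 2 - t ^ 2) / (b ^ 2 - a ^ 2))) as Hs.
  revert Hs. generalize (Derive step ((b ^ 2 - t ^ 2) / (b ^ 2 - a ^ 2))). intros s Hs.
  assert (0 <= / (b ^ 2 - a ^ 2)) by (left; now apply Rinv_0_lt_compat).
  assert (0 <= t ^ 2 * / (b ^ 2 - a ^ 2) * s).
  { apply Rmult_le_pos; [|assumption]. apply Rmult_le_pos; [apply pow2_ge_0|assumption]. }
  unfold Rdiv. nra.
Qed.

End FlatFunction.

#[global] Hint Resolve flat_smooth step_smooth bump_smooth smooth_exp : core.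

(** * Periodization and diffeomorphisms *)

Section MeanValue.
Implicit Types f g : R -> R.

Lemma derive_mvt f (x y : R) : smooth f ->
  exists c, Rmin x y <= c <= Rmax x y /\ f y - f x = Derive f c * (y - x).
Proof.
  intro H. apply MVT_gen.
  - intros t _. now apply smooth_is_derive.
  - intros t _. apply continuity_pt_filterlim. now apply smooth_continuous.
Qed.

Lemma derive_0_eq f (x y : R) :
  (forall t, Rmin x y <= t <= Rmax x y -> is_derive f t 0) -> f x = f y.
Proof.
  intro H. destruct (MVT_gen f x y (fun _ => 0)) as [c [_ Hc]].
  - intros t Ht. apply H. lra.
  - intros t Ht. apply continuity_pt_filterlim, @ex_derive_continuous. exists 0. now apply H.
  - lra.
Qed.

Lemma derive_pos_lt f (x y : R) : smooth f -> (forall t, 0 < Derive f t) -> x < y -> f x < f y.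
Proof.
  intros Hf H0 Hxy. destruct (derive_mvt f x y Hf) as [c [_ Hc]]. specialize (H0 c). nra.
Qed.

Lemma smooth_primitive g : smooth g -> exists F, smooth F /\ forall x, is_derive F x (g x).
Proof.
  intro H. exists (RInt g 0).
  assert (D : forall x, is_derive (RInt g 0) x (g x)).
  { intro x. apply is_derive_RInt with 0; [|now apply smooth_continuous].
    apply filter_forall. intro y. apply @RInt_correct.
    apply @ex_RInt_continuous. intros z _. now apply smooth_continuous. }
  split; [|assumption]. now apply smooth_of_derive with g.
Qed.

Lemma smooth_inverse f : smooth f -> (forall x, 0 < Derive f x) -> (forall y, exists x, f x = y) ->
  exists g, smooth g /\ (forall x, g (f x) = x) /\ (forall y, f (g y) = y).
Proof.
  intros Hf H0 Hs.
  set (g := fun y => proj1_sig (constructive_indefinite_description _ (Hs y))).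
  assert (fg : forall y, f (g y) = y).
  { intro y. unfold g. now destruct (constructive_indefinite_description _ (Hs y)). }
  assert (mono : forall x y, f x < f y -> x < y).
  { intros x y H. destruct (Rlt_le_dec x y) as [|L]; [assumption|].
    destruct L as [L|L]; [|subst; lra]. pose proof (derive_pos_lt f y x Hf H0 L). lra. }
  assert (gf : forall x, g (f x) = x).
  { intro x. pose proof (fg (f x)) as E.
    destruct (Rtotal_order (g (f x)) x) as [L|[L|L]]; [|assumption|];
    pose proof (derive_pos_lt f _ _ Hf H0 L); lra. }
  exists g. split; [|now split].
  assert (Hcont : forall y e, 0 < e -> locally y (fun z => Rabs (g z - g y) < e)).
  { intros y e He.
    pose proof (derive_pos_lt f (g y - e) (g y) Hf H0 ltac:(lra)) as L1.
    pose proof (derive_pos_lt f (g y) (g y + e) Hf H0 ltac:(lra)) as L2.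
    rewrite fg in L1, L2. apply locally_Rabs_ex.
    exists (Rmin (y - f (g y - e)) (f (g y + e) - y)). split; [apply Rmin_pos; lra|].
    intros z Hz. apply Rabs_def2 in Hz.
    pose proof (Rmin_l (y - f (g y - e)) (f (g y + e) - y)).
    pose proof (Rmin_r (y - f (g y - e)) (f (g y + e) - y)).
    apply Rabs_def1.
    - assert (g z < g y + e); [|lra]. apply mono. rewrite fg. lra.
    - assert (g y - e < g z); [|lra]. apply mono. rewrite fg. lra. }
  assert (D : forall y, is_derive g y (/ Derive f (g y))).
  { intro y. apply is_derive_Reals. intros eps Heps.
    assert (Hc : continuous (fun x => / Derive f x) (g y)).
    { apply (smooth_continuous (fun x => / Derive f x)).
      apply smooth_inv; [intro x; specialize (H0 x); lra|now apply smooth_Derive]. }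
    pose proof (locally_continuous _ _ _ Hc (locally_Rabs (/ Derive f (g y)) eps Heps)) as L.
    apply locally_Rabs_ex in L. destruct L as [d [Hd L]].
    specialize (Hcont y d Hd). apply locally_Rabs_ex in Hcont. destruct Hcont as [d' [Hd' L']].
    exists (mkposreal _ Hd'). intros h Hh0 Hh. simpl in Hh.
    destruct (derive_mvt f (g y) (g (y + h)) Hf) as [c [Hc1 Hc2]].
    rewrite !fg in Hc2.
    replace ((g (y + h) - g y) / h) with (/ Derive f c).
    - apply L. apply Rle_lt_trans with (Rabs (g (y + h) - g y)).
      + revert Hc1. unfold Rmin, Rmax. destruct (Rle_dec (g y) (g (y + h))); intro;
          [rewrite !Rabs_pos_eq by lra; lra|].
        rewrite (Rabs_minus_sym c), (Rabs_minus_sym (g (y + h))), !Rabs_pos_eq; lra.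
      + apply L'. now replace (y + h - y) with h by ring.
    - specialize (H0 c). field_simplify_eq; [|split; lra]. lra. }
  (* Bootstrap: g' = (1/f') o g is n times differentiable as soon as g is. *)
  apply smooth_diffn. intro n. induction n as [|n IH]; [exact I|]. split.
  - intro y. eexists. apply D.
  - replace (Derive g) with (fun y => / Derive f (g y)).
    + apply (diffn_comp n (fun x => / Derive f x)); [|assumption].
      apply smooth_diffn. apply smooth_inv; [intro x; specialize (H0 x); lra|now apply smooth_Derive].
    + extensionality y. symmetry. apply is_derive_unique, D.
Qed.

End MeanValue.

Section Periodization.

(** The subtracted integer is the one nearest to x, so the restriction of h to [-1/2, 1/2) is
    repeated and the seams lie at the half-integers. *)
Definition Per (h : R -> R) (x : R) : R := h (x - IZR (Int_part (x + 1 / 2))).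

Lemma Per_near (h : R -> R) (n : Z) (x : R) : Rabs (x - IZR n) < 1 / 2 -> Per h x = h (x - IZR n).
Proof.
  intro H. apply Rabs_def2 in H. unfold Per.
  replace (Int_part (x + 1 / 2)) with n; [reflexivity|]. apply Int_part_spec. lra.
Qed.

Lemma Per_period (h : R -> R) (x : R) : Per h (x + 1) = Per h x.
Proof.
  unfold Per.
  replace (Int_part (x + 1 + 1 / 2)) with (Int_part (x + 1 / 2) + 1)%Z.
  - rewrite plus_IZR. f_equal. ring.
  - apply Int_part_spec. rewrite plus_IZR. pose proof (base_Int_part (x + 1 / 2)). lra.
Qed.

Lemma Per_cases (h : R -> R) (x : R) : exists n : Z, - (1 / 2) <= x - IZR n < 1 / 2 /\ Per h x = h (x - IZR n).
Proof.
  exists (Int_part (x + 1 / 2)). split; [|reflexivity].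
  pose proof (base_Int_part (x + 1 / 2)). lra.
Qed.

Lemma Per_inner (h : R -> R) (n : Z) (x : R) : - (1 / 2) < x - IZR n < 1 / 2 ->
  locally x (fun y => Per h y = h (y - IZR n)).
Proof.
  intro H. apply locally_Rabs_ex. exists (Rmin (x - IZR n + 1 / 2) (1 / 2 - (x - IZR n))).
  split; [apply Rmin_pos; lra|]. intros y Hy. apply Per_near.
  pose proof (Rmin_l (x - IZR n + 1 / 2) (1 / 2 - (x - IZR n))).
  pose proof (Rmin_r (x - IZR n + 1 / 2) (1 / 2 - (x - IZR n))).
  apply Rabs_def2 in Hy. apply Rabs_def1; lra.
Qed.

Lemma Per_edge (h : R -> R) (r : R) (n : Z) (x : R) : r < 1 / 2 ->
  (forall t, r <= Rabs t -> h t = 0) -> - (1 / 2) = x - IZR n -> locally x (fun y => Per h y = 0).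
Proof.
  intros Hr H0 H. apply locally_Rabs_ex. exists (1 / 2 - r). split; [lra|].
  intros y Hy. apply Rabs_def2 in Hy.
  destruct (Per_cases h y) as [m [Hm E]]. rewrite E. apply H0.
  destruct (Z_lt_le_dec m n) as [L|L].
  - apply Rle_trans with (y - IZR m); [|apply Rle_abs].
    assert (m <= n - 1)%Z as L' by lia. apply IZR_le in L'. rewrite minus_IZR in L'. lra.
  - rewrite <- Rabs_Ropp. apply Rle_trans with (- (y - IZR m)); [|apply Rle_abs].
    apply IZR_le in L. lra.
Qed.

Lemma Per_smooth (h : R -> R) (r : R) : r < 1 / 2 -> (forall t, r <= Rabs t -> h t = 0) ->
  smooth h -> smooth (Per h).
Proof.
  intros Hr H0 Hh. apply smooth_local. intro x.
  destruct (Per_cases h x) as [n [[Hn1 Hn2] _]].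
  destruct Hn1 as [Hn1|Hn1].
  - exists (fun y => h (y - IZR n)). split; [smooth|]. now apply Per_inner.
  - exists (fun _ => 0). split; [smooth|]. now apply Per_edge with r n.
Qed.

Lemma period_Z (f : R -> R) (c : R) : (forall x, f (x + 1) = f x + c) ->
  forall (n : Z) x, f (x + IZR n) = f x + IZR n * c.
Proof.
  intros H.
  assert (P : forall (n : nat) x, f (x + INR n) = f x + INR n * c).
  { induction n as [|n IH]; intro x; [simpl; rewrite Rplus_0_r; ring|].
    rewrite S_INR. replace (x + (INR n + 1)) with (x + INR n + 1) by ring.
    rewrite H, IH. ring. }
  intros n x. destruct (Z_le_gt_dec 0 n) as [L|L].
  - rewrite <- (Z2Nat.id n L), <- INR_IZR_INZ. apply P.
  - assert (E : IZR n = - INR (Z.to_nat (- n))).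
    { rewrite INR_IZR_INZ, Z2Nat.id by lia. rewrite opp_IZR. ring. }
    pose proof (P (Z.to_nat (- n)) (x + IZR n)) as Q.
    replace (x + IZR n + INR (Z.to_nat (- n))) with x in Q by lra.
    rewrite Q, E. ring.
Qed.

Lemma Derive_shift (f : R -> R) (c x : R) : Derive (fun y => f (y + c)) x = Derive f (x + c).
Proof.
  unfold Derive. apply f_equal. apply Lim_ext. intro h.
  now replace (x + h + c) with (x + c + h) by ring.
Qed.

(* A 1-periodic smooth function equal to [t] near 0: composing with [x0 + proj (y - x0)]
   makes any function periodic without changing its germ at [x0]. *)
Definition proj (t : R) : R := Per (fun t => t * bump (1 / 8) (1 / 4) t) t.

Lemma proj_smooth : smooth proj.
Proof.
  apply Per_smooth with (1 / 4); [lra| |].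
  - intros t Ht. rewrite bump_0 by lra. ring.
  - smooth.
Qed.

Lemma proj_period (t : R) : proj (t + 1) = proj t.
Proof. apply Per_period. Qed.

Lemma proj_near (t : R) : Rabs t <= 1 / 8 -> proj t = t.
Proof.
  intro H. unfold proj. rewrite (Per_near _ 0).
  - rewrite Rminus_0_r, bump_1 by lra. ring.
  - rewrite Rminus_0_r. lra.
Qed.

Lemma proj_bound (t : R) : Rabs (proj t) <= 1 / 2.
Proof.
  unfold proj. destruct (Per_cases (fun t => t * bump (1 / 8) (1 / 4) t) t) as [n [Hn E]].
  rewrite E. rewrite Rabs_mult, (Rabs_pos_eq (bump _ _ _)) by apply bump_bound.
  assert (Rabs (t - IZR n) <= 1 / 2) by (apply Rabs_le; lra).
  pose proof (bump_bound (1 / 8) (1 / 4) (t - IZR n)). pose proof (Rabs_pos (t - IZR n)). nra.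
Qed.

Lemma proj_slope (t : R) : Derive proj t <= 1.
Proof.
  destruct (Per_cases (fun t => t * bump (1 / 8) (1 / 4) t) t) as [n [[[H1|H1] H2] E]].
  - set (h0 := fun t => t * bump (1 / 8) (1 / 4) t) in *.
    rewrite (Derive_ext_loc _ (fun y => h0 (y + - IZR n))).
    + rewrite Derive_shift. apply bump_slope. lra.
    + now apply Per_inner.
  - rewrite (Derive_ext_loc _ (fun _ => 0)); [rewrite Derive_const; lra|].
    apply Per_edge with (1 / 4) n; [lra| |assumption].
    intros u Hu. rewrite bump_0 by lra. ring.
Qed.

Definition loc (x0 y : R) : R := x0 + proj (y - x0).

Lemma loc_smooth (x0 : R) : smooth (loc x0).
Proof.
  pose proof proj_smooth. unfold loc. smooth.
Qed.

Lemma loc_period (x0 y : R) : loc x0 (y + 1) = loc x0 y.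
Proof.
  unfold loc. replace (y + 1 - x0) with (y - x0 + 1) by ring. now rewrite proj_period.
Qed.

Lemma loc_eq (x0 y : R) : Rabs (y - x0) <= 1 / 8 -> loc x0 y = y.
Proof. intro H. unfold loc. rewrite proj_near by assumption. ring. Qed.

Lemma loc_near (x0 : R) : locally x0 (fun y => loc x0 y = y).
Proof.
  apply locally_Rabs_ex. exists (1 / 8). split; [lra|]. intros y Hy. apply loc_eq. lra.
Qed.

End Periodization.

(** * Diffeomorphisms of the line and the circle from densities and germs *)

Section Diffeos.
Implicit Types f g : R -> R.

Lemma surjective_of_bounded f (K : R) : smooth f -> (forall x, Rabs (f x - x) <= K) ->
  forall y, exists x, f x = y.
Proof.
  intros Hf HK y.
  assert (H1 := HK (y - K)). assert (H2 := HK (y + K)).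
  apply Rabs_le_between in H1. apply Rabs_le_between in H2.
  destruct (IVT_gen f (y - K) (y + K) y) as [x [_ Hx]].
  - intro t. apply continuity_pt_filterlim. now apply smooth_continuous.
  - rewrite Rmin_left, Rmax_right; lra.
  - now exists x.
Qed.

Lemma isdiff_MR_bounded f (K : R) : smooth f -> (forall x, 0 < Derive f x) ->
  (forall x, Rabs (f x - x) <= K) -> isdiff MR f.
Proof.
  intros Hf H0 HK. split; [assumption|]. split; [assumption|].
  apply smooth_inverse; [assumption..|]. now apply surjective_of_bounded with K.
Qed.

Lemma isdiff_smooth M f : isdiff M f -> smooth f.
Proof. destruct M; now intros [H _]. Qed.

Lemma isdiff_pos M f : isdiff M f -> forall x, 0 < Derive f x.
Proof. destruct M; now intros [_ [H _]]. Qed.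

(** The displacement f(x) - x of a lift is periodic, hence bounded, which makes the lift onto. *)
Lemma isdiff_MS1_MR f : isdiff MS1 f -> isdiff MR f.
Proof.
  intros [Hf [H0 Hp]]. apply isdiff_MR_bounded with (Rabs (f 0) + 1); [assumption..|].
  intro x.
  assert (Hx : exists n : Z, 0 <= x - IZR n < 1).
  { exists (Int_part x). pose proof (base_Int_part x). lra. }
  destruct Hx as [n Hn].
  pose proof (period_Z f 1 Hp n (x - IZR n)) as E.
  replace (x - IZR n + IZR n) with x in E by ring. rewrite E.
  set (t := x - IZR n) in *.
  assert (f 0 <= f t).
  { destruct (Rle_lt_or_eq_dec 0 t) as [L|L]; [lra| |rewrite <- L; lra].
    left. now apply derive_pos_lt. }
  assert (f t < f 1) by (apply derive_pos_lt; [assumption..|lra]).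
  pose proof (Hp 0) as E1. rewrite Rplus_0_l in E1.
  replace (f t + IZR n * 1 - x) with (f t - t) by (unfold t; ring).
  assert (- Rabs (f 0) <= f 0 <= Rabs (f 0)) by (apply Rabs_le_between; lra).
  apply Rabs_le. lra.
Qed.

Lemma isdiff_inverse M f : isdiff M f ->
  exists g, isdiff M g /\ (forall x, g (f x) = x) /\ (forall y, f (g y) = y).
Proof.
  intro H. assert (HR : isdiff MR f) by (destruct M; [assumption|now apply isdiff_MS1_MR]).
  destruct HR as [Hf [H0 [g [Hg [gf fg]]]]].
  assert (D : forall y, Derive g y * Derive f (g y) = 1).
  { intro y. rewrite <- (Derive_comp f g) by (now apply smooth_ex_derive).
    rewrite (Derive_ext _ (fun y => y) y fg). apply Derive_id. }
  assert (G0 : forall y, 0 < Derive g y).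
  { intro y. specialize (D y). specialize (H0 (g y)). nra. }
  exists g. split; [|now split].
  destruct M; (split; [assumption|split; [assumption|]]).
  - exists f. repeat split; assumption.
  - destruct H as [_ [_ Hp]]. intro y.
    rewrite <- (fg y) at 1. rewrite <- Hp. apply gf.
Qed.

Lemma isdiff_MS1_comp f g : isdiff MS1 f -> isdiff MS1 g -> isdiff MS1 (fun x => f (g x)).
Proof.
  intros [Hf [Hf0 Hfp]] [Hg [Hg0 Hgp]]. split; [now apply smooth_comp|]. split.
  - intro x. rewrite (Derive_comp f g) by (now apply smooth_ex_derive).
    now apply Rmult_lt_0_compat.
  - intro x. now rewrite Hgp, Hfp.
Qed.

Lemma isdiff_MS1_shift (c : R) : isdiff MS1 (fun y => y + c).
Proof.
  split; [smooth|]. split.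
  - intro x. rewrite (Derive_shift (fun y => y)), Derive_id. lra.
  - intro x. ring.
Qed.

Lemma density_diffeo (v : R -> R) (K : R) : smooth v -> (forall x, 0 < v x) ->
  forall F, (forall x, is_derive F x (v x)) -> (forall x, F (x + 1) = F x + K) ->
  0 < K -> isdiff MS1 (fun x => F x / K) /\ forall x, Derive (fun x => F x / K) x = v x / K.
Proof.
  intros Hv H0 F HF HP HK.
  assert (D : forall x, Derive (fun x => F x / K) x = v x / K).
  { intro x. unfold Rdiv. rewrite Derive_scal_l.
    now rewrite (is_derive_unique _ _ _ (HF x)). }
  assert (SF : smooth F) by now apply smooth_of_derive with v.
  split; [|assumption]. split; [|split].
  - apply smooth_div; [intro; lra|assumption|apply smooth_const].
  - intro x. rewrite D. apply Rdiv_lt_0_compat; auto.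
  - intro x. rewrite HP. field. lra.
Qed.

Lemma primitive_period (v F : R -> R) : (forall x, is_derive F x (v x)) -> (forall x, v (x + 1) = v x) ->
  forall x, F (x + 1) = F x + (F 1 - F 0).
Proof.
  intros HF Hv x.
  assert (E : (fun x => F (x + 1) - F x) x = (fun x => F (x + 1) - F x) 0).
  { apply (derive_0_eq (fun x => F (x + 1) - F x)). intros t _.
    replace 0 with (v (t + 1) - v t) by (rewrite Hv; ring).
    apply @is_derive_minus; [|apply HF].
    replace (v (t + 1)) with (1 * v (t + 1)) by ring.
    apply (is_derive_comp F (fun x => x + 1)); [apply HF|auto_derive; [exact I|ring]]. }
  simpl in E. rewrite Rplus_0_l in E. lra.
Qed.

(** For r <= 1 the diffeomorphism is z + (r - 1) proj(z - z0), whose slope is at least r by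
    [proj_slope]. For r > 1 the inverse of the one of ratio 1/r is taken. *)
Lemma slope_diffeo (r z0 : R) : 0 < r ->
  exists s, isdiff MS1 s /\ locally z0 (fun z => s z = z0 + r * (z - z0)).
Proof.
  assert (small : forall r, 0 < r <= 1 ->
    exists s, isdiff MS1 s /\ locally z0 (fun z => s z = z0 + r * (z - z0))).
  { clear r. intros r Hr. exists (fun z => z + (r - 1) * proj (z - z0)).
    pose proof proj_smooth. assert (Sp : smooth (fun z => proj (z - z0))) by smooth.
    split; [split; [|split]|].
    - smooth.
    - intro x. rewrite Derive_plus; [|apply ex_derive_id|].
      2: { apply ex_derive_scal. now apply smooth_ex_derive. }
      change (fun z => (r - 1) * proj (z - z0)) with (fun z => (r - 1) * proj (z + - z0)).
      rewrite Derive_id, Derive_scal, (Derive_shift proj (- z0) x).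
      pose proof (proj_slope (x + - z0)). nra.
    - intro x. replace (x + 1 - z0) with (x - z0 + 1) by ring. rewrite proj_period. ring.
    - apply locally_Rabs_ex. exists (1 / 8). split; [lra|]. intros y Hy.
      rewrite proj_near by lra. ring. }
  intro Hr. destruct (Rle_lt_dec r 1) as [L|L]; [now apply small|].
  destruct (small (/ r)) as [s [Hs Hl]].
  { split; [now apply Rinv_0_lt_compat|]. rewrite <- Rinv_1. apply Rinv_le_contravar; lra. }
  destruct (isdiff_inverse MS1 s Hs) as [g [Hg [gs sg]]].
  exists g. split; [assumption|].
  apply locally_Rabs_ex in Hl. destruct Hl as [d [Hd Hl]].
  apply locally_Rabs_ex. exists (d / r). split; [apply Rdiv_lt_0_compat; lra|].
  intros y Hy.
  assert (E : s (z0 + r * (y - z0)) = y).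
  { rewrite Hl; [field; lra|].
    replace (z0 + r * (y - z0) - z0) with (r * (y - z0)) by ring.
    rewrite Rabs_mult, (Rabs_pos_eq r) by lra.
    apply Rmult_lt_reg_r with (/ r); [now apply Rinv_0_lt_compat|].
    replace (r * Rabs (y - z0) * / r) with (Rabs (y - z0)) by (field; lra). exact Hy. }
  rewrite <- E at 1. apply gs.
Qed.

(** Near x0 the derivative F' is made periodic and integrated. A lift must advance by 1 per period,
    so the primitive is divided by its mass K; a local dilation of ratio K and a shift then restore
    the germ of F. *)
Lemma germ_diffeo (F : R -> R) (x0 : R) : smooth F -> (forall x, 0 < Derive F x) ->
  exists f, isdiff MS1 f /\ locally x0 (fun x => f x = F x).
Proof.
  intros HF H0. set (v := fun y => Derive F (loc x0 y)).
  assert (Sv : smooth v).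
  { apply (smooth_comp (Derive F)); [now apply smooth_Derive|apply loc_smooth]. }
  destruct (smooth_primitive v Sv) as [G [SG DG]].
  assert (Gp := primitive_period v G DG ltac:(intro x; unfold v; now rewrite loc_period)).
  set (K := G 1 - G 0) in Gp.
  assert (HK : 0 < K).
  { unfold K. assert (G 0 < G 1); [|lra]. apply derive_pos_lt; [assumption| |lra].
    intro t. rewrite (is_derive_unique _ _ _ (DG t)). apply H0. }
  destruct (density_diffeo v K Sv ltac:(intro; apply H0) G DG Gp HK) as [Hd _].
  set (f1 := fun x => G x / K) in Hd.
  destruct (slope_diffeo K (f1 x0) HK) as [s [Hs Ls]].
  exists (fun x => s (f1 x) + (F x0 - f1 x0)). split.
  - apply (isdiff_MS1_comp (fun y => y + (F x0 - f1 x0)) (fun x => s (f1 x)));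
      [apply isdiff_MS1_shift|now apply isdiff_MS1_comp].
  - assert (L1 : locally x0 (fun x => s (f1 x) = f1 x0 + K * (f1 x - f1 x0))).
    { apply (locally_continuous f1 x0 (fun z => s z = f1 x0 + K * (z - f1 x0))); [|exact Ls]. apply smooth_continuous, (isdiff_smooth MS1 f1 Hd). }
    apply locally_Rabs_ex in L1. destruct L1 as [d [Hdd L1]].
    apply locally_Rabs_ex. exists (Rmin d (1 / 8)). split; [apply Rmin_pos; lra|].
    intros x Hx. pose proof (Rmin_l d (1 / 8)). pose proof (Rmin_r d (1 / 8)).
    rewrite L1 by lra.
    assert (E : (fun x => G x - F x) x0 = (fun x => G x - F x) x).
    { apply (derive_0_eq (fun x => G x - F x)). intros t Ht.
      replace 0 with (v t - Derive F t).
      - apply @is_derive_minus; [apply DG|now apply smooth_is_derive].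
      - unfold v. rewrite loc_eq; [ring|]. apply Rabs_def2 in Hx. apply Rabs_le.
        revert Ht. unfold Rmin, Rmax. destruct (Rle_dec x0 x); lra. }
    simpl in E. unfold f1.
    replace (G x0 / K + K * (G x / K - G x0 / K) + (F x0 - G x0 / K)) with (G x - G x0 + F x0) by (field; lra). lra.
Qed.

End Diffeos.

(** * Complex-valued functions *)

Definition CD (phi : R -> C) (x : R) : C :=
  (Derive (fun y => Re (phi y)) x, Derive (fun y => Im (phi y)) x).

Section ComplexFunctions.
Implicit Types phi psi : R -> C.

Lemma C_eq (z w : C) : Re z = Re w -> Im z = Im w -> z = w.
Proof. apply injective_projections. Qed.

Lemma cDn_0 phi : cDn 0 phi = phi.
Proof. extensionality x. now apply C_eq. Qed.

Lemma cDn_S (n : nat) phi : cDn (S n) phi = CD (cDn n phi).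
Proof. reflexivity. Qed.

Lemma cDn_CD (n : nat) phi : cDn n (CD phi) = cDn (S n) phi.
Proof.
  extensionality x. unfold cDn, CD. cbn [Re Im fst snd].
  change (fun y => Re (Derive (fun y0 => Re (phi y0)) y, Derive (fun y0 => Im (phi y0)) y))
    with (Derive (fun y0 => Re (phi y0))).
  change (fun y => Im (Derive (fun y0 => Re (phi y0)) y, Derive (fun y0 => Im (phi y0)) y))
    with (Derive (fun y0 => Im (phi y0))).
  now rewrite !Derive_n_Derive.
Qed.

Lemma csmooth_const (c : C) : csmooth (fun _ => c).
Proof. split; [exact (smooth_const (Re c))|exact (smooth_const (Im c))]. Qed.

Lemma csmooth_RtoC (f : R -> R) : smooth f -> csmooth (fun x => RtoC (f x)).
Proof. intro H. split; [exact H|exact (smooth_const 0)]. Qed.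

Lemma csmooth_plus phi psi : csmooth phi -> csmooth psi -> csmooth (fun x => Cplus (phi x) (psi x)).
Proof. intros [H1 H2] [H3 H4]. split; now apply smooth_plus. Qed.

Lemma csmooth_mult phi psi : csmooth phi -> csmooth psi -> csmooth (fun x => Cmult (phi x) (psi x)).
Proof.
  intros [H1 H2] [H3 H4]. split.
  - apply smooth_minus; now apply smooth_mult.
  - apply smooth_plus; now apply smooth_mult.
Qed.

Lemma csmooth_comp phi (f : R -> R) : csmooth phi -> smooth f -> csmooth (fun x => phi (f x)).
Proof.
  intros [H1 H2] Hf. split.
  - now apply (smooth_comp (fun x => Re (phi x))).
  - now apply (smooth_comp (fun x => Im (phi x))).
Qed.

Lemma csmooth_CD phi : csmooth phi -> csmooth (CD phi).
Proof. intros [H1 H2]. split; [exact (smooth_Derive _ H1)|exact (smooth_Derive _ H2)]. Qed.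

Lemma csmooth_cDn (n : nat) phi : csmooth phi -> csmooth (cDn n phi).
Proof.
  intro H. induction n as [|n IH]; [now rewrite cDn_0|]. rewrite cDn_S. now apply csmooth_CD.
Qed.

Lemma csmooth_local phi :
  (forall x, exists psi, csmooth psi /\ locally x (fun y => phi y = psi y)) -> csmooth phi.
Proof.
  intro H. split; apply smooth_local; intro x; destruct (H x) as [psi [[H1 H2] L]].
  - exists (fun y => Re (psi y)). split; [assumption|].
    apply filter_imp with (2 := L). intros y Hy. now rewrite Hy.
  - exists (fun y => Im (psi y)). split; [assumption|].
    apply filter_imp with (2 := L). intros y Hy. now rewrite Hy.
Qed.

Lemma CD_const (c : C) (x : R) : CD (fun _ => c) x = RtoC 0.
Proof. unfold CD. now rewrite !Derive_const. Qed.

Lemma CD_RtoC (f : R -> R) (x : R) : CD (fun y => RtoC (f y)) x = RtoC (Derive f x).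
Proof. unfold CD. simpl. now rewrite Derive_const. Qed.

Lemma CD_plus phi psi (x : R) : csmooth phi -> csmooth psi ->
  CD (fun y => Cplus (phi y) (psi y)) x = Cplus (CD phi x) (CD psi x).
Proof.
  intros [H1 H2] [H3 H4]. apply C_eq; cbn [CD Re Im Cplus fst snd].
  - apply (Derive_plus (fun y => Re (phi y)) (fun y => Re (psi y))); now apply smooth_ex_derive.
  - apply (Derive_plus (fun y => Im (phi y)) (fun y => Im (psi y))); now apply smooth_ex_derive.
Qed.

Lemma CD_mult phi psi (x : R) : csmooth phi -> csmooth psi ->
  CD (fun y => Cmult (phi y) (psi y)) x = Cplus (Cmult (CD phi x) (psi x)) (Cmult (phi x) (CD psi x)).
Proof.
  intros [H1 H2] [H3 H4].
  pose proof (fun f H => Derive_correct f x (smooth_ex_derive f H x)) as D.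
  pose proof (D _ H1) as D1. pose proof (D _ H2) as D2.
  pose proof (D _ H3) as D3. pose proof (D _ H4) as D4.
  pose proof (fun f g a b (F : is_derive f x a) (G : is_derive g x b) =>
    is_derive_mult f g x a b F G Rmult_comm) as M.
  apply C_eq; cbn [CD Re Im fst snd].
  - apply is_derive_unique. eapply filterdiff_ext_lin.
    + exact (is_derive_minus _ _ x _ _ (M _ _ _ _ D1 D3) (M _ _ _ _ D2 D4)).
    + intro t. cbn [CD Re Im Cplus Cmult fst snd]. unfold scal, minus, plus, opp, mult; simpl.
      unfold mult; simpl. unfold Re, Im. ring.
  - apply is_derive_unique. eapply filterdiff_ext_lin.
    + exact (is_derive_plus _ _ x _ _ (M _ _ _ _ D1 D4) (M _ _ _ _ D2 D3)).
    + intro t. cbn [CD Re Im Cplus Cmult fst snd]. unfold scal, minus, plus, opp, mult; simpl.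
      unfold mult; simpl. unfold Re, Im. ring.
Qed.

Lemma CD_scal (c : C) phi (x : R) : csmooth phi ->
  CD (fun y => Cmult c (phi y)) x = Cmult c (CD phi x).
Proof. intro H. rewrite (CD_mult (fun _ => c)) by (assumption || apply csmooth_const). rewrite CD_const. ring. Qed.

Lemma CD_comp phi (f : R -> R) (x : R) : csmooth phi -> smooth f ->
  CD (fun y => phi (f y)) x = Cmult (RtoC (Derive f x)) (CD phi (f x)).
Proof.
  intros [H1 H2] Hf. apply C_eq; cbn [CD Re Im Cmult RtoC fst snd]; rewrite ?Rmult_0_l, ?Rminus_0_r, ?Rplus_0_r.
  - apply (Derive_comp (fun y => Re (phi y)) f); now apply smooth_ex_derive.
  - apply (Derive_comp (fun y => Im (phi y)) f); now apply smooth_ex_derive.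
Qed.

Lemma CD_ext_loc phi psi (x : R) : locally x (fun y => phi y = psi y) -> CD phi x = CD psi x.
Proof.
  intro L. apply C_eq; cbn [CD Re Im fst snd]; apply Derive_ext_loc;
    apply filter_imp with (2 := L); intros y Hy; now rewrite Hy.
Qed.

Lemma CD_loc phi psi (x : R) : locally x (fun y => phi y = psi y) ->
  locally x (fun y => CD phi y = CD psi y).
Proof. intro L. apply locally_locally in L. apply filter_imp with (2 := L). intro y. apply CD_ext_loc. Qed.

Lemma cDn_ext_loc (n : nat) phi psi (x : R) :
  locally x (fun y => phi y = psi y) -> cDn n phi x = cDn n psi x.
Proof.
  intro L. apply C_eq; cbn [cDn Re Im fst snd]; apply Derive_n_ext_loc;
    apply filter_imp with (2 := L); intros y Hy; now rewrite Hy.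
Qed.

Lemma cDn_plus (n : nat) phi psi (x : R) : csmooth phi -> csmooth psi ->
  cDn n (fun y => Cplus (phi y) (psi y)) x = Cplus (cDn n phi x) (cDn n psi x).
Proof.
  intros Hp Hq. revert x. induction n as [|n IH]; intro x; [now rewrite !cDn_0|].
  rewrite !cDn_S. rewrite <- CD_plus by now apply csmooth_cDn.
  f_equal. extensionality y. apply IH.
Qed.

Lemma cDn_scal (n : nat) (c : C) phi (x : R) : csmooth phi ->
  cDn n (fun y => Cmult c (phi y)) x = Cmult c (cDn n phi x).
Proof.
  intros Hp. revert x. induction n as [|n IH]; intro x; [now rewrite !cDn_0|].
  rewrite !cDn_S. rewrite <- CD_scal by now apply csmooth_cDn.
  f_equal. extensionality y. apply IH.
Qed.

Lemma cDn_zero (n : nat) (x : R) : cDn n (fun _ => RtoC 0) x = RtoC 0.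
Proof.
  revert x. induction n as [|n IH]; intro x; [now rewrite cDn_0|].
  rewrite cDn_S. transitivity (CD (fun _ => RtoC 0) x); [|apply CD_const].
  f_equal. extensionality y. apply IH.
Qed.

Lemma CD_shift phi (c x : R) : CD (fun y => phi (y + c)) x = CD phi (x + c).
Proof.
  unfold CD. f_equal.
  - apply (Derive_shift (fun y => Re (phi y))).
  - apply (Derive_shift (fun y => Im (phi y))).
Qed.

Lemma CD_period phi : (forall x, phi (x + 1) = phi x) -> forall x, CD phi (x + 1) = CD phi x.
Proof. intros H x. rewrite <- CD_shift. f_equal. extensionality y. apply H. Qed.

Lemma CD_0_eq phi (x y : R) : csmooth phi ->
  (forall t, Rmin x y <= t <= Rmax x y -> CD phi t = RtoC 0) -> phi x = phi y.
Proof.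
  intros [H1 H2] H. apply C_eq.
  - apply (derive_0_eq (fun y => Re (phi y))). intros t Ht.
    replace 0 with (Re (CD phi t)) by now rewrite (H t Ht). now apply smooth_is_derive.
  - apply (derive_0_eq (fun y => Im (phi y))). intros t Ht.
    replace 0 with (Im (CD phi t)) by now rewrite (H t Ht). now apply smooth_is_derive.
Qed.

End ComplexFunctions.

Section FiniteSums.
Open Scope C_scope.

Lemma csum_ext (n : nat) (g h : nat -> C) : (forall i, (i <= n)%nat -> g i = h i) -> csum n g = csum n h.
Proof.
  induction n as [|n IH]; intro H; simpl; [now apply H|]. rewrite IH, (H (S n)) by auto. reflexivity.
Qed.

Lemma csum_zero (n : nat) (g : nat -> C) : (forall i, (i <= n)%nat -> g i = 0) -> csum n g = 0.
Proof.
  induction n as [|n IH]; intro H; simpl; [now apply H|]. rewrite IH, (H (S n)) by auto. ring.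
Qed.

Lemma csum_plus (n : nat) (g h : nat -> C) : csum n (fun i => g i + h i) = csum n g + csum n h.
Proof. induction n as [|n IH]; simpl; [reflexivity|]. rewrite IH. ring. Qed.

Lemma csum_scal (n : nat) (c : C) (g : nat -> C) : csum n (fun i => c * g i) = c * csum n g.
Proof. induction n as [|n IH]; simpl; [reflexivity|]. rewrite IH. ring. Qed.

Lemma csum_single (n j : nat) (g : nat -> C) : (j <= n)%nat ->
  (forall i, (i <= n)%nat -> i <> j -> g i = 0) -> csum n g = g j.
Proof.
  intros Hj H. induction n as [|n IH]; simpl.
  - now replace j with O by lia.
  - destruct (Nat.eq_dec j (S n)) as [->|Hn].
    + rewrite csum_zero; [ring|]. intros i Hi. apply H; lia.
    + rewrite IH, (H (S n)) by (try intros; try apply H; lia). ring.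
Qed.

Lemma csum_swap (n p : nat) (g : nat -> nat -> C) :
  csum n (fun i => csum p (fun j => g i j)) = csum p (fun j => csum n (fun i => g i j)).
Proof. induction n as [|n IH]; simpl; [reflexivity|]. rewrite IH, csum_plus. reflexivity. Qed.

Lemma csmooth_csum (n : nat) (g : nat -> R -> C) : (forall i, (i <= n)%nat -> csmooth (g i)) ->
  csmooth (fun x => csum n (fun i => g i x)).
Proof.
  induction n as [|n IH]; intro H; simpl; [now apply H|].
  apply csmooth_plus; [apply IH; auto|now apply H].
Qed.

End FiniteSums.

(** * Powers with complex exponent *)

Section Powers.
Open Scope C_scope.

Lemma cpow_smooth (f : R -> R) (l : C) : smooth f -> (forall x, (0 < f x)%R) ->
  csmooth (fun x => cpow (f x) l).
Proof.
  intros Hf H0.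
  assert (L : forall c, smooth (fun x => (c * ln (f x))%R)).
  { intro c. apply smooth_mult; [apply smooth_const|now apply smooth_ln]. }
  split; apply smooth_mult.
  - apply (smooth_comp exp); [apply smooth_exp|apply L].
  - apply (smooth_comp cos); [apply smooth_sin_cos|apply L].
  - apply (smooth_comp exp); [apply smooth_exp|apply L].
  - apply (smooth_comp sin); [apply smooth_sin_cos|apply L].
Qed.

Lemma cpow_1_l (l : C) : cpow 1 l = 1.
Proof. unfold cpow. rewrite ln_1, !Rmult_0_r, exp_0, cos_0, sin_0. apply C_eq; simpl; ring. Qed.

Lemma cpow_0_r (t : R) : cpow t 0 = 1.
Proof. unfold cpow. simpl. rewrite !Rmult_0_l, exp_0, cos_0, sin_0. apply C_eq; simpl; ring. Qed.

Lemma cpow_1_r (t : R) : (0 < t)%R -> cpow t 1 = RtoC t.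
Proof.
  intro H. unfold cpow. simpl. rewrite Rmult_1_l, Rmult_0_l, exp_ln, cos_0, sin_0 by assumption.
  apply C_eq; simpl; ring.
Qed.

Lemma cpow_plus (t : R) (l m : C) : cpow t (l + m) = cpow t l * cpow t m.
Proof.
  unfold cpow. apply C_eq; simpl; unfold Re, Im; rewrite !Rmult_plus_distr_r, exp_plus.
  - rewrite cos_plus. ring.
  - rewrite sin_plus. ring.
Qed.

Lemma cpow_inv (t : R) (l : C) : (0 < t)%R -> cpow t l * cpow (/ t) l = 1.
Proof.
  intro H. unfold cpow. rewrite ln_Rinv by assumption.
  assert (E1 : (exp (Re l * ln t) * exp (Re l * - ln t) = 1)%R).
  { rewrite <- exp_plus, <- exp_0. f_equal. ring. }
  replace (Im l * - ln t)%R with (- (Im l * ln t))%R by ring.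
  rewrite cos_neg, sin_neg. pose proof (sin2_cos2 (Im l * ln t)) as E2. unfold Rsqr in E2.
  apply C_eq; simpl.
  - transitivity (exp (Re l * ln t) * exp (Re l * - ln t)
      * (sin (Im l * ln t) * sin (Im l * ln t) + cos (Im l * ln t) * cos (Im l * ln t)))%R; [ring|].
    rewrite E1, E2. ring.
  - ring.
Qed.

Lemma cpow_neq_0 (t : R) (l : C) : (0 < t)%R -> cpow t l <> 0.
Proof.
  intros H E. pose proof (cpow_inv t l H) as F. rewrite E, Cmult_0_l in F.
  apply RtoC_inj in F. lra.
Qed.

Lemma cpow_mult_l (s t : R) (l : C) : (0 < s)%R -> (0 < t)%R -> cpow (s * t) l = cpow s l * cpow t l.
Proof.
  intros Hs Ht. unfold cpow. rewrite ln_mult by assumption.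
  apply C_eq; simpl; rewrite !Rmult_plus_distr_l, exp_plus.
  - rewrite cos_plus. ring.
  - rewrite sin_plus. ring.
Qed.

Lemma cpow_nat (t : R) (n : nat) : (0 < t)%R -> cpow t (RtoC (INR n)) = RtoC (t ^ n)%R.
Proof.
  intro H. induction n as [|n IH]; [apply cpow_0_r|].
  rewrite S_INR, RtoC_plus, cpow_plus, IH, cpow_1_r by assumption. simpl. rewrite RtoC_mult. ring.
Qed.

(* Any t sufficiently close to 1 makes the argument of t^z too small to vanish mod 2 pi. *)
Lemma cpow_eq_1 (z : C) : locally 1%R (fun t => cpow t z = 1) -> z = 0.
Proof.
  intro L. apply locally_Rabs_ex in L. destruct L as [e [He L]].
  set (K := (Rabs (Im z) + 1)%R).
  assert (HK : (0 < K)%R) by (unfold K; pose proof (Rabs_pos (Im z)); lra).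
  set (d := Rmin (ln (1 + e / 2)) (/ K)).
  assert (Hd : (0 < d)%R).
  { apply Rmin_pos; [|now apply Rinv_0_lt_compat].
    rewrite <- ln_1. apply ln_increasing; lra. }
  assert (E : cpow (exp d) z = 1).
  { apply L. assert (1 < exp d)%R by (rewrite <- exp_0; now apply exp_increasing).
    assert (exp d <= 1 + e / 2)%R.
    { rewrite <- (exp_ln (1 + e / 2)) by lra.
      destruct (Rmin_l (ln (1 + e / 2)) (/ K)) as [Q|Q].
      - left. now apply exp_increasing.
      - right. unfold d. now rewrite Q. }
    rewrite Rabs_pos_eq; lra. }
  unfold cpow in E. rewrite ln_exp in E. unfold RtoC in E. injection E as E1 E2.
  assert (P := exp_pos (Re z * d)).
  assert (Hs : sin (Im z * d) = 0%R) by nra.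
  assert (Hb : (Rabs (Im z * d) < 1)%R).
  { rewrite Rabs_mult, (Rabs_pos_eq d) by lra.
    apply Rle_lt_trans with (Rabs (Im z) * / K)%R.
    - apply Rmult_le_compat_l; [apply Rabs_pos|apply Rmin_r].
    - apply Rmult_lt_reg_r with K; [assumption|]. rewrite Rmult_assoc, Rinv_l by lra. unfold K. lra. }
  apply Rabs_def2 in Hb.
  assert (PI > 1)%R by (pose proof PI2_1; lra).
  assert (Hi : (Im z * d = 0)%R).
  { destruct (Rtotal_order (Im z * d) 0) as [Q|[Q|Q]]; [|assumption|].
    - assert (0 < sin (- (Im z * d)))%R by (apply sin_gt_0; lra). rewrite sin_neg in *. lra.
    - assert (0 < sin (Im z * d))%R by (apply sin_gt_0; lra). lra. }
  rewrite Hi, cos_0, Rmult_1_r in E1.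
  assert (Re z * d = 0)%R by (apply exp_inv; now rewrite exp_0).
  apply C_eq; simpl; nra.
Qed.

End Powers.

(** * Differential operators and their pull-back *)

Section Isfun.
Open Scope C_scope.
Variable M : manifold.
Implicit Types phi psi : R -> C.

Lemma isfun_csmooth phi : isfun M phi -> csmooth phi.
Proof. destruct M; [auto|now intros [H _]]. Qed.

Lemma isfun_const (c : C) : isfun M (fun _ => c).
Proof. pose proof (csmooth_const c). destruct M; simpl; auto. Qed.

Lemma isfun_plus phi psi : isfun M phi -> isfun M psi -> isfun M (fun x => phi x + psi x).
Proof.
  destruct M; simpl; [apply csmooth_plus|]. intros [H1 H2] [H3 H4].
  split; [now apply csmooth_plus|]. intro x. now rewrite H2, H4.
Qed.

Lemma isfun_mult phi psi : isfun M phi -> isfun M psi -> isfun M (fun x => phi x * psi x).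
Proof.
  destruct M; simpl; [apply csmooth_mult|]. intros [H1 H2] [H3 H4].
  split; [now apply csmooth_mult|]. intro x. now rewrite H2, H4.
Qed.

Lemma isfun_CD phi : isfun M phi -> isfun M (CD phi).
Proof.
  destruct M; simpl; [apply csmooth_CD|]. intros [H1 H2].
  split; [now apply csmooth_CD|]. now apply CD_period.
Qed.

Lemma isfun_csum (n : nat) (g : nat -> R -> C) : (forall i, (i <= n)%nat -> isfun M (g i)) ->
  isfun M (fun x => csum n (fun i => g i x)).
Proof.
  induction n as [|n IH]; intro H; simpl; [now apply H|].
  apply isfun_plus; [apply IH; auto|now apply H].
Qed.

Lemma isfun_comp phi f : isfun M phi -> isdiff M f -> isfun M (fun x => phi (f x)).
Proof.
  destruct M; simpl.
  - intros H [Hf _]. now apply csmooth_comp.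
  - intros [H1 H2] [Hf [_ Hp]]. split; [now apply csmooth_comp|].
    intro x. now rewrite Hp, H2.
Qed.

Lemma isfun_loc phi (x0 : R) : csmooth phi -> isfun M (fun y => phi (loc x0 y)).
Proof.
  intro H. pose proof (csmooth_comp phi (loc x0) H (loc_smooth x0)).
  destruct M; simpl; [assumption|]. split; [assumption|].
  intro x. now rewrite loc_period.
Qed.

Lemma Derive_period f : isdiff MS1 f -> forall x, Derive f (x + 1) = Derive f x.
Proof.
  intros [Hf [_ Hp]] x. rewrite <- Derive_shift.
  rewrite (Derive_ext _ (fun y => (f y + 1)%R) x Hp), Derive_plus, Derive_const.
  - ring.
  - now apply smooth_ex_derive.
  - apply @ex_derive_const.
Qed.

Lemma isfun_cpow_Derive f (l : C) : isdiff M f ->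
  isfun M (fun x => cpow (Derive f x) l) /\ isfun M (fun x => cpow (/ Derive f x) l)
  /\ isfun M (fun x => RtoC (/ Derive f x)).
Proof.
  intro H. pose proof (isdiff_smooth M f H) as Hf. pose proof (isdiff_pos M f H) as H0.
  assert (Hi : smooth (fun x => / Derive f x)%R).
  { apply smooth_inv; [intro x; specialize (H0 x); lra|now apply smooth_Derive]. }
  assert (csmooth (fun x => cpow (Derive f x) l)) by (apply cpow_smooth; [now apply smooth_Derive|assumption]).
  assert (csmooth (fun x => cpow (/ Derive f x) l)).
  { apply (cpow_smooth (fun x => / Derive f x)%R); [assumption|].
    intro x. now apply Rinv_0_lt_compat. }
  assert (csmooth (fun x => RtoC (/ Derive f x))) by now apply csmooth_RtoC.
  destruct M; simpl; [auto|].
  pose proof (Derive_period f H) as P.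
  repeat split; try assumption; try apply H1; try apply H2; try apply H3; intro x; now rewrite P.
Qed.

Lemma isfun_act l f phi : isdiff M f -> isfun M phi -> isfun M (act l f phi).
Proof.
  intros H Hp. apply (isfun_mult (fun x => cpow (Derive f x) l) (fun x => phi (f x))); [exact (proj1 (isfun_cpow_Derive f l H))|now apply isfun_comp].
Qed.

End Isfun.

Ltac coefs_ext i x := extensionality i; extensionality x.

Section Operators.
Open Scope C_scope.
Implicit Types phi psi : R -> C.
Implicit Types X a b : coefs.

(** The coefficients of the composite of d/dx with the operator X. *)
Definition Dl X : coefs :=
  fun i x => CD (X i) x + match i with O => 0 | S i' => X i' x end.

Definition single (j : nat) phi : coefs := fun i x => if Nat.eqb i j then phi x else 0.

(** The last summand is the term of order k + 1, which [applyop k] cuts off. *)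
Lemma applyop_Dl k X phi x : (forall i, csmooth (X i)) -> csmooth phi ->
  CD (applyop k X phi) x = applyop k (Dl X) phi x + X k x * cDn (S k) phi x.
Proof.
  intros HX Hp. induction k as [|k IH].
  - unfold applyop, Dl. simpl csum. rewrite CD_mult by (auto using csmooth_cDn).
    rewrite <- cDn_S. ring.
  - change (applyop (S k) X phi) with (fun x => applyop k X phi x + X (S k) x * cDn (S k) phi x).
    rewrite CD_plus.
    + rewrite IH, CD_mult by (auto using csmooth_cDn). rewrite <- cDn_S.
      change (applyop (S k) (Dl X) phi x) with (applyop k (Dl X) phi x + Dl X (S k) x * cDn (S k) phi x).
      unfold Dl at 3. ring.
    + apply (csmooth_csum k (fun i x => X i x * cDn i phi x)).
      intros i _. apply csmooth_mult; auto using csmooth_cDn.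
    + apply csmooth_mult; auto using csmooth_cDn.
Qed.

Lemma applyop_ext_loc k a phi psi x : locally x (fun y => phi y = psi y) ->
  applyop k a phi x = applyop k a psi x.
Proof. intro L. apply csum_ext. intros i _. now rewrite (cDn_ext_loc i phi psi x L). Qed.

Lemma cDn_monomial (r i : nat) (x : R) :
  cDn i (fun y => RtoC ((y - x) ^ r)) x = if Nat.eqb i r then RtoC (INR (fact r)) else 0.
Proof.
  assert (E : Derive_n (fun y => ((y - x) ^ r)%R) i x = if Nat.eqb i r then INR (fact r) else 0%R).
  { change (fun y => ((y - x) ^ r)%R) with (fun y => ((y + - x) ^ r)%R).
    rewrite (Derive_n_comp_trans (fun y => (y ^ r)%R) i x (- x)).
    rewrite Derive_n_pow, Rplus_opp_r.
    destruct (Nat.eqb_spec i r) as [->|Hn].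
    - destruct (Compare_dec.le_dec r r); [|lia]. rewrite Nat.sub_diag. simpl. field.
    - destruct (Compare_dec.le_dec i r); [|reflexivity].
      rewrite pow_i by lia. ring. }
  apply C_eq; cbn [cDn Re Im fst snd RtoC].
  - rewrite E. now destruct (Nat.eqb i r).
  - assert (Z := f_equal snd (cDn_zero i x)). cbn in Z.
    transitivity 0%R; [exact Z|]. now destruct (Nat.eqb i r).
Qed.

Lemma csmooth_monomial (r : nat) (x : R) : csmooth (fun y => RtoC ((y - x) ^ r)).
Proof.
  apply (csmooth_RtoC (fun y => (y - x) ^ r)%R). smooth.
Qed.

Lemma applyop_monomial k a (r : nat) x : (r <= k)%nat ->
  applyop k a (fun y => RtoC ((loc x y - x) ^ r)) x = RtoC (INR (fact r)) * a r x.
Proof.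
  intro Hr.
  rewrite (applyop_ext_loc k a _ (fun y => RtoC ((y - x) ^ r)) x).
  - unfold applyop. rewrite (csum_single k r); [|assumption|].
    + rewrite cDn_monomial, Nat.eqb_refl. ring.
    + intros i _ Hi. rewrite cDn_monomial. apply Nat.eqb_neq in Hi. rewrite Hi. ring.
  - apply filter_imp with (2 := loc_near x). intros y Hy. now rewrite Hy.
Qed.

(** Testing on (y - x)^i, made periodic by [loc], isolates i! times the i-th coefficient at x, so
    the same test functions serve both manifolds. *)
Lemma applyop_eq M k a b x :
  (forall phi, isfun M phi -> applyop k a phi x = applyop k b phi x) ->
  forall i, (i <= k)%nat -> a i x = b i x.
Proof.
  intros H i Hi.
  specialize (H _ (isfun_loc M _ x (csmooth_monomial i x))).
  cbv beta in H. rewrite !applyop_monomial in H by assumption.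
  assert (F : RtoC (INR (fact i)) <> 0).
  { intro E. apply RtoC_inj in E. exact (INR_fact_neq_0 i E). }
  transitivity (/ RtoC (INR (fact i)) * (RtoC (INR (fact i)) * a i x)); [field; exact F|].
  rewrite H. field. exact F.
Qed.

End Operators.

Notation dpow j := (single j (fun _ => RtoC 1)).
Notation rsingle j w := (single j (fun x => RtoC (w x))).

(* [powD l f j] is the coefficient family of ((f')^-1 d/dx)^j o (f')^-l, which sends
   (f')^l (psi o f) to psi^(j) o f. *)
Fixpoint powD (l : C) (f : R -> R) (j : nat) : coefs :=
  match j with
  | O => single 0 (fun x => cpow (/ Derive f x) l)
  | S j => fun i x => Cmult (RtoC (/ Derive f x)) (Dl (powD l f j) i x)
  end.

(** The coefficients of f^*b. Writing the transported operator explicitly turns the relation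
    [conjop] into a function (see [conj_iff_pull]). *)
Definition pull (l m : C) (k : nat) (f : R -> R) (b : coefs) : coefs :=
  fun i x => Cmult (cpow (Derive f x) m) (csum k (fun j => Cmult (b j (f x)) (powD l f j i x))).

(** * Transport of operators by diffeomorphisms *)

Section Pullback.
Open Scope C_scope.
Variables (M : manifold) (l m : C) (k : nat).

Lemma isfun_zero : isfun M (fun _ => 0).
Proof. apply isfun_const. Qed.

Lemma powD_isfun f j i : isdiff M f -> isfun M (powD l f j i).
Proof.
  intro Hf. destruct (isfun_cpow_Derive M f l Hf) as [_ [H1 H2]].
  revert i. induction j as [|j IH]; intro i.
  - unfold powD, single. destruct (Nat.eqb i 0); [assumption|apply isfun_zero].
  - simpl. apply isfun_mult; [assumption|]. apply isfun_plus; [now apply isfun_CD|].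
    destruct i; [apply isfun_zero|apply IH].
Qed.

Lemma powD_order f j i x : (j < i)%nat -> powD l f j i x = 0.
Proof.
  revert i x. induction j as [|j IH]; intros i x Hi.
  - simpl. unfold single. destruct i; [lia|reflexivity].
  - simpl. unfold Dl. destruct i; [lia|]. rewrite (IH i) by lia.
    replace (powD l f j (S i)) with (fun _ : R => RtoC 0); [rewrite CD_const; ring|].
    extensionality y. symmetry. apply IH. lia.
Qed.

Lemma powD_diag f j x : powD l f j j x = RtoC ((/ Derive f x) ^ j) * cpow (/ Derive f x) l.
Proof.
  revert x. induction j as [|j IH]; intro x.
  - simpl. unfold single. simpl. ring.
  - simpl. unfold Dl.
    replace (powD l f j (S j)) with (fun _ : R => RtoC 0).
    + rewrite CD_const, IH, RtoC_mult. ring.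
    + extensionality y. symmetry. apply powD_order. lia.
Qed.

(** For l = 0 no density factor intervenes, and the powers of (1/f') d/dx kill constants. *)
Lemma powD_order_0 f j x : powD 0 f j 0%nat x = if Nat.eqb j 0 then 1 else 0.
Proof.
  revert x. induction j as [|j IH]; intro x; simpl.
  - unfold single. simpl. apply cpow_0_r.
  - unfold Dl. replace (powD 0 f j 0%nat) with (fun _ : R => if Nat.eqb j 0 then RtoC 1 else RtoC 0)
      by (extensionality y; symmetry; apply IH).
    rewrite CD_const. ring.
Qed.

Lemma powD_affine f j i x (r : R) : locally x (fun y => Derive f y = r) ->
  powD l f j i x = if Nat.eqb i j then RtoC ((/ r) ^ j) * cpow (/ r) l else 0.
Proof.
  intro L.
  (* The recursion for [powD] differentiates the previous family, so the identity must be carried on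
     a neighbourhood of x. *)
  assert (P : locally x (fun y => powD l f j i y =
    if Nat.eqb i j then RtoC ((/ r) ^ j) * cpow (/ r) l else 0)).
  2: { now apply locally_singleton in P. }
  revert i. induction j as [|j IH]; intro i.
  - apply filter_imp with (2 := L). intros y Hy. simpl. unfold single. rewrite Hy.
    destruct (Nat.eqb i 0); [ring|reflexivity].
  - pose proof (CD_loc _ _ _ (IH i)) as L1.
    assert (L2 : locally x (fun y => match i with O => RtoC 0 | S i' => powD l f j i' y end
      = if Nat.eqb i (S j) then RtoC ((/ r) ^ j) * cpow (/ r) l else 0)).
    { destruct i as [|i]; [apply filter_forall; reflexivity|]. apply IH. }
    generalize (filter_and _ _ L (filter_and _ _ L1 L2)). apply filter_imp.
    intros y [H1 [H2 H3]]. simpl. unfold Dl. rewrite H1, H2, H3, CD_const.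
    destruct i as [|i]; simpl; [ring|].
    destruct (Nat.eqb i j); [rewrite RtoC_mult|]; ring.
Qed.

Lemma powD_ext_loc f g j i x : locally x (fun y => f y = g y) -> powD l f j i x = powD l g j i x.
Proof.
  intro L0. assert (L : locally x (fun y => Derive f y = Derive g y)).
  { apply locally_locally in L0. apply filter_imp with (2 := L0). intro y. apply Derive_ext_loc. }
  assert (P : locally x (fun y => powD l f j i y = powD l g j i y)).
  2: { now apply locally_singleton in P. }
  revert i. induction j as [|j IH]; intro i.
  - apply filter_imp with (2 := L). intros y Hy. simpl. unfold single. now rewrite Hy.
  - pose proof (CD_loc _ _ _ (IH i)) as L1.
    assert (L2 : locally x (fun y => match i with O => RtoC 0 | S i' => powD l f j i' y end
      = match i with O => RtoC 0 | S i' => powD l g j i' y end)).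
    { destruct i as [|i]; [apply filter_forall; reflexivity|]. apply IH. }
    generalize (filter_and _ _ L (filter_and _ _ L1 L2)). apply filter_imp.
    intros y [H1 [H2 H3]]. simpl. unfold Dl. now rewrite H1, H2, H3.
Qed.

Lemma powD_apply f j psi x : (j <= k)%nat -> isdiff M f -> csmooth psi ->
  applyop k (powD l f j) (act l f psi) x = cDn j psi (f x).
Proof.
  intros Hj Hf Hp. pose proof (isdiff_smooth M f Hf) as Sf. pose proof (isdiff_pos M f Hf) as H0.
  assert (Sa : csmooth (act l f psi)).
  { apply (csmooth_mult (fun x => cpow (Derive f x) l) (fun x => psi (f x))); [|now apply csmooth_comp].
    exact (isfun_csmooth M _ (proj1 (isfun_cpow_Derive M f l Hf))). }
  assert (SE : forall j i, csmooth (powD l f j i)).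
  { intros j' i. apply (isfun_csmooth M). now apply powD_isfun. }
  revert x. induction j as [|j IH]; intro x.
  - unfold applyop. rewrite (csum_single k 0); [|lia|].
    + rewrite !cDn_0. simpl. unfold single, act. simpl.
      transitivity (cpow (Derive f x) l * cpow (/ Derive f x) l * psi (f x)); [ring|].
      rewrite cpow_inv by apply H0. ring.
    + intros i _ Hi. simpl. unfold single. destruct i; [lia|]. simpl. ring.
  - transitivity (RtoC (/ Derive f x) * applyop k (Dl (powD l f j)) (act l f psi) x).
    + unfold applyop. rewrite <- csum_scal. apply csum_ext. intros i _. simpl. ring.
    + assert (A := applyop_Dl k (powD l f j) (act l f psi) x (SE j) Sa).
      rewrite powD_order, Cmult_0_l, Cplus_0_r in A by lia. rewrite <- A.
      replace (applyop k (powD l f j) (act l f psi)) with (fun x => cDn j psi (f x)).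
      * rewrite (CD_comp (cDn j psi) f x (csmooth_cDn j psi Hp) Sf), <- cDn_S.
        rewrite Cmult_assoc, <- RtoC_mult, Rinv_l by (specialize (H0 x); lra). ring.
      * extensionality y. symmetry. apply IH. lia.
Qed.

Lemma pull_apply f b psi x : isdiff M f -> csmooth psi ->
  applyop k (pull l m k f b) (act l f psi) x = act m f (applyop k b psi) x.
Proof.
  intros Hf Hp. unfold act at 2. unfold applyop at 2. rewrite <- csum_scal.
  transitivity (csum k (fun j => cpow (Derive f x) m * b j (f x) * applyop k (powD l f j) (act l f psi) x)).
  - unfold applyop, pull.
    transitivity (csum k (fun i => csum k (fun j =>
      cpow (Derive f x) m * b j (f x) * (powD l f j i x * cDn i (act l f psi) x)))).
    + apply csum_ext. intros i _.
      rewrite (Cmult_comm _ (cDn i _ x)), <- !csum_scal. apply csum_ext. intros j _. ring.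
    + rewrite csum_swap. apply csum_ext. intros j _. now rewrite csum_scal.
  - apply csum_ext. intros j Hj. rewrite powD_apply by assumption. ring.
Qed.

Lemma pull_valid f b : isdiff M f -> validop M k b -> validop M k (pull l m k f b).
Proof.
  intros Hf [Hb Hb0]. split.
  - intros i Hi. unfold pull. apply isfun_mult; [exact (proj1 (isfun_cpow_Derive M f m Hf))|].
    apply (isfun_csum M k (fun j x => b j (f x) * powD l f j i x)).
    intros j Hj. apply isfun_mult; [now apply isfun_comp; auto|now apply powD_isfun].
  - intros i x Hi. unfold pull. rewrite csum_zero; [ring|].
    intros j Hj. rewrite powD_order by lia. ring.
Qed.

Lemma pull_order f (b : coefs) j0 : (forall j x, (j0 < j)%nat -> b j x = 0) ->
  forall i x, (j0 < i)%nat -> pull l m k f b i x = 0.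
Proof.
  intros Hb i x Hi. unfold pull. rewrite csum_zero; [ring|]. intros j Hj.
  destruct (le_lt_dec j j0); [rewrite powD_order by lia|rewrite Hb by assumption]; ring.
Qed.

Lemma pull_add f a b : pull l m k f (coef_add a b) = coef_add (pull l m k f a) (pull l m k f b).
Proof.
  coefs_ext i x. unfold pull, coef_add.
  rewrite <- Cmult_plus_distr_l, <- csum_plus. f_equal. apply csum_ext. intros j _. ring.
Qed.

Lemma pull_scal f c a : pull l m k f (coef_scal c a) = coef_scal c (pull l m k f a).
Proof.
  coefs_ext i x. unfold pull, coef_scal.
  transitivity (cpow (Derive f x) m * (c * csum k (fun j => a j (f x) * powD l f j i x))); [|ring].
  f_equal. rewrite <- csum_scal. apply csum_ext. intros j _. ring.
Qed.

Lemma pull_ext_loc f g a b i x : locally x (fun y => f y = g y) ->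
  (forall j, (j <= k)%nat -> a j (f x) = b j (g x)) -> pull l m k f a i x = pull l m k g b i x.
Proof.
  intros L H. unfold pull. rewrite (Derive_ext_loc f g x L). f_equal.
  apply csum_ext. intros j Hj. now rewrite H, (powD_ext_loc f g j i x L).
Qed.

Lemma pull_affine f b i x (r : R) : (i <= k)%nat -> locally x (fun y => Derive f y = r) ->
  pull l m k f b i x = cpow r m * (RtoC ((/ r) ^ i) * cpow (/ r) l) * b i (f x).
Proof.
  intros Hi L. unfold pull. rewrite (locally_singleton _ _ L), (csum_single k i); [|assumption|].
  - rewrite (powD_affine f i i x r L), Nat.eqb_refl. ring.
  - intros j _ Hj. rewrite (powD_affine f j i x r L).
    destruct (Nat.eqb_spec i j); [lia|]. ring.
Qed.

Lemma pull_id_germ f b i x : locally x (fun y => Derive f y = 1%R) ->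
  validop M k b -> pull l m k f b i x = b i (f x).
Proof.
  intros L Hb. destruct (le_lt_dec i k) as [Hi|Hi].
  - rewrite (pull_affine f b i x 1 Hi L), Rinv_1, pow1, !cpow_1_l. ring.
  - rewrite (proj2 Hb) by assumption. apply (pull_order f b k); [apply Hb|assumption].
Qed.

Lemma pull_single f j phi i x : (j <= k)%nat ->
  pull l m k f (single j phi) i x = cpow (Derive f x) m * phi (f x) * powD l f j i x.
Proof.
  intro Hj. unfold pull. rewrite (csum_single k j); [|assumption|].
  - unfold single. rewrite Nat.eqb_refl. ring.
  - intros i' _ Hi. unfold single. apply Nat.eqb_neq in Hi. rewrite Hi. ring.
Qed.

Lemma act_inverse f g phi : smooth f -> smooth g -> (forall x, 0 < Derive f x)%R ->
  (forall x, 0 < Derive g x)%R -> (forall x, g (f x) = x) ->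
  act l f (act l g phi) = phi.
Proof.
  intros Hf Hg F0 G0 gf. extensionality x. unfold act. rewrite gf, Cmult_assoc.
  rewrite <- cpow_mult_l by auto.
  assert (E : (Derive f x * Derive g (f x) = 1)%R).
  { rewrite <- (Derive_comp g f) by now apply smooth_ex_derive.
    rewrite (Derive_ext _ (fun y => y) x gf). apply Derive_id. }
  rewrite ?(Rmult_comm (Derive g (f x))), E, cpow_1_l. ring.
Qed.

(** With g inverse to f, every test function phi has the form act l f (act l g phi). Hence [conjop]
    prescribes a on all test functions, which determines its coefficients. *)
Lemma conj_iff_pull f a b : isdiff M f -> validop M k a -> validop M k b ->
  (conjop M k l m f a b <-> a = pull l m k f b).
Proof.
  intros Hf Ha Hb. split.
  - intro H. coefs_ext i x.
    destruct (le_lt_dec i k) as [Hi|Hi].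
    2: { rewrite (proj2 Ha) by assumption. symmetry. now apply (pull_valid f b Hf Hb). }
    revert i Hi. apply (applyop_eq M). intros phi Hphi.
    destruct (isdiff_inverse M f Hf) as [g [Hg [gf fg]]].
    rewrite <- (act_inverse f g phi (isdiff_smooth M f Hf) (isdiff_smooth M g Hg)
      (isdiff_pos M f Hf) (isdiff_pos M g Hg) gf).
    assert (Hpsi : isfun M (act l g phi)) by now apply isfun_act.
    rewrite pull_apply by (try apply (isfun_csmooth M); assumption).
    symmetry. now apply H.
  - intros -> psi Hpsi x. symmetry. apply pull_apply; [assumption|now apply (isfun_csmooth M)].
Qed.

Definition equivariant (T : Op) : Prop :=
  forall f b, isdiff M f -> validop M k b -> T (pull l m k f b) = pull l m k f (T b).

Lemma in_I_iff T : in_I M k l m T <->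
  (forall a, validop M k a -> validop M k (T a)) /\
  (forall a b, validop M k a -> validop M k b -> T (coef_add a b) = coef_add (T a) (T b)) /\
  (forall c a, validop M k a -> T (coef_scal c a) = coef_scal c (T a)) /\
  equivariant T.
Proof.
  split.
  - intros [H1 [H2 [H3 H4]]]. split; [assumption|]. split; [|split].
    + intros a b Ha Hb. coefs_ext i x. now apply H2.
    + intros c a Ha. coefs_ext i x. now apply H3.
    + intros f b Hf Hb. assert (Hp := pull_valid f b Hf Hb).
      apply (conj_iff_pull f); auto. apply H4; auto. now apply conj_iff_pull.
  - intros [H1 [H2 [H3 H4]]]. split; [assumption|]. split; [|split].
    + intros a b Ha Hb i x. now rewrite H2.
    + intros c a Ha i x. now rewrite H3.
    + intros f Hf a b Ha Hb Hc. apply (conj_iff_pull f) in Hc; auto.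
      apply conj_iff_pull; auto. rewrite Hc. now apply H4.
Qed.

End Pullback.

(** * Locality on the line *)

Section Perturbations.

Definition near (M : manifold) (e x0 y : R) : Prop :=
  match M with
  | MR => Rabs (y - x0) < e
  | MS1 => exists n : Z, Rabs (y - x0 - IZR n) < e
  end.

Definition periodic_on (M : manifold) (w : R -> R) : Prop :=
  match M with MR => True | MS1 => forall x, w (x + 1) = w x end.

Lemma near_le M (e e' x0 y : R) : e <= e' -> near M e x0 y -> near M e' x0 y.
Proof. destruct M; simpl; [lra|]. intros He [n Hn]. exists n. lra. Qed.

Lemma near_triangle M (e d x0 y z : R) : near M e x0 y -> Rabs (z - y) < d -> near M (e + d) x0 z.
Proof.
  destruct M; simpl.
  - intros H1 H2. pose proof (Rabs_triang_minus z y x0). lra.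
  - intros [n H1] H2. exists n. pose proof (Rabs_triang_minus z y (x0 + IZR n)) as H3.
    unfold Rminus in *. rewrite Ropp_plus_distr, <- !Rplus_assoc in H3. lra.
Qed.

Lemma near_of_Rabs M (e x0 y : R) : Rabs (y - x0) < e -> near M e x0 y.
Proof. destruct M; simpl; [auto|]. intro H. exists 0%Z. now rewrite Rminus_0_r. Qed.

Definition cut (M : manifold) (e x0 y : R) : R :=
  match M with
  | MR => bump (e / 2) e (y - x0)
  | MS1 => Per (bump (e / 2) e) (y - x0)
  end.

Variables (M : manifold) (e x0 : R).
Hypothesis He : 0 < e < 1 / 2.

Lemma cut_smooth : smooth (cut M e x0).
Proof.
  assert (H : smooth (fun y => y - x0)) by smooth.
  destruct M; simpl.
  - apply (smooth_comp (bump (e / 2) e)); [apply bump_smooth|assumption].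
  - apply (smooth_comp (Per (bump (e / 2) e))); [|assumption].
    apply Per_smooth with e; [lra| |apply bump_smooth]. intros t Ht. apply bump_0; lra.
Qed.

Lemma cut_periodic : periodic_on M (cut M e x0).
Proof.
  destruct M; simpl; [exact I|]. intro x.
  replace (x + 1 - x0) with (x - x0 + 1) by ring. apply Per_period.
Qed.

Lemma cut_1 (y : R) : Rabs (y - x0) <= e / 2 -> cut M e x0 y = 1.
Proof.
  intro H. destruct M; simpl; [apply bump_1; lra|].
  rewrite (Per_near _ 0); rewrite Rminus_0_r; [apply bump_1; lra|lra].
Qed.

Lemma cut_0 (y : R) : ~ near M e x0 y -> cut M e x0 y = 0.
Proof.
  destruct M; simpl; intro H.
  - apply bump_0; lra.
  - destruct (Per_cases (bump (e / 2) e) (y - x0)) as [n [_ E]]. rewrite E.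
    apply bump_0; [lra|]. apply Rnot_lt_le. intro Q. apply H. now exists n.
Qed.

Lemma continuous_bounded (g : R -> R) (a b : R) : (forall x, continuous g x) ->
  exists K, 0 <= K /\ forall x, a <= x <= b -> Rabs (g x) <= K.
Proof.
  intro Hg. destruct (Rle_lt_dec a b) as [L|L].
  - destruct (continuity_ab_maj (fun x => Rabs (g x)) a b L) as [z [Hz _]].
    + intros c _. apply continuity_pt_filterlim.
      apply (continuous_comp g Rabs); [apply Hg|]. apply continuous_Rabs.
    + exists (Rabs (g z)). split; [apply Rabs_pos|]. exact Hz.
  - exists 0. split; [lra|]. intros x Hx. lra.
Qed.

Lemma bounded_periodic (g : R -> R) : (forall x, continuous g x) -> (forall x, g (x + 1) = g x) ->
  exists K, 0 <= K /\ forall x, Rabs (g x) <= K.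
Proof.
  intros Hg Hp. destruct (continuous_bounded g 0 1 Hg) as [K [HK B]].
  exists K. split; [assumption|]. intro x.
  pose proof (base_Int_part x) as [B1 B2].
  pose proof (period_Z g 0 ltac:(intro; rewrite Hp; ring) (Int_part x) (x - IZR (Int_part x))) as E.
  rewrite Rmult_0_r, Rplus_0_r in E.
  replace (x - IZR (Int_part x) + IZR (Int_part x)) with x in E by ring.
  rewrite E. apply B. lra.
Qed.

Lemma isdiff_perturbation (w : R -> R) (K : R) : smooth w -> periodic_on M w ->
  (forall y, Rabs (w y) <= K) -> (forall y, Rabs (Derive w y) < 1) -> isdiff M (fun y => y + w y).
Proof.
  intros Hw Hp HK H1.
  assert (Sm : smooth (fun y => y + w y)) by smooth.
  assert (Pos : forall x, 0 < Derive (fun y => y + w y) x).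
  { intro x. rewrite (Derive_plus (fun y => y) w), Derive_id.
    - specialize (H1 x). apply Rabs_def2 in H1. lra.
    - apply ex_derive_id.
    - now apply smooth_ex_derive. }
  destruct M; simpl.
  - apply isdiff_MR_bounded with K; [assumption..|]. intro x.
    replace (x + w x - x) with (w x) by ring. apply HK.
  - split; [assumption|]. split; [assumption|]. intro x. simpl in Hp. rewrite Hp. ring.
Qed.

Lemma bounded_near (g : R -> R) : (forall x, continuous g x) -> periodic_on M g ->
  (forall y, ~ near M e x0 y -> g y = 0) -> exists K, 0 <= K /\ forall x, Rabs (g x) <= K.
Proof.
  intros Hg Hp H0. destruct M.
  - destruct (continuous_bounded g (x0 - e) (x0 + e) Hg) as [K [HK B]].
    exists K. split; [assumption|]. intro x.
    destruct (Rlt_le_dec (Rabs (x - x0)) e) as [L|L].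
    + apply Rabs_def2 in L. apply B. lra.
    + rewrite H0; [now rewrite Rabs_R0|]. simpl. lra.
  - now apply bounded_periodic.
Qed.

Lemma perturbation_isdiff (w : R -> R) (d : R) : 0 < d -> smooth w -> periodic_on M w ->
  (forall y, ~ near M (e / 2) x0 y -> w y = 0) ->
  exists u0, 0 < u0 /\ forall u, Rabs u < u0 ->
    isdiff M (fun y => y + u * w y) /\ forall y, Rabs (u * w y) < d.
Proof.
  intros Hd Hw Hp H0.
  assert (He2 : 0 < e / 2 < 1 / 2) by lra.
  destruct (bounded_near w (smooth_continuous w Hw) Hp) as [K1 [HK1 B1]].
  { intros y Hy. apply H0. intro Q. apply Hy. apply near_le with (e / 2); [lra|assumption]. }
  destruct (bounded_near (Derive w) (smooth_continuous _ (smooth_Derive w Hw))) as [K2 [HK2 B2]].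
  { destruct M; simpl; [exact I|]. intro x. rewrite <- Derive_shift. apply Derive_ext, Hp. }
  { intros y Hy. rewrite (Derive_ext_loc w (fun _ => 0)); [apply Derive_const|].
    apply locally_Rabs_ex. exists (e / 2). split; [lra|]. intros z Hz. apply H0. intro Q.
    apply Hy. replace e with (e / 2 + e / 2) by field.
    apply near_triangle with z; [assumption|]. now rewrite Rabs_minus_sym. }
  exists (Rmin (d / (K1 + 1)) (1 / (K2 + 1))). split.
  { apply Rmin_pos; apply Rdiv_lt_0_compat; lra. }
  intros u Hu.
  assert (Hu1 : Rabs u * (K1 + 1) < d).
  { apply Rmult_lt_reg_r with (/ (K1 + 1)); [apply Rinv_0_lt_compat; lra|].
    rewrite Rmult_assoc, Rinv_r, Rmult_1_r by lra.
    apply Rlt_le_trans with (1 := Hu). apply Rmin_l. }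
  assert (Hu2 : Rabs u * (K2 + 1) < 1).
  { apply Rmult_lt_reg_r with (/ (K2 + 1)); [apply Rinv_0_lt_compat; lra|].
    rewrite Rmult_assoc, Rinv_r, Rmult_1_r by lra.
    apply Rlt_le_trans with (1 := Hu). apply Rmin_r. }
  pose proof (Rabs_pos u).
  assert (Bd : forall y, Rabs (u * w y) < d).
  { intro y. rewrite Rabs_mult. specialize (B1 y). nra. }
  split; [|assumption].
  apply isdiff_perturbation with d.
  - apply smooth_mult; [apply smooth_const|assumption].
  - destruct M; simpl in *; [exact I|]. intro x. now rewrite Hp.
  - intro y. left. apply Bd.
  - intro y. rewrite Derive_scal, Rabs_mult. specialize (B2 y). nra.
Qed.

End Perturbations.

(** * Invariance under diffeomorphisms supported near a point *)

Section LocalInvariance.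
Open Scope C_scope.
Variables (M : manifold) (l m : C) (k : nat).

(** Within 2e of x0, points stay within 3e after the move, so both sides vanish; farther away w is
    zero on a neighbourhood and the diffeomorphism is the identity there. *)
Lemma pull_disjoint (w : R -> R) (e x0 : R) (a : coefs) : (0 < e)%R ->
  isdiff M (fun y => y + w y)%R -> (forall y, Rabs (w y) < e)%R ->
  (forall y, ~ near M e x0 y -> w y = 0%R) ->
  validop M k a -> (forall y, near M (3 * e) x0 y -> forall i, a i y = 0) ->
  pull l m k (fun y => y + w y)%R a = a.
Proof.
  intros He Hf Hw H0 Ha Ha0. coefs_ext i y.
  destruct (excluded_middle_informative (near M (2 * e) x0 y)) as [N|N].
  - rewrite (Ha0 y) by (apply near_le with (2 * e)%R; [lra|assumption]).
    unfold pull. rewrite csum_zero; [ring|]. intros j _. rewrite Ha0; [ring|].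
    replace (3 * e)%R with (2 * e + e)%R by ring. apply near_triangle with y; [assumption|].
    replace (y + w y - y)%R with (w y) by ring. apply Hw.
  - assert (L : locally y (fun z => w z = 0%R)).
    { apply locally_Rabs_ex. exists e. split; [assumption|]. intros z Hz. apply H0. intro Q.
      apply N. replace (2 * e)%R with (e + e)%R by ring.
      apply near_triangle with z; [assumption|]. now rewrite Rabs_minus_sym. }
    rewrite (pull_id_germ M); [| |assumption].
    + rewrite (locally_singleton _ _ L). now rewrite Rplus_0_r.
    + apply locally_locally in L. apply filter_imp with (2 := L). intros z Hz.
      rewrite (Derive_ext_loc _ (fun t => t)); [apply Derive_id|].
      apply filter_imp with (2 := Hz). intros t Ht. rewrite Ht. ring.
Qed.

Variable T : Op.
Hypothesis HT : in_I M k l m T.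

Lemma T_valid a : validop M k a -> validop M k (T a).
Proof. apply HT. Qed.

Lemma T_add a b : validop M k a -> validop M k b -> T (coef_add a b) = coef_add (T a) (T b).
Proof. apply in_I_iff in HT. apply HT. Qed.

Lemma T_scal c a : validop M k a -> T (coef_scal c a) = coef_scal c (T a).
Proof. apply in_I_iff in HT. apply HT. Qed.

Lemma T_pull f b : isdiff M f -> validop M k b -> T (pull l m k f b) = pull l m k f (T b).
Proof. apply in_I_iff in HT. apply HT. Qed.

(* The diffeomorphisms supported near x0 fix [a], hence [T a]. *)
Lemma T_pull_fixed (x0 E : R) (a : coefs) (w : R -> R) : (0 < E < 1 / 2)%R -> validop M k a ->
  (forall y, near M E x0 y -> forall i, a i y = 0) ->
  smooth w -> periodic_on M w -> (forall y, ~ near M (E / 3) x0 y -> w y = 0%R) ->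
  exists u0, (0 < u0)%R /\ forall u, (Rabs u < u0)%R ->
    isdiff M (fun y => y + u * w y)%R /\
    pull l m k (fun y => y + u * w y)%R (T a) = T a.
Proof.
  intros HE Ha Ha0 Hw Hp H0.
  destruct (perturbation_isdiff M (2 * (E / 3)) x0 ltac:(lra) w (E / 3)) as [u0 [Hu0 P]].
  - lra.
  - assumption.
  - assumption.
  - intros y Hy. apply H0. intro Q. apply Hy. now replace (2 * (E / 3) / 2)%R with (E / 3)%R by field.
  - exists u0. split; [assumption|]. intros u Hu. destruct (P u Hu) as [Hd Hb].
    split; [assumption|].
    rewrite <- T_pull by assumption. f_equal.
    apply pull_disjoint with (w := fun y => (u * w y)%R) (e := (E / 3)%R) (x0 := x0); try assumption; try lra.
    + intros y Hy. rewrite H0 by assumption. ring.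
    + replace (3 * (E / 3))%R with E by field. assumption.
Qed.

(** Among the diffeomorphisms fixing T a are some that equal the translation by y - x0 near x0;
    reading the invariance at x0 compares T a at y and at x0. *)
Lemma T_local_const (x0 E : R) (a : coefs) : (0 < E < 1 / 2)%R -> validop M k a ->
  (forall y, near M E x0 y -> forall i, a i y = 0) ->
  locally x0 (fun y => forall i, T a i y = T a i x0).
Proof.
  intros HE Ha Ha0.
  assert (HE3 : (0 < E / 3 < 1 / 2)%R) by lra.
  destruct (T_pull_fixed x0 E a (cut M (E / 3) x0)) as [u0 [Hu0 P]]; try assumption.
  - now apply cut_smooth.
  - apply cut_periodic.
  - intros y Hy. now apply cut_0.
  - apply locally_Rabs_ex. exists u0. split; [assumption|]. intros y Hy i.
    destruct (P (y - x0)%R Hy) as [_ Hd].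
    transitivity (pull l m k (fun z => z + (y - x0) * cut M (E / 3) x0 z)%R (T a) i x0); [|now rewrite Hd].
    rewrite (pull_id_germ M).
    + rewrite cut_1; [f_equal; ring|assumption|]. rewrite Rminus_diag, Rabs_R0. lra.
    + apply locally_Rabs_ex. exists (E / 6)%R. split; [lra|]. intros z Hz.
      rewrite (Derive_ext_loc _ (fun t => t + (y - x0))%R).
      * rewrite Derive_plus, Derive_id, Derive_const; [ring|apply ex_derive_id|apply @ex_derive_const].
      * apply locally_Rabs_ex. exists (E / 6 - Rabs (z - x0))%R. split; [lra|]. intros t Ht.
        pose proof (Rabs_triang_minus t z x0). rewrite cut_1; [ring|assumption|lra].
    + now apply T_valid.
Qed.

End LocalInvariance.

Arguments T_valid {M l m k T}.
Arguments T_add {M l m k T}.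
Arguments T_scal {M l m k T}.
Arguments T_pull {M l m k T}.
Arguments T_pull_fixed {M l m k T}.
Arguments T_local_const {M l m k T}.

Section Algebra.
Open Scope C_scope.
Variables (M : manifold) (k : nat).

Lemma valid_add a b : validop M k a -> validop M k b -> validop M k (coef_add a b).
Proof.
  intros [H1 H2] [H3 H4]. split.
  - intros i Hi. apply (isfun_plus M (a i) (b i)); auto.
  - intros i x Hi. unfold coef_add. rewrite H2, H4 by assumption. ring.
Qed.

Lemma valid_scal c a : validop M k a -> validop M k (coef_scal c a).
Proof.
  intros [H1 H2]. split.
  - intros i Hi. apply (isfun_mult M (fun _ => c) (a i)); [apply isfun_const|auto].
  - intros i x Hi. unfold coef_scal. rewrite H2 by assumption. ring.
Qed.

Lemma valid_csmooth a : validop M k a -> forall i, csmooth (a i).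
Proof.
  intros [H1 H2] i. destruct (le_lt_dec i k) as [L|L].
  - apply (isfun_csmooth M). now apply H1.
  - replace (a i) with (fun _ : R => RtoC 0); [apply csmooth_const|].
    extensionality x. symmetry. now apply H2.
Qed.

Lemma valid_single j phi : (j <= k)%nat -> isfun M phi -> validop M k (single j phi).
Proof.
  intros Hj Hp. split.
  - intros i _. unfold single. destruct (Nat.eqb i j); [assumption|apply isfun_const].
  - intros i x Hi. unfold single. destruct (Nat.eqb_spec i j); [lia|reflexivity].
Qed.

End Algebra.

Definition local_op (M : manifold) (k : nat) (T : Op) : Prop :=
  forall a x, validop M k a -> locally x (fun y => forall i, a i y = RtoC 0) ->
    forall i, T a i x = RtoC 0.

Lemma sign_cases (s : R) : s * s = 1 -> s = 1 \/ s = -1.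
Proof. intro H. destruct (Rle_lt_dec 0 s); [left|right]; nra. Qed.

Lemma sign_le_Rabs (s t : R) : s * s = 1 -> s * t <= Rabs t.
Proof.
  intro H. rewrite <- (Rmult_1_l (Rabs t)). destruct (sign_cases s H) as [->| ->].
  - pose proof (Rle_abs t). lra.
  - pose proof (Rle_abs (- t)). rewrite Rabs_Ropp in *. lra.
Qed.

Section LineLocality.
Open Scope C_scope.
Variables (l m : C) (k : nat) (T : Op).
Hypothesis HT : in_I MR k l m T.

(* [s = 1] or [s = -1]; the sum of the translates of [a] by s, 2 s, 3 s, ... is locally finite. *)
Lemma swindle (s c : R) (a : coefs) : (s * s = 1)%R -> validop MR k a ->
  (forall i y, (s * (y - c) < 0)%R -> a i y = 0) ->
  exists b, validop MR k b /\ (forall i y, (s * (y - c) < 0)%R -> b i y = 0) /\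
    forall i y, b i y = a i y + b i (y - s)%R.
Proof.
  intros Hs Ha Ha0.
  set (N := fun y => Z.to_nat (up (s * (y - c)))).
  assert (HN : forall y, (s * (y - c) < INR (N y))%R).
  { intro y. unfold N. destruct (archimed (s * (y - c))) as [A _].
    rewrite INR_IZR_INZ.
    apply Rlt_le_trans with (1 := A). apply IZR_le. lia. }
  set (b := fun (i : nat) y => csum (N y) (fun n => a i (y - s * INR n)%R)).
  assert (Hz : forall i y (n : nat), (s * (y - c) < INR n)%R -> a i (y - s * INR n)%R = 0).
  { intros i y n Hn. apply Ha0.
    replace (s * (y - s * INR n - c))%R with (s * (y - c) - (s * s) * INR n)%R by ring.
    rewrite Hs. lra. }
  (* The n-th translate vanishes at y once n exceeds s (y - c), so any longer partial sum has the
     same value. This allows a fixed number of terms on a neighbourhood. *)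
  assert (Hst : forall i y (p : nat), (s * (y - c) < INR p)%R ->
    b i y = csum p (fun n => a i (y - s * INR n)%R)).
  { assert (A : forall i y (p q : nat), (s * (y - c) < INR p)%R ->
      csum (q + p) (fun n => a i (y - s * INR n)%R) = csum p (fun n => a i (y - s * INR n)%R)).
    { intros i y p q Hp. induction q as [|q IH]; [reflexivity|].
      cbn [Nat.add csum]. rewrite IH, (Hz i y (S (q + p))); [ring|].
      apply Rlt_le_trans with (1 := Hp). apply le_INR. lia. }
    intros i y p Hp. unfold b. destruct (le_lt_dec (N y) p) as [L|L].
    - replace p with ((p - N y) + N y)%nat by lia. now rewrite A.
    - replace (N y) with ((N y - p) + p)%nat by lia. now rewrite A. }
  exists b. split; [split|split].
  - intros i Hi. apply (csmooth_local (b i)). intro x.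
    exists (fun y => csum (S (N x)) (fun n => a i (y - s * INR n)%R)). split.
    + apply (csmooth_csum (S (N x)) (fun n y => a i (y - s * INR n)%R)). intros n _.
      apply (csmooth_comp (a i)); [now apply (proj1 Ha)|].
      smooth.
    + apply locally_Rabs_ex. exists 1%R. split; [lra|]. intros y Hy. apply Hst.
      rewrite S_INR. pose proof (HN x).
      pose proof (sign_le_Rabs s (y - x) Hs).
      lra.
  - intros i x Hi. unfold b. apply csum_zero. intros n _. now apply Ha.
  - intros i y Hy. rewrite (Hst i y 0%nat); [|simpl; lra].
    simpl. rewrite Rmult_0_r, Rminus_0_r. now apply Ha0.
  - intros i y. pose proof (HN (y - s)%R) as H1.
    replace (s * (y - s - c))%R with (s * (y - c) - s * s)%R in H1 by ring. rewrite Hs in H1.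
    rewrite (Hst i y (S (N (y - s)%R))) by (rewrite S_INR; lra).
    unfold b. generalize (N (y - s)%R). intro p. clear.
    induction p as [|p IH].
    + simpl csum. rewrite !Rmult_0_r, !Rminus_0_r. simpl INR.
      replace (y - s * 1)%R with (y - s)%R by ring. reflexivity.
    + change (csum (S (S p)) (fun n => a i (y - s * INR n)%R))
        with (csum (S p) (fun n => a i (y - s * INR n)%R) + a i (y - s * INR (S (S p)))%R).
      rewrite IH.
      change (csum (S p) (fun n => a i (y - s - s * INR n)%R))
        with (csum p (fun n => a i (y - s - s * INR n)%R) + a i (y - s - s * INR (S p))%R).
      rewrite (S_INR (S p)).
      replace (y - s * (INR (S p) + 1))%R with (y - s - s * INR (S p))%R by ring. ring.
Qed.

Lemma isdiff_MR_affine (r c : R) : (0 < r)%R -> isdiff MR (fun y => r * y + c)%R /\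
  forall x, Derive (fun y => r * y + c)%R x = r.
Proof.
  intro Hr.
  assert (S : forall r c : R, smooth (fun y => r * y + c)%R).
  { intros. smooth. }
  assert (D : forall x, Derive (fun y => r * y + c)%R x = r).
  { intro x. apply is_derive_unique. auto_derive; [exact I|ring]. }
  split; [|assumption]. split; [apply S|]. split; [intro x; now rewrite D|].
  exists (fun y => / r * y + (- c / r))%R. split; [apply S|]. split; intro x; field; lra.
Qed.

(** Applying T to b = a + tau b gives T a = T b - tau (T b). On the open half-line where b vanishes
    T b is locally constant, hence constant, and tau reads it at another point of that half-line; so
    the difference is zero. *)
Lemma T_half_line (s c : R) (a : coefs) : (s * s = 1)%R -> validop MR k a ->
  (forall i y, (s * (y - c) < 0)%R -> a i y = 0) ->
  forall i y, (s * (y - c) < 0)%R -> T a i y = 0.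
Proof.
  intros Hs Ha Ha0 i y Hy.
  destruct (swindle s c a Hs Ha Ha0) as [b [Hb [Hb0 Eb]]].
  destruct (isdiff_MR_affine 1 (- s) ltac:(lra)) as [Hd Dd].
  set (f := fun z => (1 * z + - s)%R) in *.
  assert (Pf : forall d, validop MR k d -> forall i z, pull l m k f d i z = d i (z - s)%R).
  { intros d Hvd i' z. rewrite (pull_id_germ MR); [|apply filter_forall; exact Dd|assumption].
    unfold f. f_equal. ring. }
  assert (E : b = coef_add a (pull l m k f b)).
  { coefs_ext i' z. unfold coef_add. rewrite Pf by assumption. apply Eb. }
  assert (ET : T b = coef_add (T a) (pull l m k f (T b))).
  { rewrite E at 1. rewrite (T_add HT); [|assumption|now apply pull_valid].
    now rewrite (T_pull HT). }
  pose proof (T_valid HT b Hb) as HTb.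
  assert (Hc : T b i y = T b i (y - s)%R).
  { apply CD_0_eq; [now apply (valid_csmooth MR k)|]. intros t Ht.
    assert (Hts : (s * (t - c) < 0)%R).
    { revert Ht. destruct (sign_cases s Hs) as [->| ->]; unfold Rmin, Rmax; destruct (Rle_dec y _); lra. }
    rewrite (CD_ext_loc _ (fun _ => T b i t)); [apply CD_const|].
    set (E0 := Rmin (- (s * (t - c))) (1 / 4)).
    assert (0 < E0)%R by (apply Rmin_pos; lra).
    assert (E0 <= 1 / 4)%R by apply Rmin_r.
    assert (E0 <= - (s * (t - c)))%R by apply Rmin_l.
    assert (Hb' : forall z, near MR E0 t z -> forall j, b j z = 0).
    { intros z Hz j. apply Hb0. simpl in Hz. pose proof (sign_le_Rabs s (z - t) Hs). lra. }
    apply filter_imp with (2 := T_local_const HT t E0 b ltac:(lra) Hb Hb').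
    intros z Hz. apply Hz. }
  assert (F := f_equal (fun d => d i y) ET). simpl in F. unfold coef_add in F.
  rewrite Pf in F by assumption. rewrite <- Hc in F.
  transitivity (T b i y - T b i y); [|ring]. rewrite F at 1. ring.
Qed.

Lemma half_valid (s x e : R) (a : coefs) : (s * s = 1)%R -> (0 < e)%R -> validop MR k a ->
  (forall y, (Rabs (y - x) < e)%R -> forall i, a i y = 0) ->
  validop MR k (fun i y => if Rlt_dec (s * (y - x)) 0 then 0 else a i y).
Proof.
  intros Hs He Ha L. split.
  - intros j Hj. apply csmooth_local. intro y. destruct (Rlt_dec (s * (y - x)) 0) as [Q|Q].
    + exists (fun _ => RtoC 0). split; [apply csmooth_const|].
      apply locally_Rabs_ex. exists (- (s * (y - x)))%R. split; [lra|]. intros z Hz.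
      pose proof (sign_le_Rabs s (z - y) Hs). destruct (Rlt_dec (s * (z - x)) 0); [reflexivity|lra].
    + exists (a j). split; [now apply (proj1 Ha)|].
      apply locally_Rabs_ex. exists e. split; [lra|]. intros z Hz.
      destruct (Rlt_dec (s * (z - x)) 0); [|reflexivity]. symmetry. apply L.
      apply Rabs_def2 in Hz. destruct (sign_cases s Hs) as [->| ->]; apply Rabs_def1; lra.
  - intros j y Hj. destruct (Rlt_dec (s * (y - x)) 0); [reflexivity|now apply (proj2 Ha)].
Qed.

Lemma T_local_MR : local_op MR k T.
Proof.
  intros a x Ha L i. apply locally_Rabs_ex in L. destruct L as [e [He L]].
  set (h := (fun s i y => if Rlt_dec (s * (y - x)) 0 then RtoC 0 else a i y) : R -> coefs).
  assert (Vh : forall s, (s * s = 1)%R -> validop MR k (h s)).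
  { intros s Hs. now apply half_valid with e. }
  (* Both halves keep the point x itself, which is harmless because a vanishes there. *)
  assert (E : a = coef_add (h 1%R) (h (-1)%R)).
  { coefs_ext j y. unfold coef_add, h.
    destruct (Rlt_dec (1 * (y - x)) 0); destruct (Rlt_dec (-1 * (y - x)) 0); try ring; [lra|].
    rewrite L; [ring|]. replace (y - x)%R with 0%R by lra. now rewrite Rabs_R0. }
  assert (Z : forall s, (s * s = 1)%R -> T (h s) i x = 0).
  { intros s Hs. apply (T_half_line s (x + s * (e / 2)) (h s)); [assumption|now apply Vh| |].
    - intros j y Hy. unfold h. destruct (Rlt_dec (s * (y - x)) 0) as [|Q]; [reflexivity|].
      apply L. destruct (sign_cases s Hs) as [->| ->]; apply Rabs_def1; lra.
    - destruct (sign_cases s Hs) as [->| ->]; lra. }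
  rewrite E, (T_add HT) by (apply Vh; ring). unfold coef_add. rewrite !Z by ring. ring.
Qed.

End LineLocality.

(** * Operators fixed by the diffeomorphisms supported near a point *)

Section CircleShape.
Open Scope C_scope.

Lemma cDn_cpow_exp (z : C) (v x0 : R) (i : nat) (x : R) :
  cDn i (fun y => cpow (exp (v * (y - x0))) z) x
  = Cpow (z * RtoC v) i * cpow (exp (v * (x - x0))) z.
Proof.
  revert x. induction i as [|i IH]; intro x.
  - rewrite cDn_0. simpl. ring.
  - rewrite cDn_S. replace (cDn i (fun y => cpow (exp (v * (y - x0))) z))
      with (fun x => Cpow (z * RtoC v) i * cpow (exp (v * (x - x0))) z)
      by (extensionality y; symmetry; apply IH).
    assert (S : smooth (fun y => exp (v * (y - x0)))) by smooth.
    rewrite CD_scal.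
    2: { apply (cpow_smooth (fun y => exp (v * (y - x0)))); [assumption|]. intro. apply exp_pos. }
    replace (CD (fun y => cpow (exp (v * (y - x0))) z) x)
      with (z * RtoC v * cpow (exp (v * (x - x0))) z); [simpl; ring|].
    symmetry. unfold cpow, CD. rewrite ln_exp.
    rewrite (Derive_ext (fun y => Re _) (fun y => exp (Re z * (v * (y - x0))) * cos (Im z * (v * (y - x0))))%R)
      by (intro t; simpl; now rewrite ln_exp).
    rewrite (Derive_ext (fun y => Im _) (fun y => exp (Re z * (v * (y - x0))) * sin (Im z * (v * (y - x0))))%R)
      by (intro t; simpl; now rewrite ln_exp).
    apply C_eq; simpl; apply is_derive_unique; auto_derive; try exact I; unfold Re, Im, Rminus; ring.
Qed.

Lemma exp_minus_1_bound (s : R) : (Rabs s <= 1 / 2)%R -> (Rabs (exp s - 1) <= 2 * Rabs s)%R.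
Proof.
  intro H. apply Rabs_le_between in H.
  pose proof (exp_ineq1_le s) as H1. pose proof (exp_ineq1_le (- s)) as H2.
  rewrite exp_Ropp in H2. pose proof (exp_pos s) as H3.
  assert (H4 : (exp s * (1 - s) <= 1)%R).
  { apply Rmult_le_reg_r with (/ exp s)%R; [now apply Rinv_0_lt_compat|].
    replace (exp s * (1 - s) * / exp s)%R with (1 - s)%R by (field; lra). lra. }
  apply Rabs_le. unfold Rabs. destruct (Rcase_abs s); split; nra.
Qed.

Variables (M : manifold) (l m : C) (k : nat) (T : Op).
Hypothesis HT : in_I M k l m T.
Variables (x0 E : R) (a : coefs).
Hypothesis HE : (0 < E < 1 / 2)%R.
Hypothesis Ha : validop M k a.
Hypothesis Ha0 : forall y, near M E x0 y -> forall i, a i y = 0.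

(** A cut-off of y - x0. Its periodic factor [proj] lets one formula serve the line and the
    circle. *)
Let tilt (y : R) : R := (cut M (E / 3) x0 y * proj (y - x0))%R.

Lemma tilt_smooth : smooth tilt.
Proof.
  pose proof proj_smooth. pose proof (cut_smooth M (E / 3) x0 ltac:(lra)). unfold tilt. smooth.
Qed.

Lemma tilt_periodic : periodic_on M tilt.
Proof.
  pose proof (cut_periodic M (E / 3) x0) as P. unfold tilt. destruct M; simpl in *; [exact I|].
  intro x. rewrite P. replace (x + 1 - x0)%R with (x - x0 + 1)%R by ring. now rewrite proj_period.
Qed.

Lemma tilt_support (y : R) : ~ near M (E / 3) x0 y -> tilt y = 0%R.
Proof. intro H. unfold tilt. rewrite cut_0; [ring|lra|assumption]. Qed.

Lemma tilt_near (y : R) : (Rabs (y - x0) <= Rmin (E / 6) (1 / 8))%R -> tilt y = (y - x0)%R.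
Proof.
  intro H. pose proof (Rmin_l (E / 6) (1 / 8)). pose proof (Rmin_r (E / 6) (1 / 8)).
  unfold tilt. rewrite cut_1, proj_near by lra. ring.
Qed.

Lemma tilt_locally : locally x0 (fun y => tilt y = (y - x0)%R).
Proof.
  apply locally_Rabs_ex. exists (Rmin (E / 6) (1 / 8)). split; [apply Rmin_pos; lra|].
  intros y Hy. apply tilt_near. lra.
Qed.

(** Local homotheties of ratio r about x0 fix T a, so a nonzero coefficient of order i at x0 forces
    r^(m - l - i) = 1 for all r near 1. *)
Lemma T_weight (i : nat) : (i <= k)%nat -> T a i x0 = 0 \/ m = l + RtoC (INR i).
Proof.
  intro Hi.
  destruct (T_pull_fixed HT x0 E a tilt HE Ha Ha0 tilt_smooth tilt_periodic tilt_support) as [u0 [Hu0 P]].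
  destruct (excluded_middle_informative (T a i x0 = 0)) as [Q|Q]; [now left|right].
  assert (Z : m - (l + RtoC (INR i)) = 0).
  { apply cpow_eq_1. apply locally_Rabs_ex. exists (Rmin u0 (1 / 2)). split; [apply Rmin_pos; lra|].
    intros r Hr. pose proof (Rmin_l u0 (1 / 2)). pose proof (Rmin_r u0 (1 / 2)).
    assert (Hr0 : (0 < r)%R) by (assert (Rabs (r - 1) < 1 / 2)%R as B by lra; apply Rabs_def2 in B; lra).
    destruct (P (r - 1)%R ltac:(lra)) as [Hd Hp].
    assert (F : pull l m k (fun y => y + (r - 1) * tilt y)%R (T a) i x0 = T a i x0) by now rewrite Hp.
    rewrite (pull_affine l m k _ _ i x0 r Hi) in F.
    - rewrite (locally_singleton _ _ tilt_locally) in F.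
      replace (x0 + (r - 1) * (x0 - x0))%R with x0 in F by ring.
      assert (G : cpow r m * (RtoC ((/ r) ^ i) * cpow (/ r) l) = 1).
      { transitivity (cpow r m * (RtoC ((/ r) ^ i) * cpow (/ r) l) * T a i x0 * / T a i x0); [field; exact Q|].
        rewrite F. field. exact Q. }
      rewrite <- cpow_nat in G by now apply Rinv_0_lt_compat.
      pose proof (cpow_inv r l Hr0) as I1. pose proof (cpow_inv r (RtoC (INR i)) Hr0) as I2.
      pose proof (cpow_neq_0 r (l + RtoC (INR i)) Hr0) as N0.
      replace m with (m - (l + RtoC (INR i)) + (l + RtoC (INR i))) in G by ring.
      rewrite cpow_plus, (cpow_plus r l) in G.
      transitivity (cpow r (m - (l + RtoC (INR i))) * (cpow r l * cpow (/ r) l)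
        * (cpow r (RtoC (INR i)) * cpow (/ r) (RtoC (INR i)))); [rewrite I1, I2; ring|].
      rewrite <- G. ring.
    - generalize (proj1 (locally_Rabs_ex _ _) tilt_locally). intros [e [He L]].
      apply locally_Rabs_ex. exists e. split; [assumption|]. intros y Hy.
      rewrite (Derive_ext_loc _ (fun t => t + (r - 1) * (t - x0))%R).
      + apply is_derive_unique. auto_derive; [exact I|ring].
      + apply locally_Rabs_ex. exists (e - Rabs (y - x0))%R. split; [lra|]. intros t Ht.
        pose proof (Rabs_triang_minus t y x0). rewrite L; [reflexivity|lra]. }
  transitivity (m - (l + RtoC (INR i)) + (l + RtoC (INR i))); [ring|]. rewrite Z. ring.
Qed.

(** Affine germs only compare weights; a further restriction needs a curved germ. This one has f' =
    exp(v (y - x0)), so every derivative of (f')^l is explicit. Substituting [tilt] for y - x0 cuts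
    it off. *)
Lemma exponential_germ : exists f v, isdiff M f /\ (0 < v)%R /\ pull l m k f (T a) = T a /\
  locally x0 (fun y => f y = (x0 + (exp (v * (y - x0)) - 1) / v)%R).
Proof.
  destruct (bounded_near M (E / 3) x0 tilt) as [B1 [HB1 b1]].
  { apply smooth_continuous, tilt_smooth. }
  { apply tilt_periodic. }
  { apply tilt_support. }
  destruct (bounded_near M (2 * E / 3) x0 (Derive tilt)) as [B2 [HB2 b2]].
  { apply smooth_continuous, smooth_Derive, tilt_smooth. }
  { pose proof tilt_periodic as P. destruct M; simpl in *; [exact I|]. intro x.
    rewrite <- Derive_shift. apply Derive_ext, P. }
  { intros y Hy. rewrite (Derive_ext_loc tilt (fun _ => 0%R)); [apply Derive_const|].
    apply locally_Rabs_ex. exists (E / 3)%R. split; [lra|]. intros z Hz. apply tilt_support. intro Q.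
    apply Hy. replace (2 * E / 3)%R with (E / 3 + E / 3)%R by field.
    apply near_triangle with z; [assumption|]. now rewrite Rabs_minus_sym. }
  (* K dominates the products of bounds on [tilt] and its derivative that occur below. The choice v
     K = E / 12 keeps the exponents below 1/2, the displacement W below E / 3 and its slope below
     1. *)
  set (K := (1 + B1 + B1 * B2 + B1 * B1)%R).
  assert (HK : (1 <= K)%R) by (unfold K; nra).
  set (v := (E / (12 * K))%R).
  assert (Hv : (0 < v)%R) by (unfold v; apply Rdiv_lt_0_compat; lra).
  assert (HvK : (v * K = E / 12)%R) by (unfold v; field; lra).
  set (W := fun y => ((exp (v * tilt y) - 1) / v - tilt y)%R).
  assert (SW : smooth W) by (pose proof tilt_smooth; unfold W; smooth).
  assert (small : forall y, (Rabs (v * tilt y) <= v * B1)%R).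
  { intro y. rewrite Rabs_mult, (Rabs_pos_eq v) by lra. apply Rmult_le_compat_l; [lra|apply b1]. }
  assert (vB1 : (v * B1 <= E / 12)%R) by (rewrite <- HvK; apply Rmult_le_compat_l; unfold K; nra).
  assert (ebd : forall s, (Rabs s <= v * B1)%R -> (Rabs (exp s - 1) <= 2 * (v * B1))%R).
  { intros s Hs. eapply Rle_trans; [apply exp_minus_1_bound; lra|]. lra. }
  assert (DW : forall y, Derive W y = ((exp (v * tilt y) - 1) * Derive tilt y)%R).
  { intro y. unfold W. apply is_derive_unique.
    pose proof (smooth_ex_derive tilt tilt_smooth y) as Dw.
    auto_derive; [repeat split; assumption|].
    change (Derive (fun x => tilt x) y) with (Derive tilt y). field. lra. }
  assert (Wb : forall y, (Rabs (W y) < E / 3)%R).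
  { intro y. unfold W.
    destruct (derive_mvt (fun t => (exp (v * t) - 1) / v - t)%R 0 (tilt y)) as [c [Hc Ec]].
    { smooth. }
    rewrite Rmult_0_r, exp_0, !Rminus_0_r in Ec.
    replace (Derive (fun t => (exp (v * t) - 1) / v - t)%R c) with (exp (v * c) - 1)%R in Ec.
    2: { symmetry. apply is_derive_unique. auto_derive; [exact I|field; lra]. }
    replace ((exp (v * tilt y) - 1) / v - tilt y)%R with ((exp (v * c) - 1) * tilt y)%R
      by (rewrite <- Ec; field; lra).
    rewrite Rabs_mult.
    assert (Rabs c <= Rabs (tilt y))%R.
    { revert Hc. unfold Rmin, Rmax, Rabs.
      destruct (Rle_dec 0 (tilt y)); destruct (Rcase_abs c); destruct (Rcase_abs (tilt y)); lra. }
    assert (Rabs (exp (v * c) - 1) <= 2 * (v * B1))%R.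
    { apply ebd. rewrite Rabs_mult, (Rabs_pos_eq v) by lra. specialize (b1 y).
      apply Rmult_le_compat_l; lra. }
    specialize (b1 y). pose proof (Rabs_pos (tilt y)).
    apply Rle_lt_trans with (2 * (v * (B1 * B1)))%R.
    - replace (2 * (v * (B1 * B1)))%R with (2 * (v * B1) * B1)%R by ring.
      apply Rmult_le_compat; try apply Rabs_pos; assumption.
    - assert (v * (B1 * B1) <= v * K)%R by (apply Rmult_le_compat_l; unfold K; nra). lra. }
  assert (Wd : forall y, (Rabs (Derive W y) < 1)%R).
  { intro y. rewrite DW, Rabs_mult. pose proof (ebd _ (small y)) as H1. specialize (b2 y).
    apply Rle_lt_trans with (2 * (v * (B1 * B2)))%R.
    - replace (2 * (v * (B1 * B2)))%R with (2 * (v * B1) * B2)%R by ring.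
      apply Rmult_le_compat; try apply Rabs_pos; assumption.
    - assert (v * (B1 * B2) <= v * K)%R by (apply Rmult_le_compat_l; unfold K; nra). lra. }
  assert (Hd : isdiff M (fun y => y + W y)%R).
  { apply isdiff_perturbation with (E / 3)%R; [assumption| | |assumption].
    - pose proof tilt_periodic as P. unfold W. destruct M; simpl in *; [exact I|]. intro x. now rewrite P.
    - intro y. left. apply Wb. }
  exists (fun y => y + W y)%R, v. split; [assumption|]. split; [assumption|]. split.
  - rewrite <- (T_pull HT) by assumption. f_equal.
    apply (pull_disjoint M l m k W (E / 3) x0); try assumption; try lra.
    + intros y Hy. unfold W. rewrite tilt_support by assumption. rewrite Rmult_0_r, exp_0. field. lra.
    + replace (3 * (E / 3))%R with E by field. assumption.
  - apply filter_imp with (2 := tilt_locally). intros y Hy. unfold W. rewrite Hy. ring.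
Qed.

(** By [T_weight] a single order i survives at x0, so psi^(i)(x0) = 0 must imply the same for the
    transported psi. With the exponential germ and i >= 1, psi = 1 gives (l v)^i = 0, hence l = 0.
    With i >= 2, psi = 1 + v (y - x0) becomes exp(v (y - x0)), whose i-th derivative at x0 is not
    zero. *)
Lemma T_shape (i : nat) : (i <= k)%nat ->
  T a i x0 = 0 \/ (i = 0%nat /\ m = l) \/ (i = 1%nat /\ l = 0 /\ m = 1).
Proof.
  intro Hi. destruct (T_weight i Hi) as [H|H]; [now left|].
  destruct (excluded_middle_informative (T a i x0 = 0)) as [Q|Q]; [now left|right].
  destruct (Nat.eq_dec i 0) as [->|Hi0]; [left; split; [reflexivity|rewrite H; simpl; ring]|right].
  assert (Other : forall j, (j <= k)%nat -> j <> i -> T a j x0 = 0).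
  { intros j Hj Hji. destruct (T_weight j Hj) as [H'|H']; [assumption|exfalso].
    apply Hji. apply INR_eq. apply RtoC_inj.
    transitivity (m - l); [rewrite H'|rewrite H]; ring. }
  destruct exponential_germ as [f [v [Hf [Hv [Hp L]]]]].
  assert (Lf : locally x0 (fun y => Derive f y = exp (v * (y - x0)))).
  { apply locally_locally in L. apply filter_imp with (2 := L). intros y Hy.
    rewrite (Derive_ext_loc _ _ _ Hy). apply is_derive_unique. auto_derive; [exact I|]. unfold Rminus. field. lra. }
  assert (Fx : f x0 = x0).
  { rewrite (locally_singleton _ _ L). rewrite Rminus_diag, Rmult_0_r, exp_0. field. lra. }
  assert (Red : forall phi, applyop k (T a) phi x0 = T a i x0 * cDn i phi x0).
  { intro phi. unfold applyop. apply (csum_single k i (fun i => T a i x0 * cDn i phi x0)); [assumption|].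
    intros j Hj Hji. rewrite Other by assumption. ring. }
  assert (Test : forall psi, csmooth psi -> cDn i psi x0 = 0 -> cDn i (act l f psi) x0 = 0).
  { intros psi Hpsi H0.
    pose proof (pull_apply M l m k f (T a) psi x0 Hf Hpsi) as A.
    rewrite Hp, Red in A. unfold act at 2 in A. rewrite Fx, Red, H0 in A.
    transitivity (T a i x0 * cDn i (act l f psi) x0 * / T a i x0); [field; exact Q|].
    rewrite A. field. exact Q. }
  assert (NZ : forall (z : C) n, z <> 0 -> Cpow z n <> 0).
  { intros z n Hz. induction n as [|n IH]; simpl; [intro R0; apply RtoC_inj in R0; lra|].
    apply Cmult_neq_0; assumption. }
  assert (Nv : RtoC v <> 0) by (intro R0; apply RtoC_inj in R0; lra).
  assert (One : cpow (exp (v * (x0 - x0))) l = 1).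
  { rewrite Rminus_diag, Rmult_0_r, exp_0. apply cpow_1_l. }
  assert (Hl : l = 0).
  { pose proof (Test (fun _ => 1) (csmooth_const 1)) as A.
    rewrite (cDn_ext_loc i (act l f (fun _ => 1)) (fun y => cpow (exp (v * (y - x0))) l) x0) in A.
    - rewrite cDn_cpow_exp, One in A.
      destruct (excluded_middle_informative (l = 0)) as [|N]; [assumption|exfalso].
      apply (NZ (l * RtoC v) i); [apply Cmult_neq_0; assumption|].
      rewrite <- (Cmult_1_r (Cpow _ _)). apply A.
      destruct i as [|j]; [lia|]. rewrite <- cDn_CD.
      replace (CD (fun _ : R => RtoC 1)) with (fun _ : R => RtoC 0) by (extensionality y; now rewrite CD_const).
      apply cDn_zero.
    - apply filter_imp with (2 := Lf). intros y Hy. unfold act. rewrite Hy. ring. }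
  destruct (Nat.eq_dec i 1) as [->|Hi1].
  { split; [reflexivity|]. split; [assumption|]. rewrite H, Hl. simpl. ring. }
  exfalso.
  assert (Sp : csmooth (fun y => RtoC (1 + v * (y - x0)))).
  { apply (csmooth_RtoC (fun y => 1 + v * (y - x0))%R). smooth. }
  pose proof (Test _ Sp) as A.
  rewrite (cDn_ext_loc i (act l f _) (fun y => cpow (exp (v * (y - x0))) 1) x0) in A.
  - rewrite cDn_cpow_exp, Rminus_diag, Rmult_0_r, exp_0, cpow_1_l in A.
    apply (NZ (1 * RtoC v) i); [rewrite Cmult_1_l; assumption|].
    rewrite <- (Cmult_1_r (Cpow _ _)). apply A.
    destruct i as [|[|j]]; [lia|lia|]. rewrite <- !cDn_CD.
    replace (CD (fun y => RtoC (1 + v * (y - x0)))) with (fun _ : R => RtoC v).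
    + replace (CD (fun _ : R => RtoC v)) with (fun _ : R => RtoC 0) by (extensionality y; now rewrite CD_const).
      apply cDn_zero.
    + extensionality y. rewrite (CD_RtoC (fun y => 1 + v * (y - x0))%R). f_equal.
      symmetry. apply is_derive_unique. auto_derive; [exact I|ring].
  - generalize (filter_and _ _ L Lf). apply filter_imp. intros y [H1 H2].
    unfold act. rewrite Hl, cpow_0_r, H1, cpow_1_r by apply exp_pos.
    rewrite Cmult_1_l. f_equal. field. lra.
Qed.

End CircleShape.

(** * Locality on the circle *)

Lemma near_open M (e x0 y : R) : near M e x0 y -> locally y (fun z => near M e x0 z).
Proof.
  destruct M; simpl.
  - intro H. apply locally_Rabs_ex. exists (e - Rabs (y - x0)). split; [lra|]. intros z Hz.
    pose proof (Rabs_triang_minus z y x0). lra.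
  - intros [n H]. apply locally_Rabs_ex. exists (e - Rabs (y - x0 - IZR n)). split; [lra|].
    intros z Hz. exists n. pose proof (Rabs_triang_minus z y (x0 + IZR n)) as H1.
    unfold Rminus in *. rewrite Ropp_plus_distr, <- !Rplus_assoc in H1. lra.
Qed.

Section CircleDiagonal.
Open Scope C_scope.
Variables (l : C) (k : nat) (T : Op).
Hypothesis HT : in_I MS1 k l l T.

(** The induction hypothesis for orders below j. Only the coefficient of order 0 is followed because
    [T_shape] already excludes the others when l = m. *)
Definition low_order_local (j : nat) : Prop :=
  forall (a : coefs) (x0 E : R), validop MS1 k a -> (forall i x, (j <= i)%nat -> a i x = 0) ->
    (0 < E < 1 / 2)%R -> (forall y, near MS1 E x0 y -> forall i, a i y = 0) -> T a 0%nat x0 = 0.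

Lemma isfun_real (f : R -> R) : smooth f -> (forall x, f (x + 1) = f x)%R ->
  isfun MS1 (fun x => RtoC (f x)).
Proof. intros Hf Hp. split; [now apply csmooth_RtoC|]. intro x. now rewrite Hp. Qed.

Lemma single_scal j c phi : single j (fun x => c * phi x) = coef_scal c (single j phi).
Proof.
  coefs_ext i x. unfold single, coef_scal. destruct (Nat.eqb i j); ring.
Qed.

Lemma single_add j phi psi : single j (fun x => phi x + psi x) = coef_add (single j phi) (single j psi).
Proof.
  coefs_ext i x. unfold single, coef_add. destruct (Nat.eqb i j); ring.
Qed.

(** For l = m multiplication operators are transported like functions. With f = id + u phi and a
    periodic B of slope 1 wherever phi can be nonzero, B o f = B + u phi. As f is the identity near
    x0, T gives B o f and B the same value at x0, so u T(phi) vanishes there. *)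
Lemma order_0_local (phi : R -> R) (x0 E : R) : smooth phi -> (forall x, phi (x + 1) = phi x)%R ->
  (0 < E < 1 / 2)%R -> (forall y, near MS1 E x0 y -> phi y = 0%R) ->
  T (rsingle 0 phi) 0%nat x0 = 0.
Proof.
  intros Hs Hp HE H0.
  destruct (bounded_periodic phi (smooth_continuous phi Hs) Hp) as [K1 [HK1 B1]].
  destruct (bounded_periodic (Derive phi) (smooth_continuous _ (smooth_Derive phi Hs))) as [K2 [HK2 B2]].
  { intro x. rewrite <- Derive_shift. apply Derive_ext, Hp. }
  set (u := (E / (4 * (1 + K1 + K2)))%R).
  assert (Hu : (0 < u)%R) by (unfold u; apply Rdiv_lt_0_compat; lra).
  assert (HuK : (u * (1 + K1 + K2) = E / 4)%R) by (unfold u; field; lra).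
  assert (Sm : smooth (fun y => u * phi y)%R) by smooth.
  assert (Bd : forall y, (Rabs (u * phi y) <= E / 4)%R).
  { intro y. rewrite Rabs_mult, (Rabs_pos_eq u) by lra. specialize (B1 y).
    rewrite <- HuK. apply Rmult_le_compat_l; lra. }
  assert (Hd : isdiff MS1 (fun y => y + u * phi y)%R).
  { apply isdiff_perturbation with (E / 4)%R; [assumption| |assumption|].
    - intro x. now rewrite Hp.
    - intro y. rewrite Derive_scal, Rabs_mult, (Rabs_pos_eq u) by lra. specialize (B2 y).
      assert (u * Rabs (Derive phi y) <= u * (1 + K1 + K2))%R by (apply Rmult_le_compat_l; lra). lra. }
  (* Outside the E-neighbourhood of x0 one is within 1/2 - E of x0 + 1/2 modulo 1. A displacement of
     at most E / 4 stays inside r1, where B is affine; the return of B to its initial value is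
     hidden near x0. *)
  set (r1 := (1 / 2 - E / 2)%R). set (r2 := (1 / 2 - E / 4)%R).
  assert (Hr : (0 < r1 < r2 /\ r2 < 1 / 2)%R) by (unfold r1, r2; lra).
  set (h := fun t => (t * bump r1 r2 t)%R).
  set (B := fun y => Per h (y - x0 - 1 / 2)%R).
  assert (SB : smooth B).
  { assert (smooth (Per h)); [|unfold B; smooth].
    apply Per_smooth with r2; [lra| |unfold h; smooth].
    intros t Ht. unfold h. rewrite bump_0 by (lra || assumption). ring. }
  assert (PB : forall x, (B (x + 1) = B x)%R).
  { intro x. unfold B. replace (x + 1 - x0 - 1 / 2)%R with (x - x0 - 1 / 2 + 1)%R by ring. apply Per_period. }
  assert (VB : validop MS1 k (rsingle 0 B)).
  { apply valid_single; [lia|]. now apply isfun_real. }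
  assert (Vp : validop MS1 k (rsingle 0 phi)).
  { apply valid_single; [lia|]. now apply isfun_real. }
  assert (EB : forall y, B (y + u * phi y)%R = (B y + u * phi y)%R).
  { intro y. destruct (excluded_middle_informative (near MS1 E x0 y)) as [N|N].
    - rewrite (H0 y N), Rmult_0_r, !Rplus_0_r. reflexivity.
    - destruct (Per_cases h (y - x0 - 1 / 2)) as [n [Hn _]].
      assert (Hin : (Rabs (y - x0 - 1 / 2 - IZR n) <= 1 / 2 - E)%R).
      { apply Rnot_lt_le. intro Q. apply N.
        destruct (Rle_lt_dec 0 (y - x0 - 1 / 2 - IZR n)) as [L|L].
        - exists (n + 1)%Z. rewrite plus_IZR. rewrite Rabs_pos_eq in Q by assumption.
          apply Rabs_def1; lra.
        - exists n. rewrite Rabs_left in Q by assumption. apply Rabs_def1; lra. }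
      specialize (Bd y). apply Rabs_le_between in Bd. apply Rabs_le_between in Hin.
      unfold B. rewrite (Per_near h n), (Per_near h n).
      + unfold h. rewrite !bump_1; [ring|lra| |lra|]; apply Rabs_le; unfold r1; lra.
      + apply Rabs_def1; lra.
      + apply Rabs_def1; lra. }
  assert (Epull : pull l l k (fun y => y + u * phi y)%R (rsingle 0 B)
    = coef_add (rsingle 0 B) (coef_scal (RtoC u) (rsingle 0 phi))).
  { coefs_ext i x. rewrite pull_single by lia. rewrite EB.
    unfold coef_add, coef_scal. simpl. unfold single. destruct (Nat.eqb i 0); [|ring].
    pose proof (cpow_inv _ l (isdiff_pos MS1 _ Hd x)) as I.
    rewrite RtoC_plus, RtoC_mult.
    transitivity (cpow (Derive (fun y => y + u * phi y)%R x) l * cpow (/ Derive (fun y => y + u * phi y)%R x) l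
      * (RtoC (B x) + RtoC u * RtoC (phi x))); [ring|]. rewrite I. ring. }
  assert (F := f_equal (fun d => d 0%nat x0) (T_pull HT _ _ Hd VB)).
  simpl in F. rewrite Epull in F.
  rewrite (T_add HT) in F by (try apply valid_scal; assumption).
  rewrite (T_scal HT) in F by assumption.
  rewrite (pull_id_germ MS1) in F.
  - unfold coef_add, coef_scal in F.
    rewrite (H0 x0) in F by (apply near_of_Rabs; rewrite Rminus_diag, Rabs_R0; lra).
    rewrite Rmult_0_r, Rplus_0_r in F.
    assert (Nu : RtoC u <> 0) by (intro Q; apply RtoC_inj in Q; lra).
    set (t := T (rsingle 0 phi) 0%nat x0) in *.
    set (s := T (rsingle 0 B) 0%nat x0) in *.
    transitivity (/ RtoC u * (s + RtoC u * t - s)); [field; assumption|]. rewrite F. ring.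
  - apply locally_Rabs_ex. exists E. split; [lra|]. intros y Hy.
    rewrite (Derive_ext_loc _ (fun t => t)); [apply Derive_id|].
    apply filter_imp with (2 := near_open MS1 E x0 y (near_of_Rabs MS1 E x0 y Hy)).
    intros z Hz. rewrite H0 by assumption. ring.
  - now apply (T_valid HT).
Qed.

(** Take f' = w^(-1/j) / K, so that f^*(d^j) has top coefficient K^j w. Since w = 1 near x0, f is
    affine there and the lower-order remainder vanishes near x0, where the induction hypothesis
    applies. The slope 1/K contributes no factor to the order-0 coefficient because l = m. *)
Lemma density_local (j : nat) (w F : R -> R) (K x0 E : R) : (1 <= j <= k)%nat -> low_order_local j ->
  smooth w -> (forall x, 0 < w x)%R -> (forall x, w (x + 1) = w x)%R ->
  (0 < E < 1 / 2)%R -> (forall y, near MS1 E x0 y -> w y = 1%R) ->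
  (forall x, is_derive F x (exp (- ln (w x) / INR j))) -> (forall x, F (x + 1) = F x + K)%R -> (0 < K)%R ->
  RtoC (K ^ j) * T (rsingle j w) 0%nat x0 = T (dpow j) 0%nat x0.
Proof.
  intros Hj IH Sw W0 Wp HE W1 DF FP HK.
  assert (Hj0 : (INR j <> 0)%R) by (apply not_0_INR; lia).
  set (v := fun x => exp (- ln (w x) / INR j)).
  assert (Sv : smooth v).
  { unfold v. smooth. }
  destruct (density_diffeo v K Sv ltac:(intro; apply exp_pos) F DF FP HK) as [Hd Df].
  set (c := (x0 - F x0 / K)%R).
  set (f := fun x => (F x / K + c)%R).
  assert (Hf : isdiff MS1 f) by exact (isdiff_MS1_comp _ _ (isdiff_MS1_shift c) Hd).
  assert (Fx : f x0 = x0) by (unfold f, c; ring).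
  assert (Dv : forall x, Derive f x = (v x / K)%R).
  { intro x. unfold f. rewrite Derive_plus, Derive_const, Df; [ring| |apply @ex_derive_const].
    apply smooth_ex_derive. exact (isdiff_smooth MS1 _ Hd). }
  assert (vj : forall x, (/ (v x / K) ^ j = K ^ j * w x)%R).
  { intro x. assert (E1 : (v x ^ j = / w x)%R).
    { unfold v. rewrite <- (exp_ln (/ w x)) by now apply Rinv_0_lt_compat.
      rewrite ln_Rinv by apply W0.
      replace (exp (- ln (w x) / INR j) ^ j)%R with (exp (INR j * (- ln (w x) / INR j))).
      - f_equal. field. assumption.
      - symmetry. apply exp_mult_INR. }
    unfold Rdiv. rewrite Rpow_mult_distr, E1, pow_inv.
    field. split; [|specialize (W0 x); lra]. apply pow_nonzero. lra. }
  assert (V1 : validop MS1 k (dpow j)) by (apply valid_single; [lia|apply isfun_const]).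
  assert (Vw : validop MS1 k (rsingle j w)).
  { apply valid_single; [lia|]. now apply isfun_real. }
  pose proof (pull_valid MS1 l l k f _ Hf V1) as Vp.
  set (p := pull l l k f (dpow j)) in *.
  set (lead := coef_scal (RtoC (K ^ j)) (rsingle j w)).
  set (rest := coef_add p (coef_scal (RtoC (-1)) lead)).
  assert (Vl : validop MS1 k lead) by now apply valid_scal.
  assert (Vr : validop MS1 k rest) by (apply valid_add; [|apply valid_scal]; assumption).
  assert (Ediag : forall x, p j x = lead j x).
  { intro x. unfold p. rewrite pull_single by lia. rewrite powD_diag.
    unfold lead, coef_scal, single. rewrite Nat.eqb_refl, <- RtoC_mult, <- vj, <- Dv, pow_inv.
    pose proof (cpow_inv _ l (isdiff_pos MS1 f Hf x)) as I.
    transitivity (RtoC (/ Derive f x ^ j) * (cpow (Derive f x) l * cpow (/ Derive f x) l)); [ring|].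
    rewrite I. ring. }
  assert (Hrest : T rest 0%nat x0 = 0).
  { apply (IH rest x0 E); [assumption| |assumption|].
    - intros i x Hi. unfold rest, coef_add, coef_scal at 1.
      destruct (Nat.eq_dec i j) as [->|N]; [rewrite Ediag; ring|].
      unfold lead, coef_scal, single. apply Nat.eqb_neq in N. rewrite N.
      unfold p. rewrite (pull_order l l k f _ j); [ring| |apply Nat.eqb_neq in N; lia].
      intros i' y Hi'. unfold single. destruct (Nat.eqb_spec i' j); [lia|reflexivity].
    - intros y Hy i. unfold rest, coef_add, coef_scal at 1.
      destruct (Nat.eq_dec i j) as [->|N]; [rewrite Ediag; ring|].
      unfold lead, coef_scal, single. apply Nat.eqb_neq in N. rewrite N.
      unfold p. rewrite pull_single by lia. rewrite (powD_affine l f j i y (1 / K)).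
      + rewrite N. ring.
      + apply filter_imp with (2 := near_open MS1 E x0 y Hy). intros z Hz.
        rewrite Dv. unfold v. rewrite (W1 z Hz), ln_1.
        replace (- 0 / INR j)%R with 0%R by (field; assumption). now rewrite exp_0. }
  assert (Ep : p = coef_add lead rest).
  { coefs_ext i x. unfold rest, coef_add, coef_scal at 1. ring. }
  assert (F0 := f_equal (fun d => d 0%nat x0) (T_pull HT f _ Hf V1)).
  simpl in F0. change (pull l l k f (dpow j)) with p in F0.
  rewrite Ep, (T_add HT) in F0 by assumption.
  unfold coef_add in F0. rewrite Hrest in F0. unfold lead in F0.
  rewrite (T_scal HT) in F0 by assumption. unfold coef_scal at 1 in F0.
  rewrite Cplus_0_r in F0. rewrite F0.
  assert (HK1 : (0 < 1 / K)%R) by (apply Rdiv_lt_0_compat; lra).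
  rewrite (pull_affine l l k f _ 0 x0 (1 / K)).
  - rewrite Fx. simpl. pose proof (cpow_inv (1 / K) l HK1) as I.
    transitivity (cpow (1 / K) l * cpow (/ (1 / K)) l * T (dpow j) 0%nat x0); [ring|].
    rewrite I. ring.
  - lia.
  - apply locally_Rabs_ex. exists E. split; [lra|]. intros y Hy.
    rewrite Dv. unfold v. rewrite (W1 y (near_of_Rabs MS1 E x0 y Hy)), ln_1.
    replace (- 0 / INR j)%R with 0%R by (field; assumption). now rewrite exp_0.
Qed.

Lemma density_primitive (j : nat) (w : R -> R) : smooth w -> (forall x, 0 < w x)%R ->
  (forall x, w (x + 1) = w x)%R ->
  exists (F : R -> R) (K : R), (forall x : R, is_derive F x (exp (- ln (w x) / INR j))) /\
    (forall x, F (x + 1) = F x + K)%R /\ (0 < K)%R.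
Proof.
  intros Sw W0 Wp.
  assert (Sv : smooth (fun x => exp (- ln (w x) / INR j))).
  { smooth. }
  destruct (smooth_primitive _ Sv) as [F [SF DF]].
  exists F, (F 1 - F 0)%R. split; [assumption|]. split.
  - apply (primitive_period _ F DF). intro x. now rewrite Wp.
  - assert (F 0 < F 1)%R; [|lra]. apply derive_pos_lt; [assumption| |lra].
    intro t. rewrite (is_derive_unique _ _ _ (DF t)). apply exp_pos.
Qed.

(* phi with phi(x + 1/2) = - phi(x): the densities (1 + phi)^(-1/j) and (1 - phi)^(-1/j) have the
   same mass K, and K > 1 by convexity, whence S(1 + phi) + S(1 - phi) = 2 S(1) / K^j. *)
Lemma constant_vanishes (j : nat) (x0 : R) : (1 <= j <= k)%nat -> low_order_local j ->
  T (dpow j) 0%nat x0 = 0.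
Proof.
  intros Hj IH.
  assert (Hj0 : (0 < INR j)%R) by (apply lt_0_INR; lia).
  set (h := bump (1 / 16) (1 / 8)).
  (* Two opposite bumps half a period apart, both away from x0; the factor 1/2 keeps 1 + phi and 1 -
     phi positive. *)
  set (phi := fun y => ((Per h (y - x0 - 1 / 4) - Per h (y - x0 + 1 / 4)) / 2)%R).
  assert (Hh : forall t, (1 / 8 <= Rabs t)%R -> h t = 0%R) by (intros t Ht; apply bump_0; lra).
  assert (SP : smooth (Per h)).
  { apply Per_smooth with (1 / 8)%R; [lra|assumption|apply bump_smooth]. }
  assert (Sphi : smooth phi) by (unfold phi; smooth).
  assert (Anti : forall y, phi (y + 1 / 2)%R = (- phi y)%R).
  { intro y. unfold phi.
    replace (y + 1 / 2 - x0 - 1 / 4)%R with (y - x0 + 1 / 4)%R by field.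
    replace (y + 1 / 2 - x0 + 1 / 4)%R with (y - x0 - 1 / 4 + 1)%R by field.
    rewrite Per_period. field. }
  assert (Pphi : forall y, phi (y + 1)%R = phi y).
  { intro y. replace (y + 1)%R with (y + 1 / 2 + 1 / 2)%R by field. rewrite !Anti. ring. }
  assert (Bphi : forall y, (- (1 / 2) <= phi y <= 1 / 2)%R).
  { intro y. unfold phi.
    destruct (Per_cases h (y - x0 - 1 / 4)) as [n1 [_ E1]].
    destruct (Per_cases h (y - x0 + 1 / 4)) as [n2 [_ E2]]. rewrite E1, E2.
    pose proof (bump_bound (1 / 16) (1 / 8) (y - x0 - 1 / 4 - IZR n1)).
    pose proof (bump_bound (1 / 16) (1 / 8) (y - x0 + 1 / 4 - IZR n2)). unfold h. lra. }
  assert (Zphi : forall y, near MS1 (1 / 8) x0 y -> phi y = 0%R).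
  { intros y [n Hn]. apply Rabs_def2 in Hn. unfold phi.
    rewrite (Per_near h n), (Per_near h n).
    - rewrite !Hh; [field| |]; unfold Rabs; destruct Rcase_abs; lra.
    - apply Rabs_def1; lra.
    - apply Rabs_def1; lra. }
  set (x1 := (x0 + 1 / 4)%R).
  assert (Hx1 : phi x1 = (1 / 2)%R).
  { unfold phi, x1.
    replace (x0 + 1 / 4 - x0 - 1 / 4)%R with 0%R by field.
    replace (x0 + 1 / 4 - x0 + 1 / 4)%R with (1 / 2)%R by field.
    rewrite (Per_near h 0) by (rewrite Rminus_diag, Rabs_R0; lra).
    destruct (Per_cases h (1 / 2)) as [n [Hn E]]. rewrite E.
    assert (n = 1)%Z.
    { destruct Hn as [Hn1 Hn2]. assert (IZR n <= 1)%R by lra. assert (0 < IZR n)%R by lra.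
      apply le_IZR in H. apply lt_IZR in H0. lia. }
    subst n. rewrite (Hh (1 / 2 - 1)%R) by (rewrite Rabs_left; lra).
    unfold h. rewrite bump_1; [field|lra|]. rewrite Rminus_diag, Rabs_R0. lra. }
  set (wp := fun y => (1 + phi y)%R). set (wm := fun y => (1 - phi y)%R).
  assert (Swp : smooth wp) by (unfold wp; smooth).
  assert (Swm : smooth wm) by (unfold wm; smooth).
  assert (Wp0 : forall y, (0 < wp y)%R) by (intro y; specialize (Bphi y); unfold wp; lra).
  assert (Wm0 : forall y, (0 < wm y)%R) by (intro y; specialize (Bphi y); unfold wm; lra).
  destruct (density_primitive j wp Swp Wp0 ltac:(intro; unfold wp; now rewrite Pphi)) as [F [K [DF [FP HK]]]].
  set (Fm := fun y => F (y + 1 / 2)%R).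
  assert (DFm : forall x, is_derive Fm x (exp (- ln (wm x) / INR j))).
  { intro x. unfold Fm. replace (wm x) with (wp (x + 1 / 2)%R) by (unfold wp, wm; rewrite Anti; ring).
    replace (exp (- ln (wp (x + 1 / 2)%R) / INR j)) with (1 * exp (- ln (wp (x + 1 / 2)%R) / INR j))%R by ring.
    apply (is_derive_comp F (fun y => y + 1 / 2)%R); [apply DF|]. auto_derive; [exact I|ring]. }
  assert (FmP : forall x, (Fm (x + 1) = Fm x + K)%R).
  { intro x. unfold Fm. replace (x + 1 + 1 / 2)%R with (x + 1 / 2 + 1)%R by ring. apply FP. }
  (* The derivative g compares the sum of the two densities with 2. From exp(s) >= 1 + s one gets g
     >= -ln(1 - phi^2) / j, which is nonnegative and positive at x1. *)
  set (G := fun y => (F y + Fm y - 2 * y)%R).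
  set (g := fun y => (exp (- ln (wp y) / INR j) + exp (- ln (wm y) / INR j) - 2)%R).
  assert (DG : forall x, is_derive G x (g x)).
  { intro x. unfold G, g.
    pose proof (is_derive_plus F Fm x _ _ (DF x) (DFm x)) as D1.
    assert (D2 : is_derive (fun y => 2 * y)%R x 2%R) by (auto_derive; [exact I|ring]).
    exact (is_derive_minus _ _ x _ _ D1 D2). }
  assert (g_ge : forall x, (- ln (1 - phi x ^ 2) / INR j <= g x)%R).
  { intro x. unfold g. pose proof (exp_ineq1_le (- ln (wp x) / INR j)).
    pose proof (exp_ineq1_le (- ln (wm x) / INR j)).
    replace (1 - phi x ^ 2)%R with (wp x * wm x)%R by (unfold wp, wm; ring).
    rewrite ln_mult by auto. unfold Rdiv in *. nra. }
  assert (g0 : forall x, (0 <= g x)%R).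
  { intro x. eapply Rle_trans; [|apply g_ge]. specialize (Bphi x).
    assert (ln (1 - phi x ^ 2) <= 0)%R.
    { rewrite <- ln_1. destruct (Req_dec (phi x) 0) as [Q|Q].
      - rewrite Q. right. f_equal. ring.
      - left. apply ln_increasing; nra. }
    apply Rmult_le_pos; [lra|]. left. now apply Rinv_0_lt_compat. }
  assert (g1 : (0 < g x1)%R).
  { eapply Rlt_le_trans; [|apply g_ge]. rewrite Hx1.
    apply Rdiv_lt_0_compat; [|assumption].
    assert (ln (1 - (1 / 2) ^ 2) < 0)%R; [|lra]. rewrite <- ln_1. apply ln_increasing; lra. }
  assert (Gmono : forall x y, (x <= y)%R -> (G x <= G y)%R).
  { intros x y Hxy. destruct (MVT_gen G x y g) as [c [_ Hc]].
    - intros t _. apply DG.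
    - intros t _. apply continuity_pt_filterlim, @ex_derive_continuous. exists (g t). apply DG.
    - specialize (g0 c). nra. }
  (* G changes by 2K - 2 over a period. If K <= 1, the nondecreasing G would be constant around x1,
     against g(x1) > 0. *)
  assert (HK1 : (1 < K)%R).
  { apply Rnot_le_lt. intro Q.
    assert (Gp : forall y, (Rabs (y - x1) < 1 / 2)%R -> G y = G (x1 - 1 / 2)%R).
    { intros y Hy. apply Rabs_def2 in Hy. apply Rle_antisym; [|apply Gmono; lra].
      apply Rle_trans with (G (x1 - 1 / 2 + 1)%R); [apply Gmono; lra|].
      unfold G. rewrite FP, FmP. lra. }
    assert (D0 : Derive G x1 = 0%R).
    { rewrite (Derive_ext_loc G (fun _ => G (x1 - 1 / 2)%R)); [apply Derive_const|].
      apply locally_Rabs_ex. exists (1 / 2)%R. split; [lra|]. exact Gp. }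
    rewrite (is_derive_unique _ _ _ (DG x1)) in D0. lra. }
  pose proof (density_local j wp F K x0 (1 / 8) Hj IH Swp Wp0 ltac:(intro; unfold wp; now rewrite Pphi)
    ltac:(lra) ltac:(intros y Hy; unfold wp; rewrite Zphi by assumption; ring) DF FP HK) as E1.
  pose proof (density_local j wm Fm K x0 (1 / 8) Hj IH Swm Wm0 ltac:(intro; unfold wm; now rewrite Pphi)
    ltac:(lra) ltac:(intros y Hy; unfold wm; rewrite Zphi by assumption; ring) DFm FmP HK) as E2.
  assert (Vr : forall w : R -> R, smooth w -> (forall y, w (y + 1) = w y)%R ->
    validop MS1 k (rsingle j w)).
  { intros w Sw Pw. apply valid_single; [lia|]. now apply isfun_real. }
  assert (E3 : coef_add (rsingle j wp) (rsingle j wm)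
    = coef_scal (RtoC 2) (dpow j)).
  { coefs_ext i x. unfold coef_add, coef_scal, single, wp, wm.
    destruct (Nat.eqb i j); [|ring]. rewrite RtoC_plus, RtoC_minus. ring. }
  assert (E4 := f_equal (fun d => T d 0%nat x0) E3). simpl in E4.
  rewrite (T_add HT), (T_scal HT) in E4.
  2: { apply valid_single; [lia|apply isfun_const]. }
  2: { apply Vr; [assumption|]. intro; unfold wp; now rewrite Pphi. }
  2: { apply Vr; [assumption|]. intro; unfold wm; now rewrite Pphi. }
  unfold coef_add, coef_scal in E4.
  set (t := T (dpow j) 0%nat x0) in *.
  assert (HKj : (1 < K ^ j)%R) by (apply Rlt_pow_R1; [assumption|lia]).
  assert (E5 : RtoC (K ^ j) * (RtoC 2 * t) = RtoC 2 * t).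
  { transitivity (t + t); [rewrite <- E4, Cmult_plus_distr_l, E1, E2; reflexivity|ring]. }
  assert (N : RtoC (2 * (K ^ j - 1)) <> 0) by (intro Q; apply RtoC_inj in Q; lra).
  transitivity (/ RtoC (2 * (K ^ j - 1)) * (RtoC (2 * (K ^ j - 1)) * t)); [field; assumption|].
  replace (RtoC (2 * (K ^ j - 1)) * t) with (RtoC (K ^ j) * (RtoC 2 * t) - RtoC 2 * t).
  - rewrite E5. ring.
  - rewrite RtoC_mult, RtoC_minus. ring.
Qed.

(** For small u the function 1 + u phi is an admissible density. As T(d^j) has no order-0
    coefficient at x0, [density_local] leaves K^j u times the wanted coefficient equal to 0. *)
Lemma order_pos_local (j : nat) (phi : R -> R) (x0 E : R) : (1 <= j <= k)%nat -> low_order_local j ->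
  smooth phi -> (forall x, phi (x + 1) = phi x)%R ->
  (0 < E < 1 / 2)%R -> (forall y, near MS1 E x0 y -> phi y = 0%R) ->
  T (rsingle j phi) 0%nat x0 = 0.
Proof.
  intros Hj IH Sp Pp HE Z.
  destruct (bounded_periodic phi (smooth_continuous phi Sp) Pp) as [B [HB Bd]].
  set (u := (/ (B + 1))%R).
  assert (Hu : (0 < u)%R) by (apply Rinv_0_lt_compat; lra).
  set (w := fun y => (1 + u * phi y)%R).
  assert (Sw : smooth w) by (unfold w; smooth).
  assert (Pw : forall y, (w (y + 1) = w y)%R) by (intro y; unfold w; now rewrite Pp).
  assert (W0 : forall y, (0 < w y)%R).
  { intro y. unfold w. specialize (Bd y). apply Rabs_le_between in Bd.
    assert (u * (B + 1) = 1)%R by (unfold u; field; lra). nra. }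
  destruct (density_primitive j w Sw W0 Pw) as [F [K [DF [FP HK]]]].
  pose proof (density_local j w F K x0 E Hj IH Sw W0 Pw HE
    ltac:(intros y Hy; unfold w; rewrite Z by assumption; ring) DF FP HK) as E1.
  rewrite (constant_vanishes j x0 Hj IH) in E1.
  assert (V1 : validop MS1 k (dpow j)) by (apply valid_single; [lia|apply isfun_const]).
  assert (Vp : validop MS1 k (rsingle j phi)).
  { apply valid_single; [lia|]. now apply isfun_real. }
  assert (E2 : single j (fun x => RtoC (w x))
    = coef_add (dpow j) (coef_scal (RtoC u) (rsingle j phi))).
  { coefs_ext i x. unfold coef_add, coef_scal, single, w.
    destruct (Nat.eqb i j); [|ring]. rewrite RtoC_plus, RtoC_mult. ring. }
  rewrite E2, (T_add HT), (T_scal HT) in E1 by (try apply valid_scal; assumption).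
  unfold coef_add, coef_scal in E1. rewrite (constant_vanishes j x0 Hj IH) in E1.
  assert (Nu : RtoC (K ^ j * u) <> 0).
  { intro Q. apply RtoC_inj in Q. pose proof (pow_lt K j HK). nra. }
  set (t := T (rsingle j phi) 0%nat x0) in *.
  transitivity (/ RtoC (K ^ j * u) * (RtoC (K ^ j * u) * t)); [field; assumption|].
  rewrite RtoC_mult.
  replace (RtoC (K ^ j) * RtoC u * t) with (RtoC (K ^ j) * (0 + RtoC u * t)) by ring.
  rewrite E1. ring.
Qed.

Lemma all_orders_local (j : nat) : low_order_local j.
Proof.
  induction j as [|j IH]; intros a x0 E Ha Hord HE Z.
  - assert (E0 : a = coef_scal 0 a).
    { coefs_ext i x. unfold coef_scal. rewrite Hord by lia. ring. }
    rewrite E0, (T_scal HT) by assumption. unfold coef_scal. ring.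
  - destruct (le_lt_dec j k) as [Hj|Hj].
    2: { apply (IH a x0 E); try assumption. intros i x Hi. apply (proj2 Ha). lia. }
    pose proof (proj1 Ha j Hj) as [[S1 S2] P].
    (* Densities and displacements are real, so the real and imaginary parts of the top coefficient
       are treated separately. *)
    set (p1 := fun x => Re (a j x)). set (p2 := fun x => Im (a j x)).
    assert (P1 : forall x, (p1 (x + 1) = p1 x)%R) by (intro x; unfold p1; now rewrite P).
    assert (P2 : forall x, (p2 (x + 1) = p2 x)%R) by (intro x; unfold p2; now rewrite P).
    assert (Z1 : forall y, near MS1 E x0 y -> p1 y = 0%R) by (intros y Hy; unfold p1; now rewrite Z).
    assert (Z2 : forall y, near MS1 E x0 y -> p2 y = 0%R) by (intros y Hy; unfold p2; now rewrite Z).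
    assert (T1 : forall p : R -> R, smooth p -> (forall x, (p (x + 1) = p x)%R) ->
      (forall y, near MS1 E x0 y -> p y = 0%R) -> T (rsingle j p) 0%nat x0 = 0).
    { intros p Hp1 Hp2 Hp3. destruct j as [|j].
      - now apply order_0_local with E.
      - apply order_pos_local with E; try assumption. lia. }
    set (s1 := single j (fun x => RtoC (p1 x))). set (s2 := single j (fun x => RtoC (p2 x))).
    set (rest := (fun i x => if Nat.eqb i j then RtoC 0 else a i x) : coefs).
    assert (V1 : validop MS1 k s1) by (apply valid_single; [assumption|now apply isfun_real]).
    assert (V2 : validop MS1 k s2) by (apply valid_single; [assumption|now apply isfun_real]).
    assert (Vr : validop MS1 k rest).
    { split.
      - intros i Hi. unfold rest. destruct (Nat.eqb i j); [apply isfun_const|now apply (proj1 Ha)].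
      - intros i x Hi. unfold rest. destruct (Nat.eqb i j); [reflexivity|now apply (proj2 Ha)]. }
    assert (Ea : a = coef_add (coef_add s1 (coef_scal Ci s2)) rest).
    { coefs_ext i x. unfold coef_add, coef_scal, s1, s2, single, rest.
      destruct (Nat.eqb_spec i j) as [->|N]; [|ring].
      apply C_eq; unfold p1, p2; simpl; ring. }
    rewrite Ea, !(T_add HT), (T_scal HT)
      by (repeat first [assumption|apply valid_add|apply valid_scal]).
    unfold coef_add, coef_scal. unfold s1, s2. rewrite !T1 by assumption.
    rewrite (IH rest x0 E Vr); [ring| |assumption|].
    + intros i x Hi. unfold rest. destruct (Nat.eqb_spec i j); [reflexivity|]. apply Hord. lia.
    + intros y Hy i. unfold rest. destruct (Nat.eqb i j); [reflexivity|now apply Z].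
Qed.

End CircleDiagonal.

Lemma near_of_locally_periodic k (a : coefs) (x0 : R) : validop MS1 k a ->
  locally x0 (fun y => forall i, a i y = RtoC 0) ->
  exists E, 0 < E < 1 / 2 /\ forall y, near MS1 E x0 y -> forall i, a i y = RtoC 0.
Proof.
  intros Ha L. apply locally_Rabs_ex in L. destruct L as [e [He L]].
  exists (Rmin e (1 / 4)). pose proof (Rmin_l e (1 / 4)). pose proof (Rmin_r e (1 / 4)).
  split; [split; [apply Rmin_pos; lra|lra]|]. intros y [n Hn] i.
  destruct (le_lt_dec i k) as [Hi|Hi]; [|now apply (proj2 Ha)].
  destruct (proj1 Ha i Hi) as [_ P].
  assert (E : a i (y - IZR n) = RtoC 0).
  { apply L. replace (y - IZR n - x0) with (y - x0 - IZR n) by ring. lra. }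
  rewrite <- E. replace y with (y - IZR n + IZR n) at 1 by ring.
  apply C_eq.
  - rewrite (period_Z (fun x => Re (a i x)) 0); [ring|]. intro x. rewrite P. ring.
  - rewrite (period_Z (fun x => Im (a i x)) 0); [ring|]. intro x. rewrite P. ring.
Qed.

Lemma T_local_MS1 (l m : C) (k : nat) (T : Op) : (l, m) <> (RtoC 0, RtoC 1) ->
  in_I MS1 k l m T -> local_op MS1 k T.
Proof.
  intros Hlm HT a x0 Ha L i.
  destruct (near_of_locally_periodic k a x0 Ha L) as [E [HE Z]].
  destruct (le_lt_dec i k) as [Hi|Hi].
  2: { now apply (proj2 (T_valid HT a Ha)). }
  destruct (T_shape MS1 l m k T HT x0 E a HE Ha Z i Hi) as [H|[[-> ->]|[_ [-> ->]]]]; [assumption| |].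
  - apply (all_orders_local l k T HT (S k) a x0 E); try assumption.
    intros j x Hj. apply (proj2 Ha). lia.
  - now destruct Hlm.
Qed.

(** * The line and the circle *)

Lemma local_op_eq M l m k T a b x : in_I M k l m T -> local_op M k T ->
  validop M k a -> validop M k b -> locally x (fun y => forall i, a i y = b i y) ->
  forall i, T a i x = T b i x.
Proof.
  intros HT HL Ha Hb L i.
  assert (Vd : validop M k (coef_add a (coef_scal (RtoC (-1)) b))).
  { apply valid_add; [assumption|now apply valid_scal]. }
  assert (L' : locally x (fun y => forall i, coef_add a (coef_scal (RtoC (-1)) b) i y = RtoC 0)).
  { apply filter_imp with (2 := L). intros y Hy j. unfold coef_add, coef_scal. rewrite Hy. ring. }
  pose proof (HL _ x Vd L' i) as Z.
  rewrite (T_add HT a _ Ha (valid_scal M k _ b Hb)), (T_scal HT _ b Hb) in Z.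
  unfold coef_add, coef_scal in Z.
  transitivity (T b i x + (T a i x + RtoC (-1) * T b i x))%C; [ring|]. rewrite Z. ring.
Qed.

Lemma valid_MS1_MR k a : validop MS1 k a -> validop MR k a.
Proof. intros [H1 H2]. split; [|assumption]. intros i Hi. now apply (isfun_csmooth MS1), H1. Qed.

(** Periodic operators are those fixed by the translation by 1, a diffeomorphism of the line, so T
    preserves periodicity. *)
Lemma in_I_MR_MS1 l m k T : in_I MR k l m T -> in_I MS1 k l m T.
Proof.
  intro HT. pose proof (proj1 (in_I_iff MR l m k T) HT) as [H1 [H2 [H3 H4]]].
  apply in_I_iff. split; [|split; [|split]].
  - intros a Ha. pose proof (valid_MS1_MR k a Ha) as Ha'. pose proof (H1 a Ha') as Hv.
    split; [|apply Hv]. intros i Hi. split; [now apply (proj1 Hv)|]. intro x.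
    destruct (isdiff_MR_affine 1 1 ltac:(lra)) as [Hd Dd].
    assert (P : forall b, validop MR k b -> forall j y, pull l m k (fun y => 1 * y + 1) b j y = b j (y + 1)).
    { intros b Hb j y. rewrite (pull_id_germ MR); [|apply filter_forall; exact Dd|assumption].
      f_equal. ring. }
    rewrite <- P, <- (H4 _ a Hd Ha') by assumption. f_equal. f_equal.
    coefs_ext j y. rewrite P by assumption.
    destruct (le_lt_dec j k) as [L|L]; [now apply (proj1 Ha j L)|].
    now rewrite !(proj2 Ha) by assumption.
  - intros a b Ha Hb. apply H2; now apply valid_MS1_MR.
  - intros c a Ha. apply H3; now apply valid_MS1_MR.
  - intros f b Hf Hb. apply H4; [now apply isdiff_MS1_MR|now apply valid_MS1_MR].
Qed.

Definition localize (x : R) (a : coefs) : coefs := fun i y => a i (loc x y).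

Lemma localize_valid k x a : validop MR k a -> validop MS1 k (localize x a).
Proof.
  intros [H1 H2]. split.
  - intros i Hi. apply (isfun_loc MS1 (a i)). now apply H1.
  - intros i y Hi. now apply H2.
Qed.

Lemma localize_near x a : locally x (fun y => forall i, localize x a i y = a i y).
Proof. apply filter_imp with (2 := loc_near x). intros y Hy i. unfold localize. now rewrite Hy. Qed.

Lemma localize_eq x a y : Rabs (y - x) <= 1 / 8 -> forall i, localize x a i y = a i y.
Proof. intros Hy i. unfold localize. now rewrite loc_eq. Qed.

Section CircleToLine.
Open Scope C_scope.
Variables (l m : C) (k : nat) (T : Op).
Hypothesis HT : in_I MS1 k l m T.
Hypothesis HL : local_op MS1 k T.

(** The germ of a at x is extended to a periodic operator before T is applied. By locality the
    extension does not matter, as [line_op_spec] records. *)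
Definition line_op : Op := fun a i x => T (localize x a) i x.

Lemma line_op_spec a b x : validop MR k a -> validop MS1 k b ->
  locally x (fun y => forall i, a i y = b i y) -> forall i, line_op a i x = T b i x.
Proof.
  intros Ha Hb L. unfold line_op.
  apply (local_op_eq MS1 l m k T); try assumption; [now apply localize_valid|].
  generalize (filter_and _ _ L (localize_near x a)). apply filter_imp.
  intros y [H1 H2] i. now rewrite H2, H1.
Qed.

Lemma line_op_near a x : validop MR k a ->
  locally x (fun y => forall i, line_op a i y = T (localize x a) i y).
Proof.
  intro Ha. apply locally_Rabs_ex. exists (1 / 8)%R. split; [lra|]. intros y Hy.
  apply line_op_spec; [assumption|now apply localize_valid|].
  apply locally_Rabs_ex. exists (1 / 8 - Rabs (y - x))%R. split; [lra|]. intros z Hz i.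
  symmetry. apply localize_eq. pose proof (Rabs_triang_minus z y x). lra.
Qed.

Lemma line_op_in_I : in_I MR k l m line_op.
Proof.
  assert (V : forall a, validop MR k a -> validop MR k (line_op a)).
  { intros a Ha. split.
    - intros i Hi. apply (csmooth_local (line_op a i)). intro x. exists (T (localize x a) i). split.
      + apply (valid_csmooth MS1 k). apply (T_valid HT). now apply localize_valid.
      + apply filter_imp with (2 := line_op_near a x Ha). intros y Hy. apply Hy.
    - intros i x Hi. unfold line_op.
      apply (proj2 (T_valid HT _ (localize_valid k x a Ha))). assumption. }
  apply in_I_iff. split; [assumption|]. split; [|split].
  - intros a b Ha Hb. coefs_ext i x. unfold line_op, coef_add.
    change (localize x (fun i x => a i x + b i x)) with (coef_add (localize x a) (localize x b)).
    now rewrite (T_add HT) by now apply localize_valid.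
  - intros c a Ha. coefs_ext i x. unfold line_op, coef_scal.
    change (localize x (fun i x => c * a i x)) with (coef_scal c (localize x a)).
    now rewrite (T_scal HT) by now apply localize_valid.
  - intros f b Hf Hb. coefs_ext i x.
    pose proof (isdiff_smooth MR f Hf) as Sf.
    (* Near x the diffeomorphism of the line is replaced by one of the circle with the same germ,
       for which T is equivariant. *)
    destruct (germ_diffeo f x Sf (isdiff_pos MR f Hf)) as [g [Hg Lg]].
    assert (Lg' : locally x (fun y => f y = g y)) by (apply filter_imp with (2 := Lg); auto).
    pose proof (localize_valid k (f x) b Hb) as Vb.
    rewrite (line_op_spec _ (pull l m k g (localize (f x) b)) x).
    + rewrite (T_pull HT) by assumption. symmetry.
      apply pull_ext_loc; [assumption|]. intros j Hj.
      rewrite <- (locally_singleton _ _ Lg'). reflexivity.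
    + now apply pull_valid.
    + now apply pull_valid.
    + apply locally_locally in Lg'.
      pose proof (locally_continuous f x (fun z => forall i, localize (f x) b i z = b i z)
        (smooth_continuous f Sf x) (localize_near (f x) b)) as Lb.
      generalize (filter_and _ _ Lg' Lb). apply filter_imp. intros y [H1 H2] j.
      apply pull_ext_loc; [assumption|]. intros j' _.
      rewrite <- (locally_singleton _ _ H1). symmetry. apply H2.
Qed.

End CircleToLine.

Lemma line_circle_iso (k : nat) (l m : C) : (l, m) <> (RtoC 0, RtoC 1) ->
  alg_iso (IAlg MR k l m) (IAlg MS1 k l m).
Proof.
  intro Hlm. exists (fun T => T). simpl. split; [|split; [|split; [|split; [|split; [|split]]]]].
  - intros T HT. now apply in_I_MR_MS1.
  - intros T U HT HU. split.
    + intros H a Ha. apply H. now apply valid_MS1_MR.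
    (* Injectivity: locality on the line reduces an arbitrary operator to its periodic localization
       at x, where T and U agree. *)
    + intros H a Ha i x. pose proof (localize_valid k x a Ha) as V.
      assert (L : locally x (fun y => forall i, a i y = localize x a i y)).
      { apply filter_imp with (2 := localize_near x a). intros y Hy j. now rewrite Hy. }
      rewrite (local_op_eq MR l m k T a (localize x a) x HT (T_local_MR l m k T HT) Ha
        (valid_MS1_MR _ _ V) L).
      rewrite (local_op_eq MR l m k U a (localize x a) x HU (T_local_MR l m k U HU) Ha
        (valid_MS1_MR _ _ V) L).
      now apply H.
  - intros T HT. pose proof (T_local_MS1 l m k T Hlm HT) as HL.
    exists (line_op T). split; [now apply line_op_in_I|].
    intros a Ha i x. apply (line_op_spec l m k T HT HL); [now apply valid_MS1_MR|assumption|].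
    apply filter_forall. reflexivity.
  - intros T U _ _ a _ i x. reflexivity.
  - intros T U _ _ a _ i x. reflexivity.
  - intros c T _ a _ i x. reflexivity.
  - intros a _ i x. reflexivity.
Qed.

(** * Invariants of operators from functions to 1-forms *)

Section InvariantsClosure.
Open Scope C_scope.
Variables (M : manifold) (l m : C) (k : nat).

Lemma in_I_id : in_I M k l m (fun a => a).
Proof. apply in_I_iff. repeat split; auto; apply H. Qed.

Lemma in_I_add T U : in_I M k l m T -> in_I M k l m U -> in_I M k l m (fun a => coef_add (T a) (U a)).
Proof.
  intros HT HU. apply in_I_iff.
  apply in_I_iff in HT as [T1 [T2 [T3 T4]]]. apply in_I_iff in HU as [U1 [U2 [U3 U4]]].
  split; [|split; [|split]].
  - intros a Ha. apply valid_add; auto.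
  - intros a b Ha Hb. rewrite T2, U2 by assumption.
    coefs_ext i x. unfold coef_add. ring.
  - intros c a Ha. rewrite T3, U3 by assumption.
    coefs_ext i x. unfold coef_add, coef_scal. ring.
  - intros f b Hf Hb. rewrite T4, U4 by assumption. now rewrite pull_add.
Qed.

Lemma in_I_scal c T : in_I M k l m T -> in_I M k l m (fun a => coef_scal c (T a)).
Proof.
  intros HT. apply in_I_iff. apply in_I_iff in HT as [T1 [T2 [T3 T4]]].
  split; [|split; [|split]].
  - intros a Ha. apply valid_scal; auto.
  - intros a b Ha Hb. rewrite T2 by assumption.
    coefs_ext i x. unfold coef_add, coef_scal. ring.
  - intros c' a Ha. rewrite T3 by assumption.
    coefs_ext i x. unfold coef_scal. ring.
  - intros f b Hf Hb. rewrite T4 by assumption. now rewrite pull_scal.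
Qed.

Lemma in_I_comp T U : in_I M k l m T -> in_I M k l m U -> in_I M k l m (fun a => T (U a)).
Proof.
  intros HT HU. apply in_I_iff.
  apply in_I_iff in HT as [T1 [T2 [T3 T4]]]. apply in_I_iff in HU as [U1 [U2 [U3 U4]]].
  split; [|split; [|split]].
  - auto.
  - intros a b Ha Hb. rewrite U2, T2 by auto. reflexivity.
  - intros c a Ha. rewrite U3, T3 by auto. reflexivity.
  - intros f b Hf Hb. rewrite U4, T4 by auto. reflexivity.
Qed.

End InvariantsClosure.

(** * The formal adjoint and the flux *)

Section Adjoint.
Open Scope C_scope.
Implicit Types phi psi u : R -> C.

Definition sgn (j : nat) : C := RtoC ((-1) ^ j).

Lemma sgn_S j : sgn (S j) = - sgn j.
Proof. unfold sgn. simpl. rewrite RtoC_mult. ring. Qed.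

(* coefficients of phi |-> (u phi)^(j) *)
Fixpoint leibniz (j : nat) u : coefs :=
  match j with O => single 0 u | S j => Dl (leibniz j u) end.

Definition star (k : nat) (a : coefs) : coefs :=
  fun i x => csum k (fun j => sgn j * leibniz j (a j) i x).

Definition star_apply (k : nat) (a : coefs) phi : R -> C :=
  fun x => csum k (fun j => sgn j * cDn j (fun y => a j y * phi y) x).

(* [flux K a 1] = sum_(1 <= j <= K + 1) (-1)^(j-1) a_j^(j-1) *)
Definition flux (K : nat) (a : coefs) phi : R -> C :=
  fun x => csum K (fun j => sgn j * cDn j (fun y => a (S j) y * phi y) x).

Lemma leibniz_smooth j u i : csmooth u -> csmooth (leibniz j u i).
Proof.
  intro Hu. revert i. induction j as [|j IH]; intro i.
  - simpl. unfold single. destruct (Nat.eqb i 0); [assumption|apply csmooth_const].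
  - simpl. unfold Dl. apply csmooth_plus; [now apply csmooth_CD|].
    destruct i; [apply csmooth_const|apply IH].
Qed.

Lemma leibniz_order j u i x : (j < i)%nat -> leibniz j u i x = 0.
Proof.
  revert i x. induction j as [|j IH]; intros i x Hi.
  - simpl. unfold single. destruct i; [lia|reflexivity].
  - simpl. unfold Dl. destruct i; [lia|]. rewrite (IH i) by lia.
    replace (leibniz j u (S i)) with (fun _ : R => RtoC 0); [rewrite CD_const; ring|].
    extensionality y. symmetry. apply IH. lia.
Qed.

Lemma leibniz_diag j u x : leibniz j u j x = u x.
Proof.
  revert x. induction j as [|j IH]; intro x; [reflexivity|].
  simpl. unfold Dl. rewrite IH.
  replace (leibniz j u (S j)) with (fun _ : R => RtoC 0); [rewrite CD_const; ring|].
  extensionality y. symmetry. apply leibniz_order. lia.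
Qed.

Lemma leibniz_add j u v : csmooth u -> csmooth v ->
  leibniz j (fun x => u x + v x) = coef_add (leibniz j u) (leibniz j v).
Proof.
  intros Hu Hv. induction j as [|j IH].
  - apply single_add.
  - simpl. rewrite IH. coefs_ext i x. unfold Dl, coef_add.
    rewrite CD_plus by now apply leibniz_smooth. destruct i; ring.
Qed.

Lemma leibniz_scal j c u : csmooth u ->
  leibniz j (fun x => c * u x) = coef_scal c (leibniz j u).
Proof.
  intros Hu. induction j as [|j IH].
  - apply single_scal.
  - simpl. rewrite IH. coefs_ext i x. unfold Dl, coef_scal.
    rewrite CD_scal by now apply leibniz_smooth. destruct i; ring.
Qed.

Lemma leibniz_zero j i x : leibniz j (fun _ => 0) i x = 0.
Proof.
  replace (fun _ : R => RtoC 0) with (fun x : R => 0 * 0) by (extensionality y; ring).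
  rewrite (leibniz_scal j 0 (fun _ => 0)) by apply csmooth_const. unfold coef_scal. ring.
Qed.

Lemma leibniz_apply k j u phi x : (j <= k)%nat -> csmooth u -> csmooth phi ->
  applyop k (leibniz j u) phi x = cDn j (fun y => u y * phi y) x.
Proof.
  intros Hj Hu Hp. revert x. induction j as [|j IH]; intro x.
  - unfold applyop. rewrite (csum_single k 0); [|lia|].
    + now rewrite !cDn_0.
    + intros i _ Hi. simpl. unfold single. destruct i; [lia|]. simpl. ring.
  - pose proof (applyop_Dl k (leibniz j u) phi x (fun i => leibniz_smooth j u i Hu) Hp) as A.
    rewrite leibniz_order, Cmult_0_l, Cplus_0_r in A by lia. simpl. rewrite <- A.
    rewrite cDn_S. f_equal. extensionality y. apply IH. lia.
Qed.

Lemma star_apply_spec k a phi x : (forall i, csmooth (a i)) -> csmooth phi ->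
  applyop k (star k a) phi x = star_apply k a phi x.
Proof.
  intros Ha Hp. unfold applyop, star, star_apply.
  transitivity (csum k (fun i => csum k (fun j => sgn j * (leibniz j (a j) i x * cDn i phi x)))).
  - apply csum_ext. intros i _. rewrite Cmult_comm, <- csum_scal. apply csum_ext. intros j _. ring.
  - rewrite csum_swap. apply csum_ext. intros j Hj. rewrite csum_scal. f_equal.
    now apply leibniz_apply.
Qed.

Lemma cDn_csum n j (g : nat -> R -> C) x : (forall i, csmooth (g i)) ->
  cDn j (fun y => csum n (fun i => g i y)) x = csum n (fun i => cDn j (g i) x).
Proof.
  intro Hg. induction n as [|n IH]; simpl; [reflexivity|].
  rewrite (cDn_plus j (fun y => csum n (fun i => g i y)) (g (S n))); [now rewrite IH| |apply Hg].
  apply csmooth_csum. intros i _. apply Hg.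
Qed.

Lemma star_apply_csum n k (X : nat -> coefs) phi x : (forall j i, csmooth (X j i)) -> csmooth phi ->
  star_apply k (fun i y => csum n (fun j => X j i y)) phi x = csum n (fun j => star_apply k (X j) phi x).
Proof.
  intros HX Hp. unfold star_apply. rewrite csum_swap. apply csum_ext. intros i _.
  rewrite csum_scal. f_equal.
  rewrite <- (cDn_csum n i (fun j y => X j i y * phi y)) by (intro; now apply csmooth_mult).
  f_equal. extensionality y. rewrite Cmult_comm, <- csum_scal. apply csum_ext. intros; ring.
Qed.

Lemma flux_csum n K (X : nat -> coefs) phi x : (forall j i, csmooth (X j i)) -> csmooth phi ->
  flux K (fun i y => csum n (fun j => X j i y)) phi x = csum n (fun j => flux K (X j) phi x).
Proof.
  intros HX Hp. unfold flux. rewrite csum_swap. apply csum_ext. intros i _.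
  rewrite csum_scal. f_equal.
  rewrite <- (cDn_csum n i (fun j y => X j (S i) y * phi y)) by (intro; now apply csmooth_mult).
  f_equal. extensionality y. rewrite Cmult_comm, <- csum_scal. apply csum_ext. intros; ring.
Qed.

(** One integration by parts: p' phi = (p phi)' - p phi'. *)
Lemma cDn_Dl_term j (p q phi : R -> C) x : csmooth p -> csmooth q -> csmooth phi ->
  cDn j (fun y => (CD p y + q y) * phi y) x
  = cDn (S j) (fun y => p y * phi y) x - cDn j (fun y => p y * CD phi y) x + cDn j (fun y => q y * phi y) x.
Proof.
  intros Hp Hq Hphi.
  replace (fun y => (CD p y + q y) * phi y)
    with (fun y => (CD (fun y => p y * phi y) y + (-1) * (p y * CD phi y)) + q y * phi y).
  - assert (S1 : csmooth (CD (fun y => p y * phi y))) by now apply csmooth_CD, csmooth_mult.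
    assert (S2 : csmooth (fun y => p y * CD phi y)) by (apply csmooth_mult; [|apply csmooth_CD]; assumption).
    assert (S3 : csmooth (fun y => (-1) * (p y * CD phi y))) by (apply csmooth_mult; [apply csmooth_const|assumption]).
    rewrite cDn_plus; [|now apply csmooth_plus|now apply csmooth_mult].
    rewrite (cDn_plus j (CD (fun y => p y * phi y))) by assumption.
    rewrite cDn_CD, cDn_scal by assumption. ring.
  - extensionality y. rewrite CD_mult by assumption. ring.
Qed.

(* Both recursions telescope, leaving only the boundary term of order [k + 1]. *)
Lemma star_apply_Dl k X phi x : (forall i, csmooth (X i)) -> csmooth phi ->
  star_apply k (Dl X) phi x
  = - star_apply k X (CD phi) x + sgn k * cDn (S k) (fun y => X k y * phi y) x.
Proof.
  intros HX Hp. induction k as [|k IH].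
  - unfold star_apply, Dl. simpl csum.
    rewrite (cDn_Dl_term 0 (X 0%nat) (fun _ => 0) phi) by (auto using csmooth_const).
    replace (fun y => 0 * phi y) with (fun _ : R => RtoC 0) by (extensionality y; ring).
    rewrite cDn_zero. ring.
  - unfold star_apply in *. simpl csum. rewrite IH.
    unfold Dl at 1. rewrite (cDn_Dl_term (S k) (X (S k)) (X k) phi) by auto.
    rewrite sgn_S. ring.
Qed.

Lemma flux_Dl K X phi x : (forall i, csmooth (X i)) -> csmooth phi ->
  flux K (Dl X) phi x
  = X 0%nat x * phi x - flux K X (CD phi) x + sgn K * cDn (S K) (fun y => X (S K) y * phi y) x.
Proof.
  intros HX Hp. induction K as [|K IH].
  - unfold flux, Dl. simpl csum.
    rewrite (cDn_Dl_term 0 (X 1%nat) (X 0%nat) phi) by auto.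
    rewrite (cDn_0 (fun y => X 0%nat y * phi y)). unfold sgn. simpl. ring.
  - unfold flux in *. simpl csum. rewrite IH.
    unfold Dl at 1. rewrite (cDn_Dl_term (S K) (X (S (S K))) (X (S K)) phi) by auto.
    rewrite sgn_S. ring.
Qed.

End Adjoint.

Section Exceptional.
Open Scope C_scope.
Variable K : nat.
Let k := S K.

Section Diffeo.
Variable f : R -> R.
Hypothesis Hf : isdiff MR f.

Lemma powD_csmooth j i : csmooth (powD 0 f j i).
Proof. exact (powD_isfun MR 0 f j i Hf). Qed.

Lemma inv_smooth : csmooth (fun y => RtoC (/ Derive f y)).
Proof. exact (proj2 (proj2 (isfun_cpow_Derive MR f 0 Hf))). Qed.

Lemma pushed_smooth psi : csmooth psi -> csmooth (fun y => RtoC (Derive f y) * psi (f y)).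
Proof.
  intro Hp. apply csmooth_mult.
  - apply csmooth_RtoC. apply smooth_Derive. exact (isdiff_smooth MR f Hf).
  - apply csmooth_comp; [assumption|]. exact (isdiff_smooth MR f Hf).
Qed.

Lemma CD_pushed psi : csmooth psi ->
  CD (fun y => RtoC (/ Derive f y) * (RtoC (Derive f y) * psi (f y)))
  = (fun y => RtoC (Derive f y) * CD psi (f y)).
Proof.
  intro Hp. extensionality x. rewrite <- CD_comp; [|assumption|exact (isdiff_smooth MR f Hf)].
  f_equal. extensionality y. rewrite Cmult_assoc, <- RtoC_mult, Rinv_l; [ring|].
  pose proof (isdiff_pos MR f Hf y). lra.
Qed.

(** The adjoint of (1/f') d/dx is minus d/dx after division by f', and it sends f' (psi o f) to -f'
    (psi' o f). Each factor thus transfers one derivative to psi and changes the sign. *)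
Lemma star_apply_powD j psi x : (j <= k)%nat -> csmooth psi ->
  star_apply k (powD 0 f j) (fun y => RtoC (Derive f y) * psi (f y)) x
  = sgn j * (RtoC (Derive f x) * cDn j psi (f x)).
Proof.
  intros Hj. revert psi x. induction j as [|j IH]; intros psi x Hp.
  - unfold star_apply. rewrite (csum_single k 0); [|lia|].
    + rewrite !cDn_0. rewrite powD_order_0. simpl. ring.
    + intros i _ Hi. replace (fun y => powD 0 f 0 i y * (RtoC (Derive f y) * psi (f y)))
        with (fun _ : R => RtoC 0); [rewrite cDn_zero; ring|].
      extensionality y. rewrite powD_order by lia. ring.
  - transitivity (star_apply k (Dl (powD 0 f j))
      (fun y => RtoC (/ Derive f y) * (RtoC (Derive f y) * psi (f y))) x).
    + unfold star_apply. apply csum_ext. intros i _. f_equal. f_equal. extensionality y. simpl. ring.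
    + rewrite star_apply_Dl; [|apply powD_csmooth|].
      2: { apply csmooth_mult; [apply inv_smooth|now apply pushed_smooth]. }
      rewrite CD_pushed by assumption. rewrite IH; [|lia|now apply csmooth_CD].
      rewrite cDn_CD, sgn_S.
      match goal with |- context [cDn (S k) ?F x] => replace F with (fun _ : R => RtoC 0) end.
      * rewrite cDn_zero. ring.
      * extensionality y. rewrite powD_order by lia. ring.
Qed.

(** The same transfer of derivatives. The boundary term of [flux_Dl] survives only in the step from
    j = 0 to 1, where division by f' turns it into psi(f x). The result carries no factor f': the
    flux is transported as a function. *)
Lemma flux_powD j psi x : (j <= k)%nat -> csmooth psi ->
  flux K (powD 0 f j) (fun y => RtoC (Derive f y) * psi (f y)) x
  = match j with O => 0 | S j => sgn j * cDn j psi (f x) end.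
Proof.
  intros Hj. revert psi x. induction j as [|j IH]; intros psi x Hp.
  - unfold flux. apply csum_zero. intros i _.
    replace (fun y => powD 0 f 0 (S i) y * (RtoC (Derive f y) * psi (f y)))
        with (fun _ : R => RtoC 0); [rewrite cDn_zero; ring|].
    extensionality y. rewrite powD_order by lia. ring.
  - transitivity (flux K (Dl (powD 0 f j))
      (fun y => RtoC (/ Derive f y) * (RtoC (Derive f y) * psi (f y))) x).
    + unfold flux. apply csum_ext. intros i _. f_equal. f_equal. extensionality y. simpl. ring.
    + rewrite flux_Dl; [|apply powD_csmooth|].
      2: { apply csmooth_mult; [apply inv_smooth|now apply pushed_smooth]. }
      rewrite CD_pushed by assumption. rewrite IH; [|lia|now apply csmooth_CD].
      match goal with |- context [cDn (S K) ?F x] => replace F with (fun _ : R => RtoC 0) end.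
      2: { extensionality y. rewrite powD_order by (unfold k in Hj; lia). ring. }
      rewrite cDn_zero, powD_order_0.
      destruct j as [|j]; simpl Nat.eqb; cbv iota.
      * assert (I : RtoC (/ Derive f x) * RtoC (Derive f x) = 1).
        { rewrite <- RtoC_mult, Rinv_l; [reflexivity|]. pose proof (isdiff_pos MR f Hf x). lra. }
        rewrite cDn_0. unfold sgn. simpl.
        transitivity (RtoC (/ Derive f x) * RtoC (Derive f x) * psi (f x)); [ring|]. rewrite I. ring.
      * rewrite cDn_CD, sgn_S. ring.
Qed.

(** Shared by the adjoint and the flux: S only has to be additive in the operator and to move a
    multiplier from the coefficients into its argument. *)
Lemma pull_terms b phi (S : coefs -> (R -> C) -> R -> C) x :
  (forall X, (forall j i, csmooth (X j i)) ->
     S (fun i y => csum k (fun j => X j i y)) phi x = csum k (fun j => S (X j) phi x)) ->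
  (forall u X, S (fun i y => u y * X i y) phi x = S X (fun y => u y * phi y) x) ->
  validop MR k b ->
  S (pull 0 1 k f b) phi x
  = csum k (fun j => S (powD 0 f j) (fun y => RtoC (Derive f y) * (b j (f y) * phi y)) x).
Proof.
  intros Hsum Hmul Hb.
  assert (E : pull 0 1 k f b
    = (fun i y => csum k (fun j => (RtoC (Derive f y) * b j (f y)) * powD 0 f j i y))).
  { coefs_ext i y. unfold pull.
    rewrite cpow_1_r by exact (isdiff_pos MR f Hf y). rewrite <- csum_scal.
    apply csum_ext. intros j _. ring. }
  rewrite E. rewrite (Hsum (fun j i y => (RtoC (Derive f y) * b j (f y)) * powD 0 f j i y)).
  - apply csum_ext. intros j _.
    rewrite (Hmul (fun y => RtoC (Derive f y) * b j (f y)) (powD 0 f j)).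
    f_equal. extensionality y. ring.
  - intros j i. apply csmooth_mult; [|apply powD_csmooth].
    apply pushed_smooth. now apply (valid_csmooth MR k).
Qed.

Lemma star_apply_pull b psi x : validop MR k b -> csmooth psi ->
  star_apply k (pull 0 1 k f b) (fun y => psi (f y)) x = RtoC (Derive f x) * star_apply k b psi (f x).
Proof.
  intros Hb Hp.
  assert (Sp : csmooth (fun y => psi (f y))) by (apply csmooth_comp; [assumption|exact (isdiff_smooth MR f Hf)]).
  rewrite (pull_terms b _ (star_apply k)); [| | |assumption].
  - unfold star_apply at 2. rewrite <- csum_scal. apply csum_ext. intros j Hj.
    rewrite (star_apply_powD j (fun z => b j z * psi z)); [ring|assumption|].
    apply csmooth_mult; [now apply (valid_csmooth MR k)|assumption].
  - intros X HX. now apply star_apply_csum.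
  - intros u X. unfold star_apply. apply csum_ext. intros i _. f_equal. f_equal. extensionality y. ring.
Qed.

Lemma csum_S_l n (g : nat -> C) : csum (S n) g = g 0%nat + csum n (fun i => g (S i)).
Proof. induction n as [|n IH]; [reflexivity|]. change (csum (S (S n)) g) with (csum (S n) g + g (S (S n))). rewrite IH. simpl. ring. Qed.

Lemma flux_pull b x : validop MR k b ->
  flux K (pull 0 1 k f b) (fun _ => 1) x = flux K b (fun _ => 1) (f x).
Proof.
  intros Hb.
  rewrite (pull_terms b _ (flux K)); [| | |assumption].
  - transitivity (csum k (fun j => match j with O => 0 | S j => sgn j * cDn j (fun y => b (S j) y * 1) (f x) end)).
    + apply csum_ext. intros j Hj.
      rewrite (flux_powD j (fun z => b j z * 1)); [destruct j; reflexivity|assumption|].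
      apply csmooth_mult; [now apply (valid_csmooth MR k)|apply csmooth_const].
    + unfold k. rewrite csum_S_l. unfold flux. ring.
  - intros X HX. apply flux_csum; [assumption|apply csmooth_const].
  - intros u X. unfold flux. apply csum_ext. intros i _. f_equal. f_equal. extensionality y. ring.
Qed.

End Diffeo.

Lemma star_valid a : validop MR k a -> validop MR k (star k a).
Proof.
  intro Ha. split.
  - intros i _. apply (csmooth_csum k (fun j x => sgn j * leibniz j (a j) i x)). intros j _.
    apply csmooth_mult; [apply csmooth_const|]. apply leibniz_smooth. now apply (valid_csmooth MR k).
  - intros i x Hi. unfold star. apply csum_zero. intros j Hj. rewrite leibniz_order by lia. ring.
Qed.

(** The adjoint of an operator from l- to m-densities goes from (1 - m)- to (1 - l)-densities, and
    (0, 1) is fixed by this exchange. *)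
Lemma star_in_I : in_I MR k 0 1 (star k).
Proof.
  apply in_I_iff. split; [exact star_valid|]. split; [|split].
  - intros a b Ha Hb. coefs_ext i x. unfold star, coef_add at 2.
    rewrite <- csum_plus. apply csum_ext. intros j _. unfold coef_add at 1.
    rewrite leibniz_add by now apply (valid_csmooth MR k). unfold coef_add. ring.
  - intros c a Ha. coefs_ext i x. unfold star, coef_scal at 2.
    rewrite <- csum_scal. apply csum_ext. intros j _. unfold coef_scal at 1.
    rewrite leibniz_scal by now apply (valid_csmooth MR k). unfold coef_scal. ring.
  - intros f b Hf Hb. pose proof (pull_valid MR 0 1 k f b Hf Hb) as Vp.
    apply (conj_iff_pull MR 0 1 k f); [assumption|now apply star_valid..|].
    intros psi Hpsi x. rewrite star_apply_spec; [|now apply (valid_csmooth MR k)|].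
    2: { exact (isfun_act MR 0 f psi Hf Hpsi). }
    replace (act 0 f psi) with (fun y => psi (f y)).
    + rewrite star_apply_pull by assumption. unfold act.
      rewrite cpow_1_r by exact (isdiff_pos MR f Hf x).
      rewrite star_apply_spec; [reflexivity|now apply (valid_csmooth MR k)|assumption].
    + extensionality y. unfold act. rewrite cpow_0_r. ring.
Qed.

Definition order_0_part (a : coefs) : coefs := single 0 (a 0%nat).

(** This is multiplication by the 1-form A(1). It is invariant because constant functions are, which
    is the content of [powD_order_0]. *)
Lemma order_0_part_in_I : in_I MR k 0 1 order_0_part.
Proof.
  apply in_I_iff. split; [|split; [|split]].
  - intros a Ha. apply valid_single; [lia|]. apply (proj1 Ha). lia.
  - intros a b _ _. unfold order_0_part. apply single_add.
  - intros c a _. unfold order_0_part. apply single_scal.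
  - intros f b Hf Hb. coefs_ext i x. unfold order_0_part.
    rewrite pull_single by lia. unfold single at 1. unfold pull.
    rewrite (csum_single k 0); [|lia|].
    + rewrite powD_order_0. simpl. unfold single. destruct (Nat.eqb i 0); [|ring].
      rewrite cpow_0_r. ring.
    + intros j _ Hj. rewrite powD_order_0. apply Nat.eqb_neq in Hj. rewrite Hj. ring.
Qed.

Definition flux_part (a : coefs) : coefs := single 1 (flux K a (fun _ => 1)).

Lemma flux_part_in_I : in_I MR k 0 1 flux_part.
Proof.
  apply in_I_iff. split; [|split; [|split]].
  - intros a Ha. apply valid_single; [unfold k; lia|].
    apply (csmooth_csum K (fun j x => sgn j * cDn j (fun y => a (S j) y * 1) x)). intros j _.
    apply csmooth_mult; [apply csmooth_const|]. apply csmooth_cDn.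
    apply csmooth_mult; [now apply (valid_csmooth MR k)|apply csmooth_const].
  - intros a b Ha Hb. unfold flux_part. rewrite <- single_add. f_equal. extensionality x.
    unfold flux. rewrite <- csum_plus. apply csum_ext. intros j _. unfold coef_add.
    rewrite <- Cmult_plus_distr_l, <- cDn_plus.
    + f_equal. f_equal. extensionality y. ring.
    + apply csmooth_mult; [now apply (valid_csmooth MR k)|apply csmooth_const].
    + apply csmooth_mult; [now apply (valid_csmooth MR k)|apply csmooth_const].
  - intros c a Ha. unfold flux_part. rewrite <- single_scal. f_equal. extensionality x.
    unfold flux. rewrite <- csum_scal. apply csum_ext. intros j _. unfold coef_scal.
    replace (fun y => c * a (S j) y * 1) with (fun y => c * (a (S j) y * 1))
      by (extensionality y; ring).
    rewrite cDn_scal; [ring|].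
    apply csmooth_mult; [now apply (valid_csmooth MR k)|apply csmooth_const].
  - intros f b Hf Hb. coefs_ext i x. unfold flux_part.
    rewrite pull_single by (unfold k; lia).
    rewrite cpow_1_r by exact (isdiff_pos MR f Hf x). unfold single.
    destruct (Nat.eqb_spec i 1) as [->|Hi].
    + rewrite powD_diag, cpow_0_r, flux_pull by assumption.
      transitivity (RtoC (Derive f x * / Derive f x) * flux K b (fun _ => 1) (f x)).
      * rewrite Rinv_r; [ring|]. pose proof (isdiff_pos MR f Hf x). lra.
      * rewrite pow_1, RtoC_mult. ring.
    + destruct i as [|i].
      * rewrite powD_order_0. simpl. ring.
      * rewrite powD_order by lia. ring.
Qed.

End Exceptional.

(** * Uniqueness of the invariants for (0, 1) *)

Definition xfun : R -> C := fun x => RtoC x.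

Lemma csmooth_xfun : csmooth xfun.
Proof. apply (csmooth_RtoC (fun x => x)). apply smooth_id. Qed.

Section ExceptionalValues.
Open Scope C_scope.
Variables (k : nat) (T : Op).
Hypothesis HT : in_I MR k 0 1 T.

Lemma valid_one j : (j <= k)%nat -> validop MR k (dpow j).
Proof. intro Hj. apply valid_single; [assumption|apply csmooth_const]. Qed.

Lemma valid_x j : (j <= k)%nat -> validop MR k (single j xfun).
Proof. intro Hj. apply valid_single; [assumption|apply csmooth_xfun]. Qed.

Lemma pull_scaling (r c : R) b i x : (0 < r)%R -> (i <= k)%nat -> 
  pull 0 1 k (fun y => r * y + c)%R b i x = RtoC (r * (/ r) ^ i) * b i (r * x + c)%R.
Proof.
  intros Hr Hi. destruct (isdiff_MR_affine r c Hr) as [Hd Dd].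
  rewrite (pull_affine 0 1 k _ b i x r Hi); [|apply filter_forall; exact Dd].
  rewrite cpow_0_r, cpow_1_r, RtoC_mult by assumption. ring.
Qed.

Lemma pull_scaling_single (r c : R) j phi : (0 < r)%R -> (j <= k)%nat ->
  pull 0 1 k (fun y => r * y + c)%R (single j phi)
  = coef_scal (RtoC (r * (/ r) ^ j)) (single j (fun x => phi (r * x + c)%R)).
Proof.
  intros Hr Hj. coefs_ext i x.
  destruct (le_lt_dec i k) as [Hi|Hi].
  - rewrite pull_scaling by assumption. unfold coef_scal, single.
    destruct (Nat.eqb_spec i j) as [->|]; ring.
  - unfold coef_scal, single. destruct (Nat.eqb_spec i j); [lia|].
    rewrite (pull_order 0 1 k _ _ k); [ring| |assumption].
    intros i' y Hi'. destruct (Nat.eqb_spec i' j); [lia|reflexivity].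
Qed.

Lemma pow_half_neq i j : i <> j -> (2 * (/ 2) ^ i <> 2 * (/ 2) ^ j)%R.
Proof.
  assert (A : forall i j, (i < j)%nat -> (2 * (/ 2) ^ i <> 2 * (/ 2) ^ j)%R).
  { intros i' j' H. replace j' with (i' + S (j' - i' - 1))%nat by lia. rewrite pow_add.
    pose proof (pow_lt (/ 2) i' ltac:(lra)).
    assert ((/ 2) ^ S (j' - i' - 1) < 1)%R.
    { apply pow_lt_1_compat; [lra|lia]. }
    nra. }
  intros H. destruct (Nat.lt_total i j) as [L|[L|L]]; [now apply A|lia|].
  intro E. now apply (A j i L).
Qed.

Lemma weight_zero i j (t : C) : i <> j ->
  RtoC (2 * (/ 2) ^ i) * t = RtoC (2 * (/ 2) ^ j) * t -> t = 0.
Proof.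
  intros H E. apply pow_half_neq in H.
  assert (N : RtoC (2 * (/ 2) ^ i - 2 * (/ 2) ^ j) <> 0) by (intro Q; apply RtoC_inj in Q; lra).
  transitivity (/ RtoC (2 * (/ 2) ^ i - 2 * (/ 2) ^ j) * (RtoC (2 * (/ 2) ^ i) * t - RtoC (2 * (/ 2) ^ j) * t)).
  - rewrite RtoC_minus in *. field. assumption.
  - rewrite E. ring.
Qed.

(** Translations fix d^j, so T(d^j) has constant coefficients; the dilation of ratio 2 gives
    distinct weights to distinct orders and leaves only order j. *)
Lemma T_one j : (j <= k)%nat ->
  T (dpow j) = coef_scal (T (dpow j) j 0%R) (dpow j).
Proof.
  intro Hj. pose proof (valid_one j Hj) as V. pose proof (T_valid HT _ V) as VT.
  assert (Eq : forall r c, (0 < r)%R -> forall i x, (i <= k)%nat ->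
    RtoC (r * (/ r) ^ j) * T (dpow j) i x
    = RtoC (r * (/ r) ^ i) * T (dpow j) i (r * x + c)%R).
  { intros r c Hr i x Hi. rewrite <- pull_scaling by assumption.
    rewrite <- (T_pull HT) by (try apply isdiff_MR_affine; assumption).
    rewrite pull_scaling_single by assumption.
    now rewrite (T_scal HT) by assumption. }
  coefs_ext i x. unfold coef_scal, single at 3.
  destruct (le_lt_dec i k) as [Hi|Hi].
  2: { rewrite (proj2 VT) by assumption. destruct (Nat.eqb_spec i j); [lia|ring]. }
  assert (Ex : T (dpow j) i x = T (dpow j) i 0%R).
  { pose proof (Eq 1%R (- x)%R ltac:(lra) i x Hi) as E.
    replace (1 * x + - x)%R with 0%R in E by ring.
    rewrite Rinv_1, !pow1, Rmult_1_l, !Cmult_1_l in E. exact E. }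
  rewrite Ex. destruct (Nat.eqb_spec i j) as [->|N]; [ring|].
  rewrite (weight_zero j i (T (dpow j) i 0%R)); [ring|auto|].
  pose proof (Eq 2%R 0%R ltac:(lra) i 0%R Hi) as E.
  now replace (2 * 0 + 0)%R with 0%R in E by ring.
Qed.

(** Translating x d^j adds a multiple of d^j, whence the affine dependence on x. Under the dilation
    of ratio 2, x d^j weighs as much as d^(j-1), so its value at 0 can only sit in order j - 1. *)
Lemma T_x j i x : (j <= k)%nat -> (i <= k)%nat ->
  T (single j xfun) i x = T (single j xfun) i 0%R + RtoC x * T (dpow j) i 0%R
  /\ (S i <> j -> T (single j xfun) i 0%R = 0).
Proof.
  intros Hj Hi. pose proof (valid_one j Hj) as V1. pose proof (valid_x j Hj) as V.
  split.
  - destruct (isdiff_MR_affine 1 x ltac:(lra)) as [Hd _].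
    assert (E := f_equal (fun d => d i 0%R) (T_pull HT _ _ Hd V)). simpl in E.
    rewrite pull_scaling, pull_scaling_single in E by (assumption || lra).
    replace (1 * 0 + x)%R with x in E by ring.
    rewrite Rinv_1, !pow1, Rmult_1_l, !Cmult_1_l in E. rewrite <- E.
    replace (coef_scal (RtoC 1) (single j (fun y => xfun (1 * y + x)%R)))
      with (coef_add (single j xfun) (coef_scal (RtoC x) (dpow j))).
    + rewrite (T_add HT), (T_scal HT) by (try apply valid_scal; assumption).
      reflexivity.
    + coefs_ext i' y. unfold coef_add, coef_scal, single, xfun.
      destruct (Nat.eqb i' j); [|ring]. rewrite RtoC_plus, RtoC_mult. ring.
  - intro N. apply (weight_zero j (S i)); [auto|].
    destruct (isdiff_MR_affine 2 0 ltac:(lra)) as [Hd _].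
    assert (E := f_equal (fun d => d i 0%R) (T_pull HT _ _ Hd V)). simpl in E.
    rewrite pull_scaling, pull_scaling_single in E by (assumption || lra).
    replace (2 * 0 + 0)%R with 0%R in E by ring.
    replace (single j (fun y => xfun (2 * y + 0)%R)) with (coef_scal (RtoC 2) (single j xfun)) in E.
    + rewrite !(T_scal HT) in E by (try apply valid_scal; assumption).
      unfold coef_scal in E.
      replace (2 * (/ 2) ^ S i)%R with ((/ 2) * (2 * (/ 2) ^ i))%R by (simpl; ring).
      rewrite (RtoC_mult (/ 2)), <- Cmult_assoc, <- E, Cmult_assoc, <- RtoC_mult.
      rewrite (Cmult_assoc (RtoC (/ 2 * _))), <- RtoC_mult. f_equal. f_equal. field.
    + coefs_ext i' y. unfold coef_scal, single, xfun.
      destruct (Nat.eqb i' j); [|ring]. rewrite <- RtoC_mult. f_equal. ring.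
Qed.

Definition kills_below (j : nat) : Prop :=
  forall a, validop MR k a -> (forall i x, (j <= i)%nat -> a i x = 0) -> forall i x, T a i x = 0.

Lemma kills_lower_part j b : (j <= k)%nat -> kills_below j -> validop MR k b ->
  (forall i x, (j < i)%nat -> b i x = 0) -> forall i x, T b i x = T (single j (b j)) i x.
Proof.
  intros Hj Kj Hb Hord i x.
  set (rest := (fun i x => if Nat.eqb i j then RtoC 0 else b i x) : coefs).
  assert (Vs : validop MR k (single j (b j))) by (apply valid_single; [assumption|now apply (proj1 Hb)]).
  assert (Vr : validop MR k rest).
  { split.
    - intros i' Hi. unfold rest. destruct (Nat.eqb i' j); [apply csmooth_const|now apply (proj1 Hb)].
    - intros i' y Hi. unfold rest. destruct (Nat.eqb i' j); [reflexivity|now apply (proj2 Hb)]. }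
  assert (E : b = coef_add (single j (b j)) rest).
  { coefs_ext i' y. unfold coef_add, single, rest.
    destruct (Nat.eqb_spec i' j) as [->|]; ring. }
  rewrite E at 1. rewrite (T_add HT) by assumption. unfold coef_add.
  rewrite (Kj rest Vr); [ring|]. intros i' y Hi. unfold rest.
  destruct (Nat.eqb_spec i' j); [reflexivity|]. apply Hord. lia.
Qed.

Lemma kills_single_complex j : (j <= k)%nat ->
  (forall phi : R -> R, smooth phi -> forall i x, T (rsingle j phi) i x = 0) ->
  kills_below j -> kills_below (S j).
Proof.
  intros Hj H Kj a Ha Hord i x.
  rewrite (kills_lower_part j a Hj Kj Ha) by (intros; apply Hord; lia).
  destruct (proj1 Ha j Hj) as [S1 S2].
  assert (V : forall p : R -> R, smooth p -> validop MR k (rsingle j p)).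
  { intros p Hp. apply valid_single; [assumption|now apply csmooth_RtoC]. }
  assert (E : single j (a j) = coef_add (single j (fun y => RtoC (Re (a j y))))
    (coef_scal Ci (single j (fun y => RtoC (Im (a j y)))))).
  { coefs_ext i' y. unfold coef_add, coef_scal, single.
    destruct (Nat.eqb i' j); [|ring]. apply C_eq; simpl; ring. }
  rewrite E, (T_add HT), (T_scal HT)
    by (try apply valid_scal; apply V; assumption).
  unfold coef_add, coef_scal. rewrite !H by assumption. ring.
Qed.

Lemma pull_one_diag f j x : isdiff MR f -> (j <= k)%nat ->
  pull 0 1 k f (dpow j) j x = RtoC (Derive f x * (/ Derive f x) ^ j).
Proof.
  intros Hf Hj. rewrite pull_single by assumption.
  rewrite powD_diag, cpow_0_r, cpow_1_r by exact (isdiff_pos MR f Hf x).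
  rewrite RtoC_mult. ring.
Qed.

Lemma pull_single_order f j phi : (j <= k)%nat ->
  forall i x, (j < i)%nat -> pull 0 1 k f (single j phi) i x = 0.
Proof.
  intros Hj i x Hi. apply (pull_order 0 1 k f _ j); [|assumption].
  intros i' y Hi'. unfold single. destruct (Nat.eqb_spec i' j); [lia|reflexivity].
Qed.

Lemma isdiff_germ_MR (F : R -> R) (x0 : R) : smooth F -> (forall x, (0 < Derive F x)%R) ->
  exists f, isdiff MR f /\ locally x0 (fun x => f x = F x) /\ locally x0 (fun x => Derive f x = Derive F x).
Proof.
  intros HF H0. destruct (germ_diffeo F x0 HF H0) as [f [Hf L]].
  exists f. split; [now apply isdiff_MS1_MR|]. split; [assumption|].
  apply locally_locally in L. apply filter_imp with (2 := L). intros y. apply Derive_ext_loc.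
Qed.

(* Near any point, W = (f')^(1-j) is the top coefficient of f^*(d^j). *)
Lemma density_germ j (W : R -> R) (x0 : R) : (j <> 1)%nat -> smooth W -> (forall x, (0 < W x)%R) ->
  exists f, isdiff MR f /\ f x0 = x0 /\ locally x0 (fun x => Derive f x = exp (ln (W x) / (1 - INR j))
    /\ (Derive f x * (/ Derive f x) ^ j = W x)%R).
Proof.
  intros Hj SW W0. assert (N : (1 - INR j <> 0)%R).
  { intro E. apply Hj. apply INR_eq. simpl. lra. }
  set (v := fun x => exp (ln (W x) / (1 - INR j))).
  assert (Sv : smooth v).
  { unfold v. smooth. }
  destruct (smooth_primitive v Sv) as [F [SF DF]].
  set (G := fun x => (F x + (x0 - F x0))%R).
  assert (DG : forall x, Derive G x = v x).
  { intro x. unfold G. rewrite Derive_plus, Derive_const, (is_derive_unique _ _ _ (DF x)); [ring| |].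
    - now apply smooth_ex_derive.
    - apply @ex_derive_const. }
  destruct (isdiff_germ_MR G x0) as [f [Hf [L1 L2]]].
  - apply smooth_plus; [assumption|apply smooth_const].
  - intro x. rewrite DG. apply exp_pos.
  - exists f. split; [assumption|]. split.
    + rewrite (locally_singleton _ _ L1). unfold G. ring.
    + apply filter_imp with (2 := L2). intros x Hx. rewrite DG in Hx. rewrite Hx. split; [reflexivity|].
      unfold v. rewrite <- exp_Ropp.
      rewrite exp_mult_INR, <- exp_plus. rewrite <- (exp_ln (W x)) at 3 by auto. f_equal. field. assumption.
Qed.

Lemma T_local_single j phi psi x : (j <= k)%nat -> csmooth phi -> csmooth psi ->
  locally x (fun y => phi y = psi y) -> forall i, T (single j phi) i x = T (single j psi) i x.
Proof.
  intros Hj H1 H2 L. apply (local_op_eq MR 0 1 k T); try assumption.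
  - now apply (T_local_MR 0 1 k T).
  - now apply valid_single.
  - now apply valid_single.
  - apply filter_imp with (2 := L). intros y Hy i. unfold single. now rewrite Hy.
Qed.

(** Near x, W d^j differs from f^*(d^j) by lower orders, which T kills, and T(f^*(d^j)) =
    f^*(T(d^j)) = 0. Locality lets the argument run near one point at a time. *)
Lemma kills_density j (W : R -> R) : (j <= k)%nat -> (j <> 1)%nat -> kills_below j ->
  (forall i x, T (dpow j) i x = 0) -> smooth W -> (forall x, (0 < W x)%R) ->
  forall i x, T (rsingle j W) i x = 0.
Proof.
  intros Hj Hj1 Kj H1 SW W0 i x.
  destruct (density_germ j W x Hj1 SW W0) as [f [Hf [_ L]]].
  pose proof (valid_one j Hj) as V1. pose proof (pull_valid MR 0 1 k f _ Hf V1) as Vp.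
  rewrite (T_local_single j _ (pull 0 1 k f (dpow j) j)).
  - rewrite <- (kills_lower_part j _ Hj Kj Vp) by now apply pull_single_order.
    rewrite (T_pull HT) by assumption.
    unfold pull. rewrite csum_zero; [ring|]. intros p _. rewrite H1. ring.
  - assumption.
  - now apply csmooth_RtoC.
  - now apply (proj1 Vp).
  - apply filter_imp with (2 := L). intros y [_ Hy]. now rewrite pull_one_diag, Hy.
Qed.

Lemma kills_step j : (j <= k)%nat -> (j <> 1)%nat -> kills_below j ->
  (forall i x, T (dpow j) i x = 0) -> kills_below (S j).
Proof.
  intros Hj Hj1 Kj H1. apply kills_single_complex; [assumption| |assumption].
  intros phi Sp i x.
  (* Polarization: phi is a quarter of the difference of the positive functions with c = 1 and c =
     -1. *)
  set (W := fun (c x : R) => ((phi x + c) ^ 2 + 1)%R).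
  assert (SW : forall c, smooth (W c)) by (intro c; unfold W; smooth).
  assert (W0 : forall c y, (0 < W c y)%R) by (intros c y; unfold W; pose proof (pow2_ge_0 (phi y + c)); lra).
  assert (V : forall c, validop MR k (single j (fun y => RtoC (W c y)))).
  { intro c. apply valid_single; [assumption|now apply csmooth_RtoC]. }
  assert (E : single j (fun y => RtoC (phi y)) = coef_scal (RtoC (/ 4))
    (coef_add (single j (fun y => RtoC (W 1%R y))) (coef_scal (RtoC (-1)) (single j (fun y => RtoC (W (-1)%R y)))))).
  { coefs_ext i' y. unfold coef_add, coef_scal, single, W.
    destruct (Nat.eqb i' j); [|ring]. apply C_eq; simpl; field. }
  pose proof (valid_scal MR k (RtoC (-1)) _ (V (-1)%R)) as V2.
  rewrite E, (T_scal HT _ _ (valid_add MR k _ _ (V 1%R) V2)),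
    (T_add HT _ _ (V 1%R) V2), (T_scal HT _ _ (V (-1)%R)).
  unfold coef_scal, coef_add. rewrite !kills_density by auto. ring.
Qed.

(** As f^*d = d, the density argument is void at order 1. Instead f^*(x d) = f d handles increasing
    coefficients, and every smooth function is a difference of two increasing ones. *)
Lemma kills_step_1 : (1 <= k)%nat -> kills_below 1 ->
  (forall i x, T (dpow 1) i x = 0) -> (forall i x, T (single 1 xfun) i x = 0) ->
  kills_below 2.
Proof.
  intros Hk K1 H1 Hx. apply kills_single_complex; [assumption| |assumption].
  assert (Inc : forall F : R -> R, smooth F -> (forall x, (0 < Derive F x)%R) ->
    forall i x, T (rsingle 1 F) i x = 0).
  { intros F SF F0 i x. destruct (isdiff_germ_MR F x SF F0) as [f [Hf [L _]]].
    pose proof (valid_x 1 Hk) as Vx.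
    pose proof (pull_valid MR 0 1 k f _ Hf Vx) as Vp.
    rewrite (T_local_single 1 _ (pull 0 1 k f (single 1 xfun) 1%nat)).
    - rewrite <- (kills_lower_part 1 _ Hk K1 Vp) by now apply pull_single_order.
      rewrite (T_pull HT) by assumption.
      unfold pull. rewrite csum_zero; [ring|]. intros p _. rewrite Hx. ring.
    - assumption.
    - now apply csmooth_RtoC.
    - now apply (proj1 Vp).
    - apply filter_imp with (2 := L). intros y Hy. rewrite pull_single by assumption.
      rewrite powD_diag, cpow_0_r, cpow_1_r by exact (isdiff_pos MR f Hf y).
      unfold xfun. rewrite <- Hy, pow_1.
      transitivity (RtoC (Derive f y) * RtoC (/ Derive f y) * RtoC (f y)); [|ring].
      rewrite <- RtoC_mult, Rinv_r; [ring|]. pose proof (isdiff_pos MR f Hf y). lra. }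
  intros phi Sp i x.
  (* The two positive functions with c = 1 and c = -1 differ by phi', so their primitives are
     increasing and differ by phi up to a constant. *)
  set (W := fun (c x : R) => (((Derive phi x + c) ^ 2 + 1) / 4)%R).
  assert (SW : forall c, smooth (W c)) by (intro c; unfold W; smooth).
  assert (W0 : forall c y, (0 < W c y)%R) by (intros c y; unfold W; pose proof (pow2_ge_0 (Derive phi y + c)); lra).
  destruct (smooth_primitive (W 1%R) (SW 1%R)) as [F1 [S1 D1]].
  destruct (smooth_primitive (W (-1)%R) (SW (-1)%R)) as [F2 [S2 D2]].
  set (c := (phi 0 - (F1 0 - F2 0))%R).
  assert (Ephi : forall y, phi y = (F1 y - F2 y + c)%R).
  { intro y. assert (Q : (phi y - (F1 y - F2 y) = phi 0 - (F1 0 - F2 0))%R).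
    { apply (derive_0_eq (fun y => phi y - (F1 y - F2 y))%R). intros t _.
      replace 0%R with (Derive phi t - (W 1 t - W (-1) t))%R by (unfold W; field).
      apply @is_derive_minus; [now apply smooth_is_derive|].
      apply @is_derive_minus; [apply D1|apply D2]. }
    unfold c. lra. }
  assert (V : forall F : R -> R, smooth F -> validop MR k (rsingle 1 F)).
  { intros F SF. apply valid_single; [assumption|now apply csmooth_RtoC]. }
  pose proof (valid_one 1 Hk) as V1.
  assert (E : single 1 (fun y => RtoC (phi y)) = coef_add
    (coef_add (rsingle 1 F1) (coef_scal (RtoC (-1)) (rsingle 1 F2)))
    (coef_scal (RtoC c) (dpow 1))).
  { coefs_ext i' y. unfold coef_add, coef_scal, single.
    destruct (Nat.eqb i' 1); [|ring]. rewrite Ephi. apply C_eq; simpl; ring. }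
  pose proof (V F1 S1) as VF1. pose proof (V F2 S2) as VF2.
  pose proof (valid_scal MR k (RtoC (-1)) _ VF2) as VF2'.
  rewrite E, (T_add HT _ _ (valid_add MR k _ _ VF1 VF2') (valid_scal MR k (RtoC c) _ V1)),
    (T_add HT _ _ VF1 VF2'), (T_scal HT _ _ VF2), (T_scal HT _ _ V1).
  unfold coef_scal, coef_add. rewrite H1, !Inc; [ring|assumption| |assumption|].
  - intro t. rewrite (is_derive_unique _ _ _ (D2 t)). apply W0.
  - intro t. rewrite (is_derive_unique _ _ _ (D1 t)). apply W0.
Qed.

Section TopOrder.
Variables (n : nat) (f : R -> R).
Let beta (i : nat) : R := ((1 + INR i - INR i * INR n) / INR n)%R.
Fixpoint beta_prod (i : nat) : R := match i with O => 1%R | S i => (beta_prod i * beta i)%R end.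

(** For l = 0 the order-0 coefficients vanish, so the first-order ones obey a closed recursion:
    apply (1 + y)^(1/n) d/dy. Each step multiplies by the exponent [beta i] and adds 1/n - 1 to
    it. *)
Lemma powD_first_order : (1 <= n)%nat ->
  locally 0%R (fun y => (0 < 1 + y)%R /\ (/ Derive f y = exp (/ INR n * ln (1 + y)))%R) ->
  forall i, locally 0%R (fun y => powD 0 f (S i) 1%nat y = RtoC (beta_prod i * exp (beta i * ln (1 + y)))).
Proof.
  intros Hn L. assert (Nn : (INR n <> 0)%R) by (apply not_0_INR; lia).
  induction i as [|i IH].
  - apply filter_imp with (2 := L). intros y [_ Hy].
    change (powD 0 f 1 1%nat y) with (RtoC (/ Derive f y) * Dl (powD 0 f 0) 1%nat y).
    unfold Dl. rewrite powD_order_0. change (powD 0 f 0 1%nat) with (fun _ : R => RtoC 0).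
    rewrite CD_const, Hy. unfold beta. simpl beta_prod. simpl INR.
    replace ((1 + 0 - 0 * INR n) / INR n)%R with (/ INR n)%R by (field; assumption).
    rewrite Rmult_1_l. simpl. ring.
  - pose proof (CD_loc _ _ _ IH) as L1.
    generalize (filter_and _ _ L L1). apply filter_imp. intros y [[Hy0 Hy] H1].
    change (powD 0 f (S (S i)) 1%nat y) with (RtoC (/ Derive f y) * Dl (powD 0 f (S i)) 1%nat y).
    unfold Dl. rewrite powD_order_0, H1, CD_RtoC, Hy.
    replace (Derive (fun y => beta_prod i * exp (beta i * ln (1 + y)))%R y)
      with (beta_prod i * (beta i * / (1 + y) * exp (beta i * ln (1 + y))))%R.
    + simpl Nat.eqb. cbv iota. rewrite Cplus_0_r, <- RtoC_mult. f_equal.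
      simpl beta_prod.
      replace (exp (beta (S i) * ln (1 + y)))%R
        with (exp (/ INR n * ln (1 + y)) * exp (beta i * ln (1 + y)) * / (1 + y))%R; [ring|].
      rewrite <- (exp_ln (/ (1 + y))) by now apply Rinv_0_lt_compat.
      rewrite ln_Rinv by assumption. rewrite <- !exp_plus. f_equal.
      unfold beta. rewrite S_INR. field. assumption.
    + symmetry. apply is_derive_unique. auto_derive; [assumption|]. field. lra.
Qed.

(** A factor [beta i] vanishes exactly when i (n - 1) = 1, that is i = 1 and n = 2, which is
    operator order 3. *)
Lemma beta_prod_neq_0 i : (3 <= n)%nat -> beta_prod i <> 0%R.
Proof.
  intro Hn. induction i as [|i IH]; simpl; [lra|].
  apply Rmult_integral_contrapositive_currified; [assumption|].
  unfold beta. apply Rmult_integral_contrapositive_currified.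
  - destruct i as [|i]; [simpl; lra|].
    assert (3 <= INR n)%R by (apply (le_INR 3 n) in Hn; simpl in Hn; lra).
    rewrite S_INR. pose proof (pos_INR i). nra.
  - apply Rinv_neq_0_compat. apply not_0_INR. lia.
Qed.

End TopOrder.

(* With (f')^(-n) = 1 + x near 0, f^*(d^j) has top coefficient 1 + x, which T sends to an operator
   without first-order term; but the first-order term of f^*(d^j) itself does not vanish. *)
Lemma kills_one j : (4 <= j <= k)%nat -> kills_below j -> forall i x, T (dpow j) i x = 0.
Proof.
  intros Hj Kj. assert (Hjk : (j <= k)%nat) by lia.
  pose proof (valid_one j Hjk) as V1.
  set (t := T (dpow j) j 0%R).
  assert (Ht : t = 0).
  (* A globally positive function equal to 1 + x near 0; positivity holds since |proj| <= 1/2. *)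
  { set (W := fun x => (1 + proj x)%R).
    assert (SW : smooth W) by (pose proof proj_smooth; unfold W; smooth).
    assert (W0 : forall x, (0 < W x)%R).
    { intro x. unfold W. pose proof (proj_bound x) as B. apply Rabs_le_between in B. lra. }
    assert (LW : locally 0%R (fun x => W x = (1 + x)%R /\ (0 < 1 + x)%R)).
    { apply locally_Rabs_ex. exists (1 / 8)%R. split; [lra|]. intros y Hy. rewrite Rminus_0_r in Hy.
      unfold W. rewrite proj_near by lra. apply Rabs_def2 in Hy. split; [reflexivity|lra]. }
    destruct (density_germ j W 0 ltac:(lia) SW W0) as [f [Hf [F0 L]]].
    pose proof (pull_valid MR 0 1 k f _ Hf V1) as Vp.
    set (p := pull 0 1 k f (dpow j)) in *.
    (* By [T_x] the image of x d^j at 0 has a coefficient only in order j - 1, which differs from 1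
       because j is not 2. *)
    assert (E1 : T p 1%nat 0%R = 0).
    { unfold p. rewrite (kills_lower_part j _ Hjk Kj Vp) by now apply pull_single_order.
      rewrite (T_local_single j _ (fun y => 1 + xfun y)).
      - rewrite single_add, (T_add HT) by (assumption || now apply valid_x).
        unfold coef_add. rewrite T_one by assumption. unfold coef_scal, single at 2.
        destruct (Nat.eqb_spec 1 j); [lia|].
        rewrite (proj2 (T_x j 1 0%R Hjk ltac:(lia))) by lia. ring.
      - assumption.
      - now apply (proj1 Vp).
      - apply csmooth_plus; [apply csmooth_const|apply csmooth_xfun].
      - generalize (filter_and _ _ L LW). apply filter_imp. intros y [[_ H2] [H3 _]].
        unfold p; rewrite pull_one_diag by assumption. rewrite H2, H3, RtoC_plus. reflexivity. }
    unfold p in E1. rewrite (T_pull HT) in E1 by assumption.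
    rewrite T_one in E1 by assumption. fold t in E1.
    rewrite pull_scal in E1.
    unfold coef_scal in E1.
    rewrite pull_single in E1 by assumption.
    rewrite cpow_1_r in E1 by exact (isdiff_pos MR f Hf 0%R).
    set (n := (j - 1)%nat).
    assert (Hn : INR n = (INR j - 1)%R) by (unfold n; rewrite minus_INR by lia; simpl; ring).
    assert (Nn : (INR n <> 0)%R) by (apply not_0_INR; unfold n; lia).
    assert (LD : locally 0%R (fun y => (0 < 1 + y)%R /\ (/ Derive f y = exp (/ INR n * ln (1 + y)))%R)).
    { generalize (filter_and _ _ L LW). apply filter_imp. intros y [[H2 _] [H3 H4]].
      split; [assumption|]. rewrite H2, H3, <- exp_Ropp. f_equal. rewrite Hn. field. lra. }
    pose proof (powD_first_order n f ltac:(unfold n; lia) LD n) as LP.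
    replace (S n) with j in LP by (unfold n; lia).
    rewrite (locally_singleton _ _ LP) in E1.
    rewrite Rplus_0_r, ln_1, Rmult_0_r, exp_0, Rmult_1_r in E1.
    assert (N1 : RtoC (Derive f 0) <> 0).
    { intro Q. apply RtoC_inj in Q. pose proof (isdiff_pos MR f Hf 0%R). lra. }
    assert (N2 : RtoC (beta_prod n n) <> 0).
    { intro Q. apply RtoC_inj in Q. revert Q. apply beta_prod_neq_0. unfold n. lia. }
    transitivity (/ RtoC (Derive f 0) * / RtoC (beta_prod n n)
      * (t * (RtoC (Derive f 0) * 1 * RtoC (beta_prod n n)))); [field; now split|].
    rewrite E1. ring. }
  intros i x. rewrite T_one by assumption. fold t. rewrite Ht. unfold coef_scal. ring.
Qed.

(** Here n counts the free scalars of orders 2 and 3 that exist within order k, so n is 2 unless k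
    is smaller than 3. *)
Lemma T_vanishes n : (1 <= k)%nat -> (S n <= k)%nat -> (n = 2%nat \/ k = S n) ->
  T (dpow 0) 0%nat 0%R = 0 -> T (dpow 1) 1%nat 0%R = 0 ->
  T (single 1 xfun) 0%nat 0%R = 0 ->
  (forall j, (j < n)%nat -> T (dpow (j + 2)) (j + 2)%nat 0%R = 0) ->
  forall a, validop MR k a -> forall i x, T a i x = 0.
Proof.
  intros Hk Hn Hnk T0 T1 Tx Tj.
  assert (One : forall j, (j <= k)%nat -> T (dpow j) j 0%R = 0 ->
    forall i x, T (dpow j) i x = 0).
  { intros j Hj E i x. rewrite T_one, E by assumption. unfold coef_scal. ring. }
  assert (Kill : forall j, (j <= S k)%nat -> kills_below j).
  { induction j as [|j IH]; intro Hj.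
    - intros a Ha Hord i x. assert (E : a = coef_scal 0 a).
      { coefs_ext i' y. unfold coef_scal. rewrite Hord by lia. ring. }
      rewrite E, (T_scal HT) by assumption. unfold coef_scal. ring.
    - specialize (IH ltac:(lia)).
      destruct j as [|[|j]].
      + apply kills_step; [lia|lia|assumption|]. apply One; [lia|assumption].
      + apply kills_step_1; [lia|assumption|apply One; [lia|assumption]|].
        intros i x. destruct (le_lt_dec i k) as [Hi|Hi].
        * destruct (T_x 1 i x Hk Hi) as [E1 E2]. rewrite E1, (One 1%nat) by (assumption || lia).
          destruct i as [|i]; [rewrite Tx; ring|]. rewrite E2 by lia. ring.
        * apply (proj2 (T_valid HT _ (valid_x 1 Hk))). assumption.
      + apply kills_step; [lia|lia|assumption|].
        destruct (le_lt_dec n j) as [L|L].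
        (* An order j + 2 with n <= j within k is only possible for n = 2, so it is at least 4. *)
        * apply kills_one; [lia|assumption].
        * apply One; [lia|]. specialize (Tj j L). now replace (S (S j)) with (j + 2)%nat by lia. }
  intros a Ha. apply (Kill (S k)); [lia|assumption|].
  intros i x Hi. apply (proj2 Ha). lia.
Qed.

End ExceptionalValues.

(** * The algebra for (0, 1) *)

Section ExceptionalIso.
Open Scope C_scope.

(** By [T_one] this is the eigenvalue of an invariant T on d^j. *)
Definition diag_value (T : Op) (j : nat) : C := T (dpow j) j 0%R.
Definition d_value (T : Op) : C := T (single 1 xfun) 0%nat 0%R.

Lemma T_d_x k T : in_I MR k 0 1 T -> (1 <= k)%nat ->
  T (single 1 xfun) = coef_add (coef_scal (diag_value T 1) (single 1 xfun))
    (coef_scal (d_value T) (dpow 0)).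
Proof.
  intros HT Hk. coefs_ext i x.
  unfold coef_add, coef_scal.
  destruct (le_lt_dec i k) as [Hi|Hi].
  - destruct (T_x k T HT 1 i x Hk Hi) as [E1 E2]. rewrite E1, (T_one k T HT) by assumption.
    unfold coef_scal. fold (diag_value T 1).
    destruct i as [|[|i]]; [fold (d_value T)|rewrite E2 by lia..];
      unfold single, xfun; simpl Nat.eqb; cbv iota; ring.
  - rewrite (proj2 (T_valid HT _ (valid_x k 1 Hk)) i x Hi). unfold single.
    destruct (Nat.eqb_spec i 1); [lia|]. destruct (Nat.eqb_spec i 0); [lia|]. ring.
Qed.

Lemma diag_value_comp k T U j : in_I MR k 0 1 T -> in_I MR k 0 1 U -> (j <= k)%nat ->
  diag_value (fun a => T (U a)) j = diag_value T j * diag_value U j.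
Proof.
  intros HT HU Hj. unfold diag_value at 1.
  rewrite (T_one k U HU) by assumption.
  rewrite (T_scal HT) by now apply valid_one.
  unfold coef_scal, diag_value. ring.
Qed.

Lemma d_value_comp k T U : in_I MR k 0 1 T -> in_I MR k 0 1 U -> (1 <= k)%nat ->
  d_value (fun a => T (U a)) = d_value T * diag_value U 1 + diag_value T 0 * d_value U.
Proof.
  intros HT HU Hk. unfold d_value at 1.
  pose proof (valid_x k 1 Hk) as Vx. pose proof (valid_one k 0 ltac:(lia)) as V0.
  rewrite (T_d_x k U HU Hk).
  rewrite (T_add HT), !(T_scal HT) by (try apply valid_scal; assumption).
  unfold coef_add, coef_scal. fold (d_value T). fold (diag_value T 0). ring.
Qed.

(** An invariant T preserves the plane spanned by x d and the operator 1, where T(x d) = p x d + q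
    and T(1) = r. The triple is its lower triangular matrix in that basis; the remaining entries are
    the eigenvalues on d^2 and d^3. *)
Definition coordinates (n : nat) (T : Op) : (C * C * C) * (nat -> C) :=
  ((diag_value T 1, d_value T, diag_value T 0),
   fun j => if Nat.ltb j n then diag_value T (j + 2) else 0).

Lemma single_other i j phi x : i <> j -> single j phi i x = 0.
Proof. intro H. unfold single. now apply Nat.eqb_neq in H as ->. Qed.

Lemma single_same j phi x : single j phi j x = phi x.
Proof. unfold single. now rewrite Nat.eqb_refl. Qed.

Lemma star_single k j i phi x : (j <= k)%nat ->
  star k (single j phi) i x = sgn j * leibniz j phi i x.
Proof.
  intro Hj. unfold star. rewrite (csum_single k j); [|assumption|].
  - unfold single at 1. now rewrite Nat.eqb_refl.
  - intros p _ Hp. replace (single j phi p) with (fun _ : R => RtoC 0).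
    + rewrite leibniz_zero. ring.
    + extensionality y. now rewrite single_other.
Qed.

Lemma flux_one K x : flux K (dpow 1) (fun _ => 1) x = 1.
Proof.
  unfold flux. rewrite (csum_single K 0); [|lia|].
  - rewrite cDn_0. unfold sgn, single. simpl. ring.
  - intros p _ Hp. replace (fun y : R => single 1 (fun _ => 1) (S p) y * 1) with (fun _ : R => RtoC 0).
    + rewrite cDn_zero. ring.
    + extensionality y. rewrite single_other by lia. ring.
Qed.

(* Every invariant is a combination of the identity, the adjoint A -> A*, the projections
   A -> A(1) and A -> A*(1), and the map A -> g d/dx where dg = A(1) - A*(1). *)
Lemma coordinates_onto K (p q r s0 s1 : C) :
  exists T, in_I MR (S K) 0 1 T /\ diag_value T 1 = p /\ d_value T = q /\ diag_value T 0 = r /\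
    ((2 <= S K)%nat -> diag_value T 2 = s0) /\ ((3 <= S K)%nat -> diag_value T 3 = s1).
Proof.
  set (k := S K).
  (* Solution of a triangular system: al + be = s0 and al - be = s1 from orders 2 and 3, al - be +
     ga = p from d, -be - ze' = q from x d, and al + be + ze + ze' = r from 1. *)
  set (al := RtoC (/ 2) * (s0 + s1)). set (be := RtoC (/ 2) * (s0 - s1)).
  set (ga := p - (al - be)). set (ze' := - be - q). set (ze := r - al - be - ze').
  set (T := fun a => coef_add (coef_scal al a) (coef_add (coef_scal be (star k a))
    (coef_add (coef_scal ga (flux_part K a)) (coef_add (coef_scal ze (order_0_part a))
      (coef_scal ze' (order_0_part (star k a))))))).
  assert (Half : forall z : C, RtoC (/ 2) * (z + z) = z).
  { intro z. apply C_eq; unfold Re, Im; simpl; field. }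
  assert (Hpos : forall j, (2 <= j)%nat -> (j <= k)%nat -> diag_value T j = al + be * sgn j).
  { intros j Hj Hjk. unfold diag_value, T, coef_add, coef_scal, flux_part, order_0_part.
    rewrite star_single, leibniz_diag by assumption. rewrite (single_other j 1), !(single_other j 0) by lia.
    unfold single. rewrite Nat.eqb_refl. ring. }
  assert (S0 : sgn 0 = 1) by (unfold sgn; apply C_eq; simpl; ring).
  assert (S1 : sgn 1 = -1) by (unfold sgn; apply C_eq; simpl; ring).
  assert (S2 : sgn 2 = 1) by (unfold sgn; apply C_eq; simpl; ring).
  assert (S3 : sgn 3 = -1) by (unfold sgn; apply C_eq; simpl; ring).
  exists T. split; [|split; [|split; [|split; [|split]]]].
  - unfold T. repeat apply in_I_add; apply in_I_scal.
    + apply in_I_id.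
    + apply star_in_I.
    + apply flux_part_in_I.
    + apply order_0_part_in_I.
    + apply (in_I_comp MR 0 1 k order_0_part (star k)); [apply order_0_part_in_I|apply star_in_I].
  - unfold diag_value, T, coef_add, coef_scal, flux_part, order_0_part.
    rewrite star_single, leibniz_diag by (unfold k; lia). rewrite !(single_other 1 0) by lia.
    rewrite !single_same, flux_one, S1. unfold ga. ring.
  - unfold d_value, T, coef_add, coef_scal, flux_part, order_0_part.
    rewrite (single_other 0 1 xfun), (single_other 0 1 (flux _ _ _)), !single_same by lia.
    rewrite !star_single, (single_other 0 1) by (unfold k; lia).
    replace (leibniz 1 xfun 0%nat 0%R) with (RtoC 1).
    + rewrite S1. unfold ze'. ring.
    + simpl. unfold Dl. change (single 0 xfun 0%nat) with xfun. unfold xfun.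
      rewrite (CD_RtoC (fun x => x)), Derive_id. ring.
  - unfold diag_value, T, coef_add, coef_scal, flux_part, order_0_part.
    rewrite (single_other 0 1), !single_same by lia.
    rewrite !star_single, !leibniz_diag by lia. rewrite S0. unfold ze. ring.
  - intro H2. rewrite Hpos by (assumption || lia). rewrite S2.
    rewrite <- (Half s0) at 1. unfold al, be. ring.
  - intro H3. rewrite Hpos by (assumption || lia). rewrite S3.
    rewrite <- (Half s1) at 1. unfold al, be. ring.
Qed.

Lemma coordinates_injective n k T U : in_I MR k 0 1 T -> in_I MR k 0 1 U ->
  (S n <= k)%nat -> (n = 2%nat \/ k = S n) ->
  diag_value T 1 = diag_value U 1 -> d_value T = d_value U -> diag_value T 0 = diag_value U 0 ->
  (forall j, (j < n)%nat -> diag_value T (j + 2) = diag_value U (j + 2)) ->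
  forall a, validop MR k a -> coef_eq (T a) (U a).
Proof.
  intros HT HU Hn Hnk E1 Ed E0 Ej a Ha i x.
  set (V := fun a => coef_add (T a) (coef_scal (RtoC (-1)) (U a))).
  assert (HV : in_I MR k 0 1 V) by (apply in_I_add; [assumption|now apply in_I_scal]).
  assert (Z : V a i x = 0).
  { apply (T_vanishes k V HV n); try assumption; try lia;
      unfold V, coef_add, coef_scal.
    - change (diag_value T 0 + RtoC (-1) * diag_value U 0 = 0). rewrite E0. ring.
    - change (diag_value T 1 + RtoC (-1) * diag_value U 1 = 0). rewrite E1. ring.
    - change (d_value T + RtoC (-1) * d_value U = 0). rewrite Ed. ring.
    - intros j Hj.
      change (diag_value T (j + 2) + RtoC (-1) * diag_value U (j + 2) = 0). rewrite Ej by assumption. ring. }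
  unfold V, coef_add, coef_scal in Z.
  transitivity (U a i x + (T a i x + RtoC (-1) * U a i x)); [ring|]. rewrite Z. ring.
Qed.

Lemma exceptional_iso n k : (n <= 2)%nat -> (S n <= k)%nat -> (n = 2%nat \/ k = S n) ->
  alg_iso (IAlg MR k 0 1) (T2plus n).
Proof.
  intros Hn2 Hn Hnk. exists (coordinates n). simpl.
  assert (V1 : forall j, (j < n)%nat -> (j + 2 <= k)%nat) by (intros; lia).
  split; [|split; [|split; [|split; [|split; [|split]]]]].
  - intros T HT j Hj. destruct (Nat.ltb_spec j n); [lia|reflexivity].
  - intros T U HT HU. split.
    + intro H. unfold diag_value, d_value. split.
      * rewrite !(H _ (valid_one k 1 ltac:(lia))), !(H _ (valid_one k 0 ltac:(lia))),
          (H _ (valid_x k 1 ltac:(lia))). reflexivity.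
      * intro j. destruct (Nat.ltb_spec j n); [|reflexivity].
        apply H. apply valid_one. auto.
    + intros [H1 H2]. injection H1 as E1 Ed E0.
      apply (coordinates_injective n); try assumption.
      intros j Hj. specialize (H2 j). now destruct (Nat.ltb_spec j n); [|lia].
  - intros [[[p q] r] s] Hs. simpl in Hs. destruct k as [|K]; [lia|].
    destruct (coordinates_onto K p q r (s 0%nat) (s 1%nat)) as [T [HT [E1 [Ed [E0 [E2 E3]]]]]].
    exists T. split; [assumption|]. simpl. split; [now rewrite E1, Ed, E0|].
    intro j. destruct (Nat.ltb_spec j n) as [L|L].
    + destruct j as [|[|j]]; [apply E2; lia|apply E3; lia|lia].
    + symmetry. now apply Hs.
  - intros T U HT HU. split; [reflexivity|]. intro j.
    destruct (Nat.ltb j n); [reflexivity|]. ring.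
  - intros T U HT HU. split.
    + rewrite !(diag_value_comp k T U), (d_value_comp k T U) by (assumption || lia). reflexivity.
    + intro j. destruct (Nat.ltb_spec j n); [|ring].
      apply (diag_value_comp k T U); auto.
  - intros c T HT. split; [reflexivity|]. intro j.
    destruct (Nat.ltb j n); [reflexivity|]. ring.
  - split.
    + reflexivity.
    + intro j. destruct (Nat.ltb j n); [|reflexivity].
      unfold diag_value, single. now rewrite Nat.eqb_refl.
Qed.

End ExceptionalIso.

Theorem theorem3p6 (k : nat) (l m : C) :
  (1 <= k)%nat ->
  ((l, m) <> (RtoC 0, RtoC 1) -> alg_iso (IAlg MR k l m) (IAlg MS1 k l m)) /\
  ((l, m) = (RtoC 0, RtoC 1) ->
     ((3 <= k)%nat -> alg_iso (IAlg MR k l m) (T2plus 2)) /\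
     (k = 2%nat -> alg_iso (IAlg MR k l m) (T2plus 1)) /\
     (k = 1%nat -> alg_iso (IAlg MR k l m) (T2plus 0))).
Proof.
  intro Hk. split; [apply line_circle_iso|].
  intro E. injection E as -> ->. split; [|split].
  - intro H. apply exceptional_iso; lia.
  - intros ->. apply exceptional_iso; lia.
  - intros ->. apply exceptional_iso; lia.
Qed.
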